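(* Let $q$ be a prime power and let $A \subset \mathbb{F}_q[x]$ be a primitive set of monic polynomials with $A \neq \{1\}$. If $3 \le q \le 19$, then $$\mathcal{F}(A) \le e^{\gamma} = 1.78107\ldots,$$ and if $q > 19$, then $$\mathcal{F}(A) \le 1 + e^{\gamma}\left(1-\frac{1}{q}\right)^q + \sum_{\substack{p \in \mathcal{I}_q \\ \deg p > 1}} \frac{1}{\|p\|(\deg p + 1)(\deg p)} < 1 + e^{\gamma - 1} + \frac{\pi^2 - 9}{6} = 1.80015\ldots.$$
   Context: $\mathbb{F}_q$ is the finite field with $q$ elements. A set $A \subset \mathbb{F}_q[x]$ of monic polynomials is primitive if no element of $A$ divides another (distinct) element of $A$. For $f \in \mathbb{F}_q[x]$ nonzero, $\|f\| = q^{\deg f}$. For a set $A$ of monic polynomials, $\mathcal{F}(A) = \sum_{a \in A} \frac{1}{\|a\| \deg a}$. $\mathcal{I}_q$ is the set of monic irreducible polynomials in $\mathbb{F}_q[x]$. $\gamma = 0.577215\ldots$ is the Euler–Mascheroni constant. *)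

(* Defs.v *)
From mathcomp Require Import all_boot all_order all_algebra.
From mathcomp Require Import all_classical all_reals all_analysis.

Set Implicit Arguments.
Unset Strict Implicit.
Unset Printing Implicit Defensive.

Import Order.TTheory GRing.Theory Num.Theory.
Import numFieldNormedType.Exports.

Local Open Scope classical_set_scope.
Local Open Scope ring_scope.

Section FunctionField.
Variable F : finFieldType.
Implicit Types (f a b p : {poly F}) (A : set {poly F}).

(* Only meaningful for f != 0; pdeg 0 = 0. *)
Definition pdeg f : nat := (size f).-1.

Definition pnorm f : nat := (#|F| ^ pdeg f)%N.

Definition monic_set A := forall a, A a -> a \is monic.

Definition primitive_set A := forall a b, A a -> A b -> a %| b -> a = b.

Definition monic_irreducibles : set {poly F} :=
  [set p | p \is monic /\ irreducible_poly p].

(* The terms are nonnegative, so the unordered sum is taken in [0, +oo].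
   A constant polynomial contributes 0, since 0^-1 = 0; a primitive set other
   than {1} contains no monic constant. *)
Definition erdos_sum (R : realType) A : \bar R :=
  \esum_(a in A) (((pnorm a)%:R * (pdeg a)%:R)^-1)%:E.

End FunctionField.

(* series harmonic n = 1 + 1/2 + ... + 1/n *)
Definition euler_gamma (R : realType) : R :=
  limn (fun n : nat => series harmonic n - ln (n%:R : R)).
Arguments euler_gamma {R}.

(* Main.v *)
(* For an ordering p_1, p_2, ... of the monic irreducibles, give a polynomial a
   with last prime factor p_k the weight
     W(a) = |a|^-1 * prod_{i < k} (1 - |p_i|^-1),
   the density of the multiples a * b with b prime to p_1, ..., p_{k-1}. For a
   primitive A these sets of multiples are disjoint, so that the weights sum to at
   most 1 (Erdos). If C * (deg p + 1) times the product of 1 - |r|^-1 over the r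
   preceding p is at least 1 for every irreducible p outside A, then
   1 / (|a| deg a) <= C * W(a) for every reducible a in A, because deg a exceeds
   the degree of its last factor, and F(A) is at most C plus the excess of
   1 / (|p| deg p) over C * W(p) on the irreducible members p of A.

   The ordering depends on A and is by degree, the members of A coming first in
   each degree. Let j be the number of linear polynomials in A, y = 1/q and
   g = e^gamma. With C = g, an explicit Mertens estimate gives
     F(A) <= j y + g (1 - y)^j + sum over the p in A with deg p > 1 of
             1 / (|p| deg p (deg p + 1)),
   and the first two terms increase in j as soon as g (1 - y)^j < 1, which leads
   to j = q. When 3 j <= q this does not suffice; instead, the irreducible members
   of A of small degree at least 2 are moved to the front of the ordering, and
   another choice of C gives F(A) <= g. Finally, 1 + g (1 - y)^q plus the sum over
   irreducibles is at most g for q <= 19 and at least g for q >= 23, and 20, 21, 22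
   are not prime powers.

   The Mertens estimate comes from sum_{d | m} d * pi(d) = q^m, which follows from
   the factorization of X^(q^m) - X. *)

Require Import Defs.
From mathcomp Require Import all_boot all_order all_algebra.
From mathcomp Require Import all_classical all_reals all_analysis.
From mathcomp Require Import finfield qfpoly.
From mathcomp Require Import ring lra zify.

Set Implicit Arguments.
Unset Strict Implicit.
Unset Printing Implicit Defensive.

Import Order.TTheory GRing.Theory Num.Theory.
Import numFieldNormedType.Exports.

Local Open Scope classical_set_scope.
Local Open Scope ring_scope.

(** * The weights of a primitive set *)

(** At j = 0 the bound for the plain ordering is g plus a positive sum over the irreducible members
    of degree at least 2, so it exceeds g as soon as there is one; this is why few linear members
    need another ordering. At the front the contribution of those members is known exactly: if sigma
    is their Erdos sum and T the product of their 1 - 1/|p|, the front turns C into C T + sigma, and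
    C = (g - sigma) / T makes this equal to g. It remains to see that the later members have excess
    at most 0. Beyond a cutoff this holds already with g in place of C, by a second-order Mertens
    estimate; so only small degrees are moved, and the front stays light enough for the condition on
    irreducibles outside A. That condition concerns (n + 1) M(n), where M(n) is the product over all
    irreducibles of degree at most n. The Mertens bound for g n M(n) loses about 1/(2n), while n + 1
    in place of n gains 1/n; the difference pays for the errors when n is large, and tables by
    ranges of q treat small n. Infinite sets need no separate argument: the Erdos sum is a supremum
    over finite subsets, and these inherit primitivity. *)

(* The weight W of the polynomial with exponent vector e, where x lists the
   inverse norms of the irreducibles. *)
Fixpoint last_factor_weight (R : realType) (x : seq R) (e : seq nat) : R :=
  match x, e with
  | y :: x', k :: e' =>
      y ^+ k * (if all (fun n => n == 0)%N e' then 1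
                else (1 - y) * last_factor_weight x' e')
  | _, _ => 1
  end.

Lemma all2_leq_zero (e f : seq nat) :
  size e = size f -> all (fun n => n == 0)%N e -> all2 leq e f.
Proof.
by elim: e f => [|k e IH] [|l f] //= [sef] /andP[/eqP-> e0]; rewrite IH.
Qed.

(* Induction on x and, inside, on a bound for the first entries: an antichain
   splits into the vectors with first entry 0 and the others, whose first entry
   is lowered by 1. *)
Lemma antichain_weight_le1 (R : realType) (x : seq R) (A : seq (seq nat)) :
  all (fun y => 0 <= y <= 1) x -> uniq A ->
  {in A, forall e, size e = size x} ->
  {in A &, forall e f, all2 leq e f -> e = f} ->
  \sum_(e <- A) last_factor_weight x e <= 1.
Proof.
elim: x A => [|y x IHx] A /=.
  move=> _ uA sA _.
  case: A uA sA => [|a [|b A]] //=; rewrite ?big_nil ?big_seq1//.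
  move=> /and3P[+ _ _] sA.
  have /size0nil-> : size a = 0%N by apply: sA; rewrite inE eqxx.
  have /size0nil-> : size b = 0%N by apply: sA; rewrite !inE eqxx orbT.
  by rewrite inE eqxx.
move=> /andP[/andP[y0 y1] xP] uA sA acA.
have [n nP] : exists n, {in A, forall e, head 0 e < n}%N.
  exists (\max_(e <- A) (head 0 e)).+1%N => e eA.
  by rewrite ltnS; exact: (@leq_bigmax_seq _ A xpredT).
elim: n A uA sA acA nP => [|n IHn] A uA sA acA nP.
  case: A nP {uA sA acA} => [_|a A /(_ a)]; first by rewrite big_nil.
  by rewrite inE eqxx => /(_ isT).
(* The zero vector lies below all others, so an antichain containing it is a singleton. Once it is
   excluded, a vector with first entry 0 always takes the [1 - y] branch of the weight. *)
have [/hasP[z zA z0]|noz] := boolP (has (all (fun n => n == 0)%N) A).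
  have eqz e : e \in A -> e = z.
    move=> eA; apply/esym/acA => //; apply: all2_leq_zero => //.
    by rewrite !sA.
  have -> : A = [:: z].
    apply: perm_small_eq => //; apply: uniq_perm => // e; rewrite inE.
    by apply/idP/eqP => [/eqz//|->].
  have := sA _ zA; rewrite big_seq1.
  by case: z z0 {zA eqz} => // k z /= /andP[/eqP-> ->] _; rewrite mulr1.
have nzA e : e \in A -> ~~ all (fun n => n == 0)%N e.
  by move=> eA; apply: contra noz => ?; apply/hasP; exists e.
rewrite (bigID (fun e => head 0 e == 0)%N) /=.
set A0 := [seq behead e | e <- A & head 0%N e == 0%N].
set A1 := [seq (head 0%N e).-1 :: behead e | e <- A & head 0%N e != 0%N].
have -> : \sum_(e <- A | head 0%N e == 0%N) last_factor_weight (y :: x) e =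
    (1 - y) * \sum_(e <- A0) last_factor_weight x e.
  rewrite big_map big_filter mulr_sumr big_seq_cond [RHS]big_seq_cond.
  apply: eq_bigr => e /andP[eA]; have := nzA _ eA; have := sA _ eA.
  by case: e eA => //= k e _ _ + /eqP k0; rewrite k0 /= expr0 mul1r => /negbTE->.
have -> : \sum_(e <- A | head 0%N e != 0%N) last_factor_weight (y :: x) e =
    y * \sum_(e <- A1) last_factor_weight (y :: x) e.
  rewrite big_map big_filter mulr_sumr big_seq_cond [RHS]big_seq_cond.
  apply: eq_bigr => e /andP[eA]; have := sA _ eA.
  by case: e eA => //= -[//|k] e _ _ _; rewrite mulrA -exprS.
have A0P : \sum_(e <- A0) last_factor_weight x e <= 1.
  apply: IHx => //.
  - rewrite map_inj_in_uniq ?filter_uniq// => e f.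
    rewrite !mem_filter => /andP[/eqP e0 /sA se] /andP[/eqP f0 /sA sf].
    by case: e f e0 se f0 sf => //= k e [] //= l f -> _ -> _ ->.
  - move=> _ /mapP[e + ->]; rewrite mem_filter => /andP[_ /sA].
    by case: e => //= k e [].
  - move=> _ _ /mapP[e + ->] /mapP[f + ->].
    rewrite !mem_filter => /andP[/eqP e0 eA] /andP[/eqP f0 fA] ef.
    congr behead; apply: acA => //.
    by have := sA _ eA; have := sA _ fA; case: e f e0 f0 ef {eA fA} => //= ? ? [] //= ? ? -> ->.
have A1P : \sum_(e <- A1) last_factor_weight (y :: x) e <= 1.
  apply: IHn => //.
  - rewrite map_inj_in_uniq ?filter_uniq// => e f.
    rewrite !mem_filter => /andP[e0 /sA se] /andP[f0 /sA sf].
    by case: e f e0 se f0 sf => //= -[//|k] e [] //= [//|l] f _ _ _ _ [-> ->].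
  - move=> _ /mapP[e + ->]; rewrite mem_filter => /andP[_ /sA].
    by case: e => //= k e [->].
  - move=> _ _ /mapP[e + ->] /mapP[f + ->].
    rewrite !mem_filter => /andP[e0 eA] /andP[f0 fA] ef.
    suff -> : e = f by [].
    apply: acA => //; have := sA _ eA; have := sA _ fA.
    by case: e f e0 f0 ef {eA fA} => [//|[//|k] e] [//|[//|l] f].
  - move=> _ /mapP[e + ->]; rewrite mem_filter => /andP[e0 /nP] /=.
    by case: (head _ _) e0.
apply: le_trans (_ : (1 - y) * 1 + y * 1 <= _); last by lra.
by rewrite lerD// ler_wpM2l// subr_ge0.
Qed.

Definition smooth_poly (F : fieldType) (s : seq {poly F}) (e : seq nat) : {poly F} :=
  \prod_(pk <- zip s e) pk.1 ^+ pk.2.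

Lemma smooth_poly_dvdp (F : fieldType) (s : seq {poly F}) (e f : seq nat) :
  size e = size s -> size f = size s -> all2 leq e f ->
  smooth_poly s e %| smooth_poly s f.
Proof.
elim: s e f => [|p s IH] [|k e] [|l f] //=.
move=> [se] [sf] /andP[kl ef]; rewrite /smooth_poly /= !big_cons /=.
by apply: dvdp_mul; [exact: dvdp_exp2l|exact: IH].
Qed.

Section SmoothWeight.
Variables (R : realType) (F : finFieldType).
Implicit Types (s : seq {poly F}) (p a : {poly F}).

Definition inv_norm p : R := (pnorm p)%:R^-1.

Lemma pnorm_gt0 p : (0 < pnorm p)%N.
Proof. by rewrite expn_gt0 (ltn_trans _ (finNzRing_gt1 F)). Qed.

Lemma pnormM p a : p != 0 -> a != 0 -> pnorm (p * a) = (pnorm p * pnorm a)%N.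
Proof.
move=> p0 a0; rewrite /pnorm -expnD /pdeg size_mul//.
congr expn; move: p0 a0; rewrite -!size_poly_gt0.
by case: (size p) (size a) => [//|m] [//|n] _ _; rewrite addnS.
Qed.

Lemma pnorm1 : pnorm (1 : {poly F}) = 1%N.
Proof. by rewrite /pnorm /pdeg size_poly1. Qed.

Lemma inv_normM p a : p != 0 -> a != 0 -> inv_norm (p * a) = inv_norm p * inv_norm a.
Proof. by move=> p0 a0; rewrite /inv_norm pnormM// natrM invfM. Qed.

Lemma inv_normX p k : p != 0 -> inv_norm (p ^+ k) = inv_norm p ^+ k.
Proof.
move=> p0; elim: k => [|k IH]; first by rewrite !expr0 /inv_norm pnorm1 invr1.
by rewrite !exprS inv_normM ?expf_neq0// IH.
Qed.

Lemma inv_norm_itv p : 0 <= inv_norm p <= 1.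
Proof.
rewrite invr_ge0 ler0n /= invf_le1 ?ltr0n ?pnorm_gt0//.
by rewrite ler1n pnorm_gt0.
Qed.

Lemma all_inv_norm_itv s : all (fun y => 0 <= y <= 1) (map inv_norm s).
Proof. by apply/allP => _ /mapP[p _ ->]; exact: inv_norm_itv. Qed.

Lemma smooth_poly_neq0 s e : {in s, forall p, p != 0} -> smooth_poly s e != 0.
Proof.
move=> s0; rewrite /smooth_poly big_seq prodf_seq_neq0; apply/allP => -[p k] /= pk.
apply/implyP => _; rewrite expf_neq0// s0//.
by move: pk => /(map_f fst) /=; elim: (s) (e) => [|? ? IH] [|? ?] //=; rewrite !inE => /orP[->//|/IH->]; rewrite orbT.
Qed.

(** The [p] found is the entry of largest index with nonzero exponent: every entry before it
    contributes a factor [1 - y] to the recursion, whatever its own exponent. *)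
Lemma last_factor_weightE s e : uniq s -> {in s, forall p, p != 0} ->
  size e = size s -> ~~ all (fun n => n == 0)%N e ->
  exists2 p, p \in s &
    p %| smooth_poly s e /\
    last_factor_weight (map inv_norm s) e =
    inv_norm (smooth_poly s e) * \prod_(r <- take (index p s) s) (1 - inv_norm r).
Proof.
elim: s e => [|p s IH] [|k e] //= /andP[ps us] s0 [se].
have p0 : p != 0 by apply: s0; rewrite inE eqxx.
have s0' : {in s, forall p, p != 0} by move=> r rs; apply: s0; rewrite inE rs orbT.
have sE : smooth_poly (p :: s) (k :: e) = p ^+ k * smooth_poly s e.
  by rewrite /smooth_poly /= big_cons.
rewrite sE inv_normM ?expf_neq0 ?smooth_poly_neq0 ?inv_normX//.
case: ifPn => [e0|e0 _].
  have s1 : smooth_poly s e = 1.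
    rewrite /smooth_poly big_seq big1// => -[r l] /= /(map_f snd) /= rl.
    suff /eqP-> : l == 0%N by [].
    move: rl; elim: (s) (e) e0 => [|? ? IH'] [|? ?] //= /andP[? ?].
    by rewrite inE => /orP[/eqP->//|/IH']; exact.
  rewrite andbT => k0; exists p; first by rewrite inE eqxx.
  rewrite eqxx /= big_nil s1 /inv_norm pnorm1 invr1 !mulr1; split=> //.
  by case: (k) k0 => // l _; rewrite exprS dvdp_mulr.
have [r rs [rd ->]] := IH _ us s0' se e0.
exists r; first by rewrite inE rs orbT.
have /negbTE-> : p != r by apply: contraNneq ps => ->.
split; first exact: dvdp_mull.
by rewrite /= big_cons; ring.
Qed.
End SmoothWeight.

Section Factorization.
Variable F : finFieldType.
Implicit Types (s : seq {poly F}) (p a : {poly F}).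

Lemma monic_irreducible_dvdp a : (1 < size a)%N ->
  exists p, monic_irreducibles p /\ p %| a.
Proof.
have [n] := ubnP (size a); elim: n a => // n IH a sa a1.
have [|nia] := pselect (irreducible_poly a) => [ia|].
  have a0 : a != 0 by rewrite -size_poly_gt0 ltnW.
  have la : (lead_coef a)^-1 != 0 by rewrite invr_eq0 lead_coef_eq0.
  exists ((lead_coef a)^-1 *: a); split; last by rewrite dvdpZl.
  split; first by rewrite monicE lead_coefZ mulVf// lead_coef_eq0.
  split; first by rewrite size_scale.
  by move=> r r1; rewrite dvdpZr// eqp_sym (eqp_ltrans (eqp_scale _ _))// eqp_sym; exact: ia.2.
have [r [r1 ra nra]] : exists r : {poly F}, [/\ size r != 1%N, r %| a & ~~ (r %= a)].
  apply: contrapT => nex; apply: nia; split=> // r r1 ra.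
  by apply: contrapT => /negP nr; apply: nex; exists r.
have a0 : a != 0 by rewrite -size_poly_gt0 ltnW.
have r0 : r != 0 by apply: contraNneq a0 => r0; rewrite r0 dvd0p in ra.
have sr : (size r < size a)%N.
  by rewrite ltn_neqAle dvdp_leq// andbT (dvdp_size_eqp ra).
have [||p [ip pr]] := IH r; first exact: leq_trans sr _.
  by rewrite ltn_neqAle eq_sym r1 size_poly_gt0.
by exists p; split=> //; exact: dvdp_trans pr ra.
Qed.

Lemma smooth_poly_incr s e p : size e = size s -> p \in s ->
  smooth_poly s (incr_nth e (index p s)) = p * smooth_poly s e.
Proof.
elim: s e => [|r s IH] [|k e] //= [se]; rewrite inE.
have [->|rp] /= := eqVneq p r.
  by rewrite /smooth_poly /= !big_cons /= exprS mulrA.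
move=> ps; rewrite /smooth_poly /= !big_cons /=.
by have := IH e se ps; rewrite /smooth_poly => ->; rewrite mulrCA.
Qed.

Lemma smooth_poly_surj s a : a \is monic ->
  (forall p, monic_irreducibles p -> p %| a -> p \in s) ->
  exists2 e, size e = size s & smooth_poly s e = a.
Proof.
have [n] := ubnP (size a); elim: n a => // n IH a sa am sP.
have a0 := monic_neq0 am.
have [a1|a1] := leqP (size a) 1.
  exists (nseq (size s) 0%N); first by rewrite size_nseq.
  have -> : a = 1.
    apply/eqP; rewrite -(eqp_monic am (monic1 _)) -size_poly_eq1.
    by rewrite eqn_leq a1 size_poly_gt0.
  rewrite /smooth_poly; elim: (s) => [|? ? IHs] /=; first by rewrite big_nil.
  by rewrite big_cons IHs expr0 mulr1.
have [p [pI pa]] := monic_irreducible_dvdp a1.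
have [b aE] := dvdpP _ _ pa.
have bm : b \is monic by rewrite -(monicMr _ pI.1) -aE.
have [||e se be] := IH b _ bm.
- move: sa; rewrite aE size_Mmonic ?monic_neq0 ?pI.1//.
  have := pI.2.1; have := monic_neq0 bm; rewrite -size_poly_gt0.
  by case: (size p) => [|[|k]]//; move=> _ _; rewrite !addnS /= ltnS; apply: leq_ltn_trans; exact: leq_addr.
- by move=> r rI rb; apply: sP => //; rewrite aE dvdp_mulr.
- exists (incr_nth e (index p s)).
    by rewrite size_incr_nth se index_mem sP.
  by rewrite smooth_poly_incr ?sP// be aE mulrC.
Qed.
End Factorization.

(** * The weight bound with a correction for irreducible members *)

Section Excess.
Variables (R : realType) (F : finFieldType).
Implicit Types (s A : seq {poly F}) (p a : {poly F}).
Local Notation x := (@inv_norm R F).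

Definition erdos_term a : R := ((pnorm a)%:R * (pdeg a)%:R)^-1.

Lemma erdos_termE a : erdos_term a = x a / (pdeg a)%:R.
Proof. by rewrite /erdos_term invfM. Qed.

(* P is the constant C times the product of 1 - 1/|r| over the irreducibles r
   already passed in the ordering. *)
Fixpoint excess A (P : R) s : R :=
  if s is p :: s' then
    (if p \in A then erdos_term p - P * x p else 0)
    + excess A (P * (1 - x p)) s'
  else 0.

Definition coprod s : R := \prod_(p <- s) (1 - x p).

Lemma excessE A P s : uniq s -> excess A P s =
  \sum_(p <- s | p \in A) (erdos_term p - P * x p * coprod (take (index p s) s)).
Proof.
elim: s P => [|p s IH] P /=; first by rewrite big_nil.
move=> /andP[ps us]; rewrite big_cons IH// eqxx /= /coprod big_nil mulr1.
have -> : \sum_(r <- s | r \in A) (erdos_term r - P * (1 - x p) * x r *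
     \prod_(i <- take (index r s) s) (1 - x i)) =
   \sum_(r <- s | r \in A) (erdos_term r - P * x r *
     \prod_(i <- take (if p == r then 0%N else (index r s).+1) (p :: s)) (1 - x i)).
  rewrite big_seq_cond [RHS]big_seq_cond; apply: eq_bigr => r /andP[rs _].
  have /negbTE-> : p != r by apply: contraNneq ps => ->.
  by rewrite /= big_cons; ring.
by case: ifP => // _; rewrite add0r.
Qed.

Lemma excess_cat A P s t : excess A P (s ++ t) = excess A P s + excess A (P * coprod s) t.
Proof.
elim: s P => [|p s IH] P /=; first by rewrite add0r /coprod big_nil mulr1.
by rewrite IH addrA /coprod big_cons mulrA.
Qed.

Lemma coprod_cat s t : coprod (s ++ t) = coprod s * coprod t.
Proof. by rewrite /coprod big_cat. Qed.

Lemma onem_inv_norm_itv p : 0 <= 1 - x p <= 1.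
Proof. have /andP[] := inv_norm_itv R p => ? ?; lra. Qed.

Lemma coprod_itv s : 0 <= coprod s <= 1.
Proof.
rewrite /coprod; elim: s => [|p s /andP[IH0 IH1]]; first by rewrite big_nil ler01 lexx.
rewrite big_cons; have /andP[p0 p1] := onem_inv_norm_itv p.
by rewrite mulr_ge0//= mulr_ile1.
Qed.

Lemma coprod_sub s t : uniq s -> {subset s <= t} -> coprod t <= coprod s.
Proof.
elim: s t => [|p s IH] t /=; first by rewrite {2}/coprod big_nil => _ _; have /andP[] := coprod_itv t.
move=> /andP[ps us] st; have pt : p \in t by apply: st; rewrite inE eqxx.
rewrite /coprod (perm_big _ (perm_to_rem pt)) /= !big_cons.
have /andP[p0 p1] := onem_inv_norm_itv p; apply: ler_wpM2l => //; apply: IH => // r rs.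
by apply: rem_mem; [apply: contraNneq ps => <-|apply: st; rewrite inE rs orbT].
Qed.

(** Primitivity enters twice: it makes the exponent vectors an antichain, so that the weights sum to
    at most 1, and it keeps the last factor of a reducible member outside [A], where the hypothesis
    on [C] is available. *)
Lemma erdos_sum_le_excess s A (C : R) : 0 <= C -> uniq s -> uniq A ->
  {in s, forall p, monic_irreducibles p} ->
  {in A &, forall a b, a %| b -> a = b} ->
  {in A, forall a, a \is monic /\ (1 < size a)%N} ->
  {in A, forall a p, monic_irreducibles p -> p %| a -> p \in s} ->
  {in s, forall p, p \notin A ->
     1 <= C * (pdeg p).+1%:R * coprod (take (index p s) s)} ->
  \sum_(a <- A) erdos_term a <= C + excess A C s.
Proof.
move=> C0 us uA sI primA monA facA sC.
have s0 : {in s, forall p, p != 0} by move=> p /sI[/monic_neq0].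
have /choice[e eP] : forall a, exists e : seq nat,
    a \in A -> size e = size s /\ smooth_poly s e = a.
  move=> a; have [aA|] := boolP (a \in A); last by exists [::].
  have [e se ea] := smooth_poly_surj (monA _ aA).1 (facA _ aA).
  by exists e.
pose w a := last_factor_weight (map x s) (e a).
have sumw : \sum_(a <- A) w a <= 1.
  have -> : \sum_(a <- A) w a = \sum_(f <- map e A) last_factor_weight (map x s) f.
    by rewrite big_map.
  apply: antichain_weight_le1 => //.
  - exact: all_inv_norm_itv.
  - rewrite map_inj_in_uniq// => a b aA bA eab.
    by rewrite -(eP _ aA).2 -(eP _ bA).2 eab.
  - by move=> _ /mapP[a aA ->]; rewrite size_map (eP _ aA).1.
  - move=> _ _ /mapP[a aA ->] /mapP[b bA ->] ab; congr e.
    apply: primA => //; rewrite -(eP _ aA).2 -(eP _ bA).2.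
    by apply: smooth_poly_dvdp; rewrite ?(eP _ aA).1 ?(eP _ bA).1.
have wP a : a \in A -> exists2 p, p \in s &
    p %| a /\ w a = x a * coprod (take (index p s) s).
  move=> aA; have [|p ps] := @last_factor_weightE R F s (e a) us s0 (eP _ aA).1.
    apply: contraL (monA _ aA).2 => ea0; rewrite -leqNgt -(eP _ aA).2.
    rewrite /smooth_poly big_seq big1 ?size_poly1// => -[r l] /= /(map_f snd) /= rl.
    suff /eqP-> : l == 0%N by [].
    move: rl; elim: (s) (e a) ea0 => [|? ? IH'] [|? ?] //= /andP[? ?].
    by rewrite inE => /orP[/eqP->//|/IH']; exact.
  by rewrite (eP _ aA).2 => -[pa wa]; exists p.
have wirr p : p \in s -> p \in A -> w p = x p * coprod (take (index p s) s).
  move=> ps pA; have [r rs [rp ->]] := wP _ pA.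
  suff -> : r = p by [].
  apply/eqP; rewrite -(eqp_monic (sI _ rs).1 (sI _ ps).1).
  apply: (sI _ ps).2.2 => //.
  by have := (sI _ rs).2.1; case: (size r) => [|[|]].
have ineq a : a \in A ->
    erdos_term a <= C * w a + (if a \in s then erdos_term a - C * w a else 0).
  move=> aA; case: ifPn => [_|as_]; first lra.
  have [p ps [pa waE]] := wP _ aA; rewrite addr0 waE erdos_termE mulrCA.
  have /andP[xa0 xa1] := inv_norm_itv R a.
  apply: ler_wpM2l => //.
  (* A last factor in [A] would divide [a] and hence equal it, but [p] is in [s] and [a] is not. *)
  have pA : p \notin A.
    apply: contra as_ => pA; suff <- : p = a by [].
    exact: primA.
  have pdegS : (pdeg p < pdeg a)%N.
    have [b aE] := dvdpP _ _ pa.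
    have bm : b \is monic by rewrite -(monicMr _ (sI _ ps).1) -aE (monA _ aA).1.
    have b1 : (size b != 1)%N.
      apply: contra as_; rewrite (size_poly_eq1 b) => b1; suff <- : p = a by [].
      rewrite aE; have /eqP-> : b == 1 by rewrite -eqp_monic ?monic1.
      by rewrite mul1r.
    rewrite /pdeg aE size_Mmonic ?monic_neq0// ?(sI _ ps).1//.
    have := (sI _ ps).2.1; move: b1; have := monic_neq0 bm; rewrite -size_poly_gt0.
    case: (size b) => [|[|k]] // _ _; case: (size p) => [|[|l]] // _.
    by rewrite !addnS !addSn /= !ltnS leq_addl.
  have sCp := sC _ ps pA.
  rewrite -[leLHS]mul1r lter_pdivrMr ?ltr0n ?(leq_trans _ pdegS)//.
  apply: le_trans sCp _; rewrite mulrAC ler_wpM2l//.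
    by rewrite mulr_ge0//; have /andP[] := coprod_itv (take (index p s) s).
  by rewrite ler_nat.
rewrite big_seq; apply: le_trans (ler_sum _ ineq) _; rewrite -big_seq big_split /=.
apply: lerD.
  by rewrite -mulr_sumr -[leRHS]mulr1 ler_wpM2l.
rewrite excessE// -big_mkcond /= -[leLHS]big_filter -[leRHS]big_filter.
rewrite (perm_big [seq a <- s | a \in A]) /=; last first.
  apply: uniq_perm; rewrite ?filter_uniq// => a.
  by rewrite !mem_filter andbC.
rewrite big_seq [leRHS]big_seq le_eqVlt; apply/orP; left; apply/eqP.
apply: eq_bigr => p; rewrite mem_filter => /andP[pA ps].
by rewrite wirr// mulrA.
Qed.
End Excess.

(** * Numerical constants *)

Section RealBounds.
Variable R : realType.
Implicit Types (x t : R).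

Lemma le_of_derive_ge0 (f df : R -> R) (b : R) : 0 <= b ->
  (forall x, 0 <= x <= b -> is_derive x 1 f (df x)) ->
  (forall x, 0 <= x <= b -> 0 <= df x) -> f 0 <= f b.
Proof.
move=> b0 fdf df0; rewrite -subr_ge0.
have fdf' x : x \in `[0, b] -> is_derive x 1 f (df x).
  by rewrite in_itv/=; exact: fdf.
have df' x : x \in `]0, b[ -> is_derive x 1 f (df x).
  by rewrite in_itv/= => /andP[? ?]; apply: fdf; rewrite !ltW.
have cf : {within `[0, b], continuous f}.
  by apply: derivable_within_continuous => x /fdf'[].
have [c cb fE] := MVT_segment b0 df' cf.
move: cb; rewrite fE in_itv/= => /df0 ?.
by rewrite mulr_ge0// subr_ge0.
Qed.

Lemma is_derive_ln1D x : -1 < x -> is_derive x 1 (fun t => ln (1 + t)) (1 + x)^-1.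
Proof.
move=> x1; have d1 : is_derive x 1 (fun t : R => 1 + t) 1.
  by have := is_deriveD (is_derive_cst (1 : R) x 1) (is_derive_id x 1); rewrite add0r.
have x1' : 0 < 1 + x by lra.
have := @is_derive1_comp R (@ln R) (fun t => 1 + t) x _ _ (is_derive1_ln x1') d1.
by rewrite mulr1.
Qed.

Lemma is_derive_ln1B x : x < 1 -> is_derive x 1 (fun t => ln (1 - t)) (- (1 - x)^-1).
Proof.
move=> x1; have d1 : is_derive x 1 (fun t : R => 1 - t) (-1).
  by have := is_deriveB (is_derive_cst (1 : R) x 1) (is_derive_id x 1); rewrite sub0r.
have x1' : 0 < 1 - x by lra.
have := @is_derive1_comp R (@ln R) (fun t => 1 - t) x _ _ (is_derive1_ln x1') d1.
by rewrite mulrN1.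
Qed.

Definition log_series (K : nat) : {poly R} :=
  \sum_(i < K) (i.+1%:R^-1 *: 'X^(i.+1)).

Lemma deriv_log_series K : deriv (log_series K) = \sum_(i < K) 'X^i.
Proof.
rewrite /log_series raddf_sum; apply: eq_bigr => i _ /=.
by rewrite derivZ derivXn -scalerMnr scalerMnl -mulr_natr mulVf ?scale1r// pnatr_eq0.
Qed.

(** The remainder coefficient is frozen at [x], so that the comparison function is ln(1 - t) plus a
    polynomial. Its derivative is t^K (1/(1 - x) - 1/(1 - t)), nonnegative for t <= x. *)
Lemma onemx_ge_exp K x : 0 <= x < 1 ->
  expR (- (\sum_(i < K) x ^+ i.+1 / i.+1%:R + x ^+ K.+1 / (K.+1%:R * (1 - x))))
  <= 1 - x.
Proof.
move=> /andP[x0 x1].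
pose p := log_series K + ((K.+1%:R * (1 - x))^-1) *: 'X^(K.+1).
have pE : p.[x] = \sum_(i < K) x ^+ i.+1 / i.+1%:R + x ^+ K.+1 / (K.+1%:R * (1 - x)).
  rewrite /p hornerE horner_sum hornerZ hornerXn [x ^+ _ / _]mulrC; congr (_ + _).
  by apply: eq_bigr => i _; rewrite hornerZ hornerXn mulrC.
rewrite -pE -[leRHS]lnK ?posrE ?subr_gt0// ler_expR lerNl -subr_ge0 opprK addrC.
pose f t := ln (1 - t) + p.[t].
have -> : 0 = f 0.
  rewrite /f subr0 ln1 /p hornerE horner_sum hornerZ hornerXn expr0n mulr0 addr0 big1 ?addr0//.
  by move=> i _; rewrite hornerZ hornerXn expr0n mulr0.
apply: (@le_of_derive_ge0 _ (fun t => - (1 - t)^-1 + (deriv p).[t])) => // t /andP[t0 tx].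
  have t1 : t < 1 by exact: le_lt_trans tx _.
  exact: (is_deriveD (is_derive_ln1B t1) (is_derive_poly p t)).
have t1 : 0 < 1 - t by rewrite subr_gt0; exact: le_lt_trans tx _.
have x1' : 0 < 1 - x by rewrite subr_gt0.
have -> : (deriv p).[t] = (1 - t ^+ K) / (1 - t) + t ^+ K / (1 - x).
  rewrite /p derivD deriv_log_series derivZ derivXn hornerE horner_sum hornerZ hornerMn hornerXn /=.
  congr (_ + _).
    have -> : 1 - t ^+ K = (1 - t) * \sum_(i < K) t ^+ i by rewrite -[LHS]opprB subrX1 -mulNr opprB.
    rewrite mulrAC divff ?gt_eqF// mul1r.
    by apply: eq_bigr => i _; rewrite hornerXn.
  by rewrite invfM -mulr_natr; field; rewrite !gt_eqF//.
have -> : - (1 - t)^-1 + ((1 - t ^+ K) / (1 - t) + t ^+ K / (1 - x)) =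
   t ^+ K * ((1 - x)^-1 - (1 - t)^-1) by field; rewrite !gt_eqF.
rewrite mulr_ge0 ?exprn_ge0// subr_ge0 lef_pV2 ?posrE//; lra.
Qed.

(** The right-hand side is 2 artanh t. At t = 1/(2n + 1) it equals ln((n + 1)/n), and two terms of
    the odd series control one step of the Euler-Maclaurin truncations. *)
Lemma artanh_lower t : 0 <= t < 1 ->
  2 * t + 2 / 3 * t ^+ 3 <= ln (1 + t) - ln (1 - t).
Proof.
move=> /andP[t0 t1].
pose p : {poly R} := - (2 *: 'X + (2 / 3) *: 'X^3).
pose f s := (ln (1 + s) - ln (1 - s)) + p.[s].
have pE s : p.[s] = - (2 * s + 2 / 3 * s ^+ 3) by rewrite /p !hornerE.
have dpE s : (deriv p).[s] = - (2 + 2 * s ^+ 2).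
  by rewrite /p derivN derivD !derivZ derivX derivXn !(hornerE, hornerMn) /=; field.
suff : f 0 <= f t.
  by rewrite /f !pE addr0 subr0 ln1 subrr expr0n /= mulr0 mulr0 !addr0 oppr0; lra.
apply: (@le_of_derive_ge0 _ (fun s => ((1 + s)^-1 - - (1 - s)^-1) + (deriv p).[s])) => // s /andP[s0 st].
  have s1 : s < 1 by lra.
  have s1' : -1 < s by lra.
  exact: (is_deriveD (is_deriveB (is_derive_ln1D s1') (is_derive_ln1B s1)) (is_derive_poly p s)).
rewrite dpE.
have -> : (1 + s)^-1 - - (1 - s)^-1 - (2 + 2 * s ^+ 2) = 2 * s ^+ 4 / ((1 - s) * (1 + s)).
  by field; apply/andP; split; apply: lt0r_neq0; lra.
by rewrite divr_ge0 ?mulr_ge0 ?exprn_ge0//; lra.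
Qed.

Lemma artanh_upper t : 0 <= t < 1 ->
  ln (1 + t) - ln (1 - t) <= 2 * t + 2 / 3 * t ^+ 3 + 2 / 5 * t ^+ 5 / (1 - t ^+ 2).
Proof.
move=> /andP[t0 t1].
have tt : 0 < 1 - t ^+ 2.
  by rewrite subr_gt0 expr2 -[ltRHS]mulr1 ltr_pM// ?mulr_ile1// ; lra.
pose p : {poly R} := 2 *: 'X + (2 / 3) *: 'X^3 + (2 / 5 / (1 - t ^+ 2)) *: 'X^5.
pose f s := p.[s] - (ln (1 + s) - ln (1 - s)).
have pE s : p.[s] = 2 * s + 2 / 3 * s ^+ 3 + 2 / 5 / (1 - t ^+ 2) * s ^+ 5.
  by rewrite /p !hornerE.
have dpE s : (deriv p).[s] = 2 + 2 * s ^+ 2 + 2 / (1 - t ^+ 2) * s ^+ 4.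
  rewrite /p !derivD !derivZ derivX !derivXn !(hornerE, hornerMn) /=; field.
  by rewrite gt_eqF.
suff : f 0 <= f t.
  rewrite /f !pE addr0 subr0 ln1 subrr !expr0n /= !mulr0 !addr0 subr0 mulrAC; lra.
apply: (@le_of_derive_ge0 _ (fun s => (deriv p).[s] - ((1 + s)^-1 - - (1 - s)^-1))) => // s /andP[s0 st].
  have s1 : s < 1 by lra.
  have s1' : -1 < s by lra.
  exact: (is_deriveB (is_derive_poly p s) (is_deriveB (is_derive_ln1D s1') (is_derive_ln1B s1))).
rewrite dpE.
have ss : 0 < 1 - s ^+ 2 by have : s ^+ 2 <= t ^+ 2 by [rewrite lerXn2r// nnegrE; lra]; lra.
have -> : 2 + 2 * s ^+ 2 + 2 / (1 - t ^+ 2) * s ^+ 4 - ((1 + s)^-1 - - (1 - s)^-1)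
   = 2 * s ^+ 4 * ((1 - t ^+ 2)^-1 - (1 - s ^+ 2)^-1).
  by field; rewrite !gt_eqF//=; lra.
rewrite !mulr_ge0 ?exprn_ge0// subr_ge0 lef_pV2 ?posrE//.
have : s ^+ 2 <= t ^+ 2 by rewrite lerXn2r// nnegrE; lra.
lra.
Qed.

End RealBounds.

(** * Monotone bounds for Euler's constant *)

Section EulerGamma.
Variable R : realType.

Definition harmonic_sum (n : nat) : R := series harmonic n.

Lemma harmonic_sumS n : harmonic_sum n.+1 = harmonic_sum n + n.+1%:R^-1.
Proof. by rewrite /harmonic_sum /series /= big_nat_recr. Qed.

(* Truncations of the Euler-Maclaurin expansion of H_n - ln n. *)
Definition gamma_upper (n : nat) : R :=
  harmonic_sum n - ln (n%:R) - 1 / (2 * n%:R) + 1 / (12 * n%:R ^+ 2).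

Definition gamma_lower (n : nat) : R := gamma_upper n - 1 / (120 * n%:R ^+ 4).

Lemma ln_succ n : (0 < n)%N ->
  let t := (2 * n%:R + 1 : R)^-1 in
  (0 <= t < 1) /\ ln (n.+1%:R) - ln (n%:R) = ln (1 + t) - ln (1 - t) :> R.
Proof.
move=> n0 t; have x0 : 0 < n%:R :> R by rewrite ltr0n.
have x1 : 0 < 2 * n%:R + 1 :> R by lra.
have t01 : 0 <= t < 1 by rewrite invr_ge0 ltW//= invf_lt1//; lra.
split=> //; rewrite -!ln_div ?posrE ?ltr0n//; [|lra|lra].
congr ln; rewrite /t (_ : n.+1%:R = n%:R + 1) ?natr1 -?(natr1 n)//; field.
by rewrite !gt_eqF//=; lra.
Qed.

(** One step splits into the error of the artanh bound, which has the right sign, and an explicit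
    rational function with positive numerator. The lower truncation is treated in the same way. *)
Lemma gamma_upper_nonincreasing n : (0 < n)%N -> gamma_upper n.+1 <= gamma_upper n.
Proof.
move=> n0; have [t01 lnE] := ln_succ n0; have := artanh_lower t01.
rewrite -lnE /gamma_upper harmonic_sumS => h.
rewrite -subr_ge0.
have x0 : 0 < n%:R :> R by rewrite ltr0n.
move: h; rewrite (_ : n.+1%:R = n%:R + 1); last (by rewrite natr1); set x : R := n%:R in x0 *.
set L := ln (x + 1) - ln x => h.
have -> : harmonic_sum n - ln x - 1 / (2 * x) + 1 / (12 * x ^+ 2) -
 (harmonic_sum n + (x + 1)^-1 - ln (x + 1) - 1 / (2 * (x + 1)) + 1 / (12 * (x + 1) ^+ 2))
 = (L - (2 * (2 * x + 1)^-1 + 2 / 3 * (2 * x + 1)^-1 ^+ 3)) +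
   (1 + 2 * x + 2 * x ^+ 2) / (12 * x ^+ 2 * (x + 1) ^+ 2 * (2 * x + 1) ^+ 3).
  by rewrite /L; field; rewrite !gt_eqF//=; lra.
rewrite addr_ge0 ?subr_ge0// divr_ge0//; first nra.
by rewrite !mulr_ge0 ?exprn_ge0//; lra.
Qed.

Lemma gamma_lower_nondecreasing n : (0 < n)%N -> gamma_lower n <= gamma_lower n.+1.
Proof.
move=> n0; have [t01 lnE] := ln_succ n0; have := artanh_upper t01.
rewrite -lnE /gamma_lower /gamma_upper harmonic_sumS => h.
rewrite -subr_ge0.
have x0 : 0 < n%:R :> R by rewrite ltr0n.
move: h; rewrite (_ : n.+1%:R = n%:R + 1); last (by rewrite natr1); set x : R := n%:R in x0 *.
have -> : 2 / 5 * (2 * x + 1)^-1 ^+ 5 / (1 - (2 * x + 1)^-1 ^+ 2) =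
   2 / 5 / ((2 * x + 1) ^+ 3 * (4 * x * (x + 1))).
  have ? : 0 < 2 * x + 1 by lra.
  have ? : 0 < 4 * x * (x + 1) by rewrite !mulr_gt0//; lra.
  by field; rewrite !gt_eqF//=; nra.
set L := ln (x + 1) - ln x => h.
have -> : harmonic_sum n + (x + 1)^-1 - ln (x + 1) - 1 / (2 * (x + 1)) + 1 / (12 * (x + 1) ^+ 2)
   - 1 / (120 * (x + 1) ^+ 4) -
 (harmonic_sum n - ln x - 1 / (2 * x) + 1 / (12 * x ^+ 2) - 1 / (120 * x ^+ 4))
 = ((2 * (2 * x + 1)^-1 + 2 / 3 * (2 * x + 1)^-1 ^+ 3 + 2 / 5 / ((2 * x + 1) ^+ 3 * (4 * x * (x + 1)))) - L) +
   (1 + 10 * x + 32 * x ^+ 2 + 44 * x ^+ 3 + 22 * x ^+ 4) / (120 * x ^+ 4 * (x + 1) ^+ 4 * (2 * x + 1) ^+ 3).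
  by rewrite /L; field; rewrite !gt_eqF//=; lra.
rewrite addr_ge0 ?subr_ge0// divr_ge0//.
  by rewrite !addr_ge0// ?mulr_ge0 ?exprn_ge0// ltW.
by rewrite !mulr_ge0 ?exprn_ge0//; lra.
Qed.

Lemma gamma_lower_le_upper n : gamma_lower n <= gamma_upper n.
Proof. by rewrite lerBlDr lerDl divr_ge0// mulr_ge0// exprn_ge0. Qed.

Lemma cvg_invn_exp k (c : R) : (fun n => 1 / (c * n.+1%:R ^+ k.+1)) @ \oo --> (0 : R).
Proof.
have h0 : @harmonic R @ \oo --> (0 : R) := cvg_harmonic.
have -> : (fun n => 1 / (c * n.+1%:R ^+ k.+1)) = (fun n => c^-1 * (@harmonic R n) ^+ k.+1) :> R^nat.
  by apply/funext => n; rewrite /= div1r invfM exprVn.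
suff h : (fun n => harmonic n ^+ k.+1) @ \oo --> (0 : R).
  have : (fun n => c^-1 * harmonic n ^+ k.+1) @ \oo --> (c^-1 * 0 : R).
    by apply: cvgM; [exact: cvg_cst|exact: h].
  by rewrite mulr0.
elim: k => [|k IH].
  have -> : (fun n => harmonic n ^+ 1) = @harmonic R by apply/funext.
  exact: h0.
have -> : (fun n => harmonic n ^+ k.+2) = (fun n => harmonic n * harmonic n ^+ k.+1) :> R^nat.
  by apply/funext => n; rewrite exprS.
have : (fun n => harmonic n * harmonic n ^+ k.+1) @ \oo --> (0 * 0 : R).
  by apply: cvgM; [exact: h0|exact: IH].
by rewrite mulr0.
Qed.

Lemma euler_gamma_bounds n : (0 < n)%N ->
  gamma_lower n <= euler_gamma <= gamma_upper n.
Proof.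
move=> n0.
(* The shift avoids [n = 0], where the logarithm and the inverses take default values. *)
pose u : R^nat := fun n => gamma_upper n.+1.
pose v : R^nat := fun n => gamma_lower n.+1.
have ud : nonincreasing_seq u.
  by apply/nonincreasing_seqP => k; exact: gamma_upper_nonincreasing.
have vi : nondecreasing_seq v.
  by apply/nondecreasing_seqP => k; exact: gamma_lower_nondecreasing.
have uc : cvgn u.
  apply: nonincreasing_is_cvgn => //; exists (v 0%N) => _ [k _ <-].
  exact: le_trans (vi _ _ (leq0n k)) (gamma_lower_le_upper _).
have vu : v = u - (fun n => 1 / (120 * n.+1%:R ^+ 4)) by apply/funext.
have vl : v @ \oo --> limn u.
  suff : v @ \oo --> limn u - 0 by rewrite subr0.
  by rewrite vu; apply: cvgB; [exact: uc|exact: cvg_invn_exp].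
have gl : limn u = euler_gamma.
  apply/esym/cvg_lim => //; rewrite -cvg_shiftS.
  have -> : [sequence series harmonic k.+1 - ln k.+1%:R]_k =
     u + (fun k => 1 / (2 * k.+1%:R ^+ 1)) - (fun k => 1 / (12 * k.+1%:R ^+ 2)) :> R^nat.
    apply/funext => k; rewrite /u /gamma_upper /harmonic_sum /=.
    by rewrite !fctE expr1; ring.
  rewrite -[limn u]addr0 -[limn u + 0]subr0.
  by apply: cvgB; [apply: cvgD; [exact: uc|exact: cvg_invn_exp]|exact: cvg_invn_exp].
case: n n0 => // n _; rewrite -gl.
apply/andP; split; last exact: nonincreasing_cvgn_ge.
have := nondecreasing_cvgn_le vi (cvgP _ vl) n.
by rewrite (cvg_lim _ vl).
Qed.
End EulerGamma.

(** * Decimal bounds for e and e^gamma *)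

Section ExpBounds.
Variable R : realType.
Implicit Types x : R.

Lemma expR_ge_series n x : 0 <= x -> series (exp_coeff x) n <= expR x.
Proof.
move=> x0; apply: nondecreasing_cvgn_le; last exact: is_cvg_series_exp_coeff.
apply/nondecreasing_seqP => k; rewrite /series /= big_nat_recr//= lerDl.
exact: exp_coeff_ge0.
Qed.

(** The bound is nonincreasing in [n], since consecutive coefficients have ratio [x / k.+1 <= x],
    and at each index it dominates the partial sum; hence it dominates the limit. *)
Lemma expR_le_series n x : 0 <= x < 1 ->
  expR x <= series (exp_coeff x) n + x ^+ n / n`!%:R / (1 - x).
Proof.
move=> /andP[x0 x1]; have x1' : 0 < 1 - x by rewrite subr_gt0.
have step k : series (exp_coeff x) k.+1 + x ^+ k.+1 / k.+1`!%:R / (1 - x) <=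
              series (exp_coeff x) k + x ^+ k / k`!%:R / (1 - x).
  rewrite /series /= big_nat_recr//= -addrA lerD2l /exp_coeff /=.
  have -> : x ^+ k.+1 / k.+1`!%:R = (x ^+ k / k`!%:R) * (x / k.+1%:R).
    by rewrite exprS factS natrM invfM; ring.
  have A0 : 0 <= x ^+ k / k`!%:R by rewrite divr_ge0 ?exprn_ge0.
  have cx : x / k.+1%:R <= x by rewrite ler_piMr// invf_le1 ?ltr0n// ler1n.
  move: A0 cx; set A := x ^+ k / _; set c := x / _ => A0 cx.
  rewrite -subr_ge0; have -> : A / (1 - x) - (A + A * c / (1 - x)) = A * (x - c) / (1 - x).
    by field; rewrite gt_eqF.
  by apply: divr_ge0; [apply: mulr_ge0; rewrite ?subr_ge0|exact: ltW].
have mono k : (n <= k)%N -> series (exp_coeff x) k + x ^+ k / k`!%:R / (1 - x) <=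
              series (exp_coeff x) n + x ^+ n / n`!%:R / (1 - x).
  elim: k => [|k IH]; first by rewrite leqn0 => /eqP->; rewrite lexx.
  rewrite leq_eqVlt => /predU1P[->//|nk]; last exact: le_trans (step k) (IH nk).
apply: limr_le; first exact: is_cvg_series_exp_coeff.
near=> k; apply: le_trans (mono k _); last by near: k; exact: nbhs_infty_ge.
by rewrite lerDl !divr_ge0 ?exprn_ge0// ltW.
Unshelve. all: by end_near. Qed.

(** The terms of the exponential series from x^k on, divided by the first of them. This
    normalization makes [exp_tailS] the Horner step that unfolds to [exp_taylor10]. *)
Definition exp_tail (k n : nat) x : R := \sum_(j < n) x ^+ j * k`!%:R / (k + j)`!%:R.

Lemma exp_tailS k n x : exp_tail k n.+1 x = 1 + x / k.+1%:R * exp_tail k.+1 n x.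
Proof.
have f0 m : m`!%:R != 0 :> R by rewrite pnatr_eq0 -lt0n fact_gt0.
rewrite /exp_tail big_ord_recl expr0 mul1r addn0 divff// mulr_sumr; congr (_ + _).
apply: eq_bigr => j _; rewrite lift0 addnS addSn exprS [k.+1`!]factS natrM.
rewrite -!mulrA; congr (_ * _); rewrite [in RHS]mulrCA; congr (_ * _).
by rewrite !mulrA mulVf ?mul1r// pnatr_eq0.
Qed.

Lemma exp_tail0 k x : exp_tail k 0 x = 0.
Proof. by rewrite /exp_tail big_ord0. Qed.

Definition exp_taylor10 x : R :=
  1 + x * (1 + x / 2 * (1 + x / 3 * (1 + x / 4 * (1 + x / 5 * (1 + x / 6 *
  (1 + x / 7 * (1 + x / 8 * (1 + x / 9)))))))).

Lemma series_exp_coeff10 x : series (exp_coeff x) 10 = exp_taylor10 x.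
Proof.
have -> : series (exp_coeff x) 10 = exp_tail 0 10 x.
  rewrite /series /exp_tail /= big_mkord; apply: eq_bigr => j _.
  by rewrite /exp_coeff /= fact0 mulr1 add0n.
by rewrite !exp_tailS exp_tail0 !mulr0 !addr0 !divr1 mulr1.
Qed.

Lemma expR_taylor10 x : 0 <= x <= 3 / 4 ->
  exp_taylor10 x <= expR x <= exp_taylor10 x + x ^+ 10 / (90 * 100 * 100).
Proof.
move=> /andP[x0 x1]; rewrite -series_exp_coeff10 expR_ge_series//=.
have x1' : x < 1 by lra.
apply: le_trans (expR_le_series 10 _) _; first by rewrite x0.
rewrite lerD2l -mulrA; apply: ler_wpM2l; first exact: exprn_ge0.
(* For x <= 3/4 the denominator 10! (1 - x) is at least 10!/4 = 907200, rounded down to 900000. *)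
have f10 : 90 * 100 * 100 * 4 <= 10`!%:R :> R.
  by rewrite !factS fact0 !natrM; lra.
have x1i : 0 < 1 - x by rewrite subr_gt0.
have c0 : 0 < 90 * 100 * 100 :> R by lra.
have h : 90 * 100 * 100 <= 10`!%:R * (1 - x).
  apply: le_trans (ler_wpM2r (ltW x1i) f10); lra.
by rewrite -invfM lef_pV2 ?posrE//; exact: lt_le_trans h.
Qed.

Lemma expR1_bounds : 2 + 718 / 10 ^+ 3 + 281 / 10 ^+ 6 + 82 / 10 ^+ 8 <= expR (1 : R) <= 2 + 718 / 10 ^+ 3 + 281 / 10 ^+ 6 + 84 / 10 ^+ 8.
Proof.
(* The Taylor estimate covers arguments up to 3/4 only, hence the square of e^(1/2). *)
have -> : expR (1 : R) = expR 2^-1 ^+ 2 by rewrite -expRM_natl divff.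
have h : 0 <= (2^-1 : R) <= 3 / 4.
  by apply/andP; split; lra.
have /andP[lo up] := expR_taylor10 h.
have {}lo : 1 + 648 / 10 ^+ 3 + 721 / 10 ^+ 6 + 269 / 10 ^+ 9 <= expR (2^-1 : R).
  apply: le_trans lo; rewrite /exp_taylor10; lra.
have {}up : expR (2^-1 : R) <= 1 + 648 / 10 ^+ 3 + 721 / 10 ^+ 6 + 273 / 10 ^+ 9.
  apply: le_trans up _; rewrite /exp_taylor10; lra.
apply/andP; split; nra.
Qed.

Lemma ler_exp_nneg n (a b : R) : 0 <= a -> a <= b -> a ^+ n <= b ^+ n.
Proof. by move=> a0 ab; rewrite lerXn2r// nnegrE// (le_trans a0). Qed.

(** The bounds on gamma at [n = 10] have the form s - ln 10 with s rational, and exp(s - ln 10) =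
    exp(s) / 10, so no value of ln 10 is needed. As s is about 2.8798, a quarter of it falls in the
    range of the Taylor estimate. *)
Lemma expR_gamma_bounds :
  1 + 781 / 10 ^+ 3 + 72 / 10 ^+ 6 <= expR (euler_gamma : R)
    <= 1 + 781 / 10 ^+ 3 + 75 / 10 ^+ 6.
Proof.
have /andP[lo up] := @euler_gamma_bounds R 10 isT.
have e10 y : expR (y - ln (10%:R)) = expR y / 10%:R :> R.
  by rewrite expRB lnK// posrE.
have h10 : harmonic_sum R 10 = 2 + 928 / 10 ^+ 3 + 968 / 10 ^+ 6 + 253 / 10 ^+ 9
    + 61 / (63 * 10 ^+ 9).
  have -> : harmonic_sum R 10 = 1 + 1 / 2 + 1 / 3 + 1 / 4 + 1 / 5 + 1 / 6 + 1 / 7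
     + 1 / 8 + 1 / 9 + 1 / 10.
    by rewrite !harmonic_sumS /harmonic_sum /series /= big_geq// add0r invr1 !div1r.
  lra.
apply/andP; split.
(* Slightly less than a quarter of s from [gamma_lower]; the [x] of the other half is slightly more
   than a quarter of s from [gamma_upper]. *)
- pose x : R := 719 / 10 ^+ 3 + 950 / 10 ^+ 6 + 180 / 10 ^+ 9.
  have h : 0 <= x <= 3 / 4 by rewrite /x; apply/andP; split; lra.
  have /andP[xlo _] := expR_taylor10 h.
  have {}xlo : 2 + 54 / 10 ^+ 3 + 330 / 10 ^+ 6 + 850 / 10 ^+ 9 <= expR x.
    by apply: le_trans xlo; rewrite /exp_taylor10 /x; lra.
  have : expR (4%:R * x - ln (10%:R)) <= expR (euler_gamma : R).
    rewrite ler_expR; apply: le_trans lo.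
    rewrite /gamma_lower /gamma_upper h10 /x; move: (ln _) => L; lra.
  rewrite e10 expRM_natl; apply: le_trans.
  have : (2 + 54 / 10 ^+ 3 + 330 / 10 ^+ 6 + 850 / 10 ^+ 9) ^+ 4 <= expR x ^+ 4.
    by apply: ler_exp_nneg xlo; lra.
  move: (expR x ^+ 4) => E; lra.
- pose x : R := 719 / 10 ^+ 3 + 950 / 10 ^+ 6 + 400 / 10 ^+ 9.
  have h : 0 <= x <= 3 / 4 by rewrite /x; apply/andP; split; lra.
  have /andP[_ xup] := expR_taylor10 h.
  have {}xup : expR x <= 2 + 54 / 10 ^+ 3 + 331 / 10 ^+ 6 + 600 / 10 ^+ 9.
    by apply: le_trans xup _; rewrite /exp_taylor10 /x; lra.
  have : expR (euler_gamma : R) <= expR (4%:R * x - ln (10%:R)).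
    rewrite ler_expR; apply: le_trans up _.
    rewrite /gamma_upper h10 /x; move: (ln _) => L; lra.
  rewrite e10 expRM_natl => /le_trans; apply.
  have : expR x ^+ 4 <= (2 + 54 / 10 ^+ 3 + 331 / 10 ^+ 6 + 600 / 10 ^+ 9) ^+ 4.
    by apply: ler_exp_nneg xup; exact: expR_ge0.
  move: (expR x ^+ 4) => E; lra.
Qed.
End ExpBounds.

(** * Decimal bounds for pi *)

Section PiBounds.
Variable R : realType.
Implicit Types x : R.

Lemma atan_bounds x : 0 <= x ->
  x - x ^+ 3 / 3 + x ^+ 5 / 5 - x ^+ 7 / 7 <= atan x
  <= x - x ^+ 3 / 3 + x ^+ 5 / 5 - x ^+ 7 / 7 + x ^+ 9 / 9.
Proof.
move=> x0.
pose p : {poly R} := 'X - 3^-1 *: 'X^3 + 5^-1 *: 'X^5 - 7^-1 *: 'X^7.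
pose r : {poly R} := p + 9^-1 *: 'X^9.
have pE y : p.[y] = y - y ^+ 3 / 3 + y ^+ 5 / 5 - y ^+ 7 / 7.
  by rewrite /p !(hornerD, hornerN, hornerZ, hornerX, hornerXn); field.
have rE y : r.[y] = p.[y] + y ^+ 9 / 9 by rewrite /r hornerD hornerZ hornerXn [in RHS]mulrC.
have dpE y : (deriv p).[y] = 1 - y ^+ 2 + y ^+ 4 - y ^+ 6.
  by rewrite /p !(derivD, derivN, derivZ, derivX, derivXn) !(hornerD, hornerN, hornerZ, hornerX, hornerXn, hornerMn, hornerC) /=; field.
have drE y : (deriv r).[y] = 1 - y ^+ 2 + y ^+ 4 - y ^+ 6 + y ^+ 8.
  by rewrite /r derivD derivZ derivXn hornerD dpE !(hornerD, hornerN, hornerZ, hornerX, hornerXn, hornerMn, hornerC) /=; field.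
have p0 : p.[0] = 0 by rewrite pE !expr0n /=; lra.
have r0 : r.[0] = 0 by rewrite rE p0 expr0n /=; lra.
rewrite -pE -rE; apply/andP; split; rewrite -subr_ge0.
- have -> : 0 = atan 0 - p.[0] by rewrite atan0 p0 subrr.
  apply: (@le_of_derive_ge0 _ (fun y => atan y - p.[y]) (fun y => (1 + y ^+ 2)^-1 - (deriv p).[y])) => // y _.
  have y0 : 0 <= y ^+ 2 by exact: sqr_ge0.
  have -> : (1 + y ^+ 2)^-1 - (deriv p).[y] = (y ^+ 2) ^+ 4 / (1 + y ^+ 2).
    by rewrite dpE; field; rewrite gt_eqF//; nra.
  by apply: divr_ge0; [exact: exprn_ge0|lra].
- have -> : 0 = r.[0] - atan 0 by rewrite atan0 r0 subrr.
  apply: (@le_of_derive_ge0 _ (fun y => r.[y] - atan y) (fun y => (deriv r).[y] - (1 + y ^+ 2)^-1)) => // y _.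
  have y0 : 0 <= y ^+ 2 by exact: sqr_ge0.
  have -> : (deriv r).[y] - (1 + y ^+ 2)^-1 = (y ^+ 2) ^+ 5 / (1 + y ^+ 2).
    by rewrite drE; field; rewrite gt_eqF//; nra.
  by apply: divr_ge0; [exact: exprn_ge0|lra].
Qed.

(** With a = atan(1/5) and b = atan(1/239), both 4 a and pi/4 + b have tangent 120/119. Crude bounds
    on a and b, with pi >= 2, place them in the interval where tan is injective. *)
Lemma machin : (pi : R) = 16 * atan (5^-1) - 4 * atan (239^-1).
Proof.
pose a : R := atan 5^-1; pose b : R := atan 239^-1.
have cpos y : `|y| < pi / 2 -> cos y != 0 :> R.
  by rewrite ltr_norml => h; rewrite gt_eqF// cos_gt0_pihalf.
have /andP[alo aup] : 0 < a < 1 / 4.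
  have /andP[] := @atan_bounds 5^-1 ltac:(lra).
  rewrite -/a => lo up; apply/andP; split; lra.
have /andP[blo bup] : 0 < b < 1 / 4.
  have /andP[] := @atan_bounds 239^-1 ltac:(lra).
  rewrite -/b => lo up; apply/andP; split; lra.
have pi2 := @pi_ge2 R.
have ta : tan a = 5^-1 by rewrite atanK.
have tb : tan b = 239^-1 by rewrite atanK.
have t2a : tan (a + a) = 5 / 12.
  by rewrite tanD ?cpos// ?ger0_norm; [rewrite ta; field|lra..].
have t4a : tan (a + a + (a + a)) = 120 / 119.
  by rewrite tanD ?cpos// ?ger0_norm; [rewrite t2a; field|lra..].
have tpb : tan (pi / 4 + b) = 120 / 119.
  by rewrite tanD ?cpos// ?ger0_norm; [rewrite tan_piquarter tb; field|lra..].
have : a + a + (a + a) = pi / 4 + b.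
  apply: tan_inj; rewrite ?t4a// in_itv/=; apply/andP; split; lra.
rewrite -/a -/b; lra.
Qed.

Lemma pi_bounds : 3 + 141 / 10 ^+ 3 + 591 / 10 ^+ 6 <= (pi : R) <= 3 + 141 / 10 ^+ 3 + 593 / 10 ^+ 6.
Proof.
have /andP[] := @atan_bounds 5^-1 ltac:(lra).
have /andP[] := @atan_bounds 239^-1 ltac:(lra).
rewrite machin => ? ? ? ?; apply/andP; split; lra.
Qed.
End PiBounds.

Section Constants.
Variable R : realType.
Implicit Types x : R.

Lemma expR_gammaB1_bounds :
  655 / 10 ^+ 3 + 219 / 10 ^+ 6 <= expR (euler_gamma - 1 : R) <= 655 / 10 ^+ 3 + 221 / 10 ^+ 6.
Proof.
have /andP[g0 g1] := expR_gamma_bounds R; have /andP[e0 e1] := expR1_bounds R.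
have e_gt0 : 0 < expR 1 :> R by exact: expR_gt0.
rewrite expRB ler_pdivlMr// ler_pdivrMr//.
move: (expR _) (expR _) g0 g1 e0 e1 {e_gt0} => g e g0 g1 e0 e1.
apply/andP; split; lra.
Qed.

Lemma expR_gamma_decimals :
  1 + 78 / 10 ^+ 2 + 107 / 10 ^+ 5 <= expR (euler_gamma : R)
        < 1 + 78 / 10 ^+ 2 + 108 / 10 ^+ 5.
Proof.
have /andP[g0 g1] := expR_gamma_bounds R.
move: (expR _) g0 g1 => g g0 g1; apply/andP; split; lra.
Qed.

Lemma limit_bound_decimals :
  1 + 80 / 10 ^+ 2 + 15 / 10 ^+ 5
        <= 1 + expR (euler_gamma - 1) + ((pi : R) ^+ 2 - 9) / 6
        < 1 + 80 / 10 ^+ 2 + 16 / 10 ^+ 5.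
Proof.
have /andP[g0 g1] := expR_gammaB1_bounds.
have /andP[p0 p1] := pi_bounds R.
move: (expR _) (pi : R) g0 g1 p0 p1 => g p g0 g1 p0 p1.
apply/andP; split; nra.
Qed.

Lemma sin_le x : 0 <= x -> sin x <= x.
Proof.
move=> x0; rewrite -subr_ge0.
have -> : 0 = (0 : R) - sin 0 by rewrite sin0 subrr.
apply: (@le_of_derive_ge0 _ (fun y => y - sin y) (fun y => 1 - cos y)) => // y _.
Qed.

Definition dyadic_angle (n k : nat) : R := k.*2.+1%:R * pi / 2 ^+ n.+2.

Lemma dyadic_angle_itv n k : (k < 2 ^ n)%N -> 0 < dyadic_angle n k < pi / 2.
Proof.
move=> kn; rewrite /dyadic_angle; apply/andP; split.
  by rewrite divr_gt0 ?exprn_gt0// mulr_gt0 ?pi_gt0// ltr0n.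
have h : k.*2.+1%:R < 2 ^+ n.+1 :> R by rewrite -natrX ltr_nat expnS; lia.
have P0 : 0 < 2 ^+ n.+1 :> R by rewrite exprn_gt0.
rewrite [2 ^+ n.+2]exprS -subr_gt0; move: (k.*2.+1%:R) (2 ^+ n.+1) h P0 => K P h P0.
have -> : pi / 2 - K * pi / (2 * P) = pi * (P - K) / (2 * P) :> R.
  by field; rewrite gt_eqF.
by rewrite divr_gt0 ?mulr_gt0 ?pi_gt0 ?subr_gt0.
Qed.

(* 4 / sin(2 t)^2 = 1 / sin(t)^2 + 1 / sin(pi/2 - t)^2, by induction on n; with
   sin t <= t this gives the upper half of Euler's sum of inverse squares. *)
Lemma sum_inv_sin2 n :
  \sum_(0 <= k < 2 ^ n) (sin (dyadic_angle n k) ^+ 2)^-1 = 2 * 4 ^+ n.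
Proof.
elim: n => [|n IH].
  rewrite expn0 big_nat1 expr0 mulr1 /dyadic_angle double0 mul1r.
  have -> : pi / 2 ^+ 2 = pi / 4 :> R by congr (_ / _); ring.
  have c0 : cos (pi / 4 : R) != 0.
    by rewrite gt_eqF// cos_gt0_pihalf//; have := @pi_gt0 R => p0; apply/andP; split; lra.
  have := @tan_piquarter R; rewrite /tan => /(canRL (divfK c0)); rewrite mul1r => sc.
  have := cos2Dsin2 (pi / 4 : R); rewrite -sc => h.
  have -> : sin (pi / 4 : R) ^+ 2 = 2^-1 by lra.
  by rewrite invrK.
have half k : (k < 2 ^ n)%N -> 4 * (sin (dyadic_angle n k) ^+ 2)^-1 =
    (sin (dyadic_angle n.+1 k) ^+ 2)^-1 +
    (sin (dyadic_angle n.+1 (2 ^ n.+1 - 1 - k)%N) ^+ 2)^-1.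
  move=> kn; set y := dyadic_angle n.+1 k.
  have kn1 : (k < 2 ^ n.+1)%N by rewrite (ltn_trans kn)// ltn_exp2l.
  have /andP[y0 y1] := dyadic_angle_itv kn1; rewrite -/y in y0 y1.
  have -> : dyadic_angle n k = y *+ 2.
    rewrite /y /dyadic_angle [2 ^+ n.+3]exprS -mulr_natr; field.
    by rewrite expf_neq0// pnatr_eq0.
  have -> : dyadic_angle n.+1 (2 ^ n.+1 - 1 - k)%N = pi / 2 - y.
    rewrite /y /dyadic_angle.
    have -> : ((2 ^ n.+1 - 1 - k).*2.+1%:R = 2 ^+ n.+2 - k.*2.+1%:R :> R).
      apply/eqP; rewrite eq_sym subr_eq -natrD -natrX eqr_nat; apply/eqP.
      by rewrite [(2 ^ n.+2)%N]expnS; lia.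
    rewrite [2 ^+ n.+3]exprS; field.
    by rewrite expf_neq0// pnatr_eq0.
  have -> : sin (pi / 2 - y) = cos y by rewrite -cosBpihalf addrAC subrr sub0r cosN.
  rewrite sin_mulr2n.
  have s0 : sin y != 0 by rewrite gt_eqF// sin_gt0_pihalf// y0.
  have c0 : cos y != 0 by rewrite gt_eqF// cos_gt0_pihalf//; lra.
  have := cos2Dsin2 y => cs.
  have -> : (sin y ^+ 2)^-1 + (cos y ^+ 2)^-1 =
      (cos y ^+ 2 + sin y ^+ 2) / (sin y ^+ 2 * cos y ^+ 2).
    by field; rewrite c0 s0.
  by rewrite cs; field; rewrite c0 s0.
rewrite exprS mulrCA -IH mulr_sumr expnS mul2n -addnn.
rewrite (@big_cat_nat _ _ _ (2 ^ n)%N)//= ?leq_addr//.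
rewrite [X in _ + X](_ : _ = \sum_(0 <= k < 2 ^ n)
    (sin (dyadic_angle n.+1 (2 ^ n.+1 - 1 - k)%N) ^+ 2)^-1); last first.
  rewrite -{1}[(2 ^ n)%N]add0n big_addn addnK big_nat_rev /= add0n.
  rewrite big_nat [RHS]big_nat; apply: eq_bigr => k /andP[_ kn].
  by congr (_ ^-1); congr (sin (dyadic_angle _ _) ^+ 2); rewrite expnS; lia.
rewrite -big_split /= big_nat [RHS]big_nat; apply: eq_bigr => k /andP[_ kn].
by rewrite half.
Qed.

Lemma sum_inv_odd_sqr_le N :
  \sum_(0 <= k < N) (k.*2.+1%:R ^+ 2)^-1 <= pi ^+ 2 / 8 :> R.
Proof.
(* Extending the sum to [2 ^ N] terms matches it with the angles at level [N], whose inverse squared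
   sines have a known sum. *)
apply: (@le_trans _ _ (\sum_(0 <= k < 2 ^ N) (k.*2.+1%:R ^+ 2)^-1)).
  rewrite [leRHS](@big_cat_nat _ _ _ N)//= ?(ltnW (ltn_expl _ _))//.
  by rewrite lerDl sumr_ge0// => k _; rewrite invr_ge0 exprn_ge0.
have p0 := @pi_gt0 R.
have c0 : 0 < pi ^+ 2 / (16 * 4 ^+ N) :> R by rewrite divr_gt0 ?mulr_gt0 ?exprn_gt0.
have -> : pi ^+ 2 / 8 = pi ^+ 2 / (16 * 4 ^+ N) * (2 * 4 ^+ N) :> R.
  by field; rewrite expf_neq0// pnatr_eq0.
rewrite -sum_inv_sin2 mulr_sumr big_nat [leRHS]big_nat.
apply: ler_sum => k /andP[_ kN].
have /andP[y0 y1] := dyadic_angle_itv kN; set y := dyadic_angle _ _ in y0 y1 *.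
have s0 : 0 < sin y by rewrite sin_gt0_pihalf// y0.
have -> : (k.*2.+1%:R ^+ 2)^-1 = pi ^+ 2 / (16 * 4 ^+ N) * (y ^+ 2)^-1 :> R.
  have -> : y ^+ 2 = k.*2.+1%:R ^+ 2 * pi ^+ 2 / (16 * 4 ^+ N).
    have e4 : (2 ^+ N.+2) ^+ 2 = 16 * 4 ^+ N :> R.
      rewrite -exprM mulnC exprM (_ : 2 ^+ 2 = 4); last by ring.
      by rewrite !exprS mulrA; congr (_ * _); ring.
    by rewrite /y /dyadic_angle !exprMn exprVn e4.
  have pN : pi != 0 :> R by rewrite gt_eqF.
  have kN' : k.*2.+1%:R != 0 :> R by rewrite pnatr_eq0.
  have fN : 4 ^+ N != 0 :> R by rewrite expf_neq0// pnatr_eq0.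
  move: (pi : R) (k.*2.+1%:R) (4 ^+ N) pN kN' fN => a b c a0 b0 c0'.
  by field; rewrite a0 b0 c0'.
apply: ler_wpM2l; first exact: ltW.
rewrite lef_pV2 ?posrE ?exprn_gt0//.
by apply: ler_exp_nneg; [exact: ltW|exact/sin_le/ltW].
Qed.

(** Separating odd and even terms, Z(2N) is an odd sum plus Z(N)/4. As Z(N) <= Z(2N), three quarters
    of Z(N) are bounded by the odd sum, at most pi^2/8. *)
Lemma sum_inv_sqr_le N : \sum_(0 <= k < N) (k.+1%:R ^+ 2)^-1 <= pi ^+ 2 / 6 :> R.
Proof.
set Z := fun N => \sum_(0 <= k < N) (k.+1%:R ^+ 2)^-1 : R.
have Z2 : Z N.*2 = \sum_(0 <= k < N) (k.*2.+1%:R ^+ 2)^-1 + 4^-1 * Z N.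
  rewrite /Z; elim: (N) => [|M IH]; first by rewrite double0 !big_geq// mulr0 addr0.
  rewrite doubleS !big_nat_recr//= IH.
  have -> : (M.*2.+2%:R ^+ 2)^-1 = 4^-1 * (M.+1%:R ^+ 2)^-1 :> R.
    rewrite -doubleS -mul2n natrM exprMn invfM; congr (_ * _); congr (_ ^-1); ring.
  ring.
have := sum_inv_odd_sqr_le N.
have : Z N <= Z N.*2.
  rewrite /Z [leRHS](@big_cat_nat _ _ _ N)//= -?addnn ?leq_addr//.
  by rewrite lerDl sumr_ge0// => k _; rewrite invr_ge0 exprn_ge0.
rewrite Z2 -/(Z N); lra.
Qed.

(** Since d pi(d) <= q^d, this bounds, for every q, the part of the theorem's sum over irreducibles
    that comes from degrees 2 to [N]. *)
Definition tail_sum (N : nat) : R := \sum_(2 <= d < N.+1) (d%:R ^+ 2 * d.+1%:R)^-1.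

Lemma tail_sum_le N : tail_sum N <= (pi ^+ 2 - 9) / 6.
Proof.
have tE M : tail_sum M.+1 = \sum_(0 <= k < M.+1) (k.+1%:R ^+ 2)^-1 + (M.+2%:R)^-1 - 3 / 2.
  elim: M => [|M IH].
    by rewrite /tail_sum big_geq// big_nat1 expr1n invr1; field.
  rewrite /tail_sum big_nat_recr//= -/(tail_sum M.+1) IH [in RHS]big_nat_recr//=.
  have -> : M.+3%:R = M.+2%:R + 1 :> R by rewrite natr1.
  have : 0 < M.+2%:R :> R by rewrite ltr0n.
  move: (M.+2%:R : R) => a a0; have a1 : 0 < a + 1 by lra.
  by field; rewrite !gt_eqF.
have mono M k : (M <= k)%N -> tail_sum M <= tail_sum k.
  move=> Mk; rewrite /tail_sum.
  have [M1|M1] := leqP 2 M.+1; last first.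
    by rewrite [leLHS]big_geq 1?ltnW// sumr_ge0// => i _; rewrite invr_ge0 mulr_ge0// exprn_ge0.
  rewrite [leRHS](@big_cat_nat _ _ _ M.+1) ?ltnS//= lerDl; apply: sumr_ge0 => i _.
  by rewrite invr_ge0 mulr_ge0// exprn_ge0.
(* Telescoping 1/(d^2 (d + 1)) = 1/d^2 - 1/d + 1/(d + 1) leaves the surplus [M.+2%:R^-1]. It is
   removed by passing to a larger index, since the sum is nondecreasing. *)
apply/ler_addgt0Pr => e e0.
have [k ke] : exists k : nat, (k.+1%:R)^-1 < e :> R.
  have [k hk] := @ltr_add_invr R 0 e e0; exists k; by rewrite add0r in hk.
apply: le_trans (mono _ (maxn N k).+1 _) _; first by rewrite leqW// leq_maxl.
have h : ((maxn N k).+2%:R)^-1 <= (k.+1%:R)^-1 :> R.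
  by rewrite lef_pV2 ?posrE ?ltr0n// ler_nat ltnS leqW// leq_maxr.
rewrite tE; have := sum_inv_sqr_le (maxn N k).+1; move: h ke.
move: (_^-1) (_^-1) (\sum_(0 <= _ < _) _) => a b c; lra.
Qed.
End Constants.

(** * Counting irreducible polynomials *)

Section Counting.
Variable F : finFieldType.
Implicit Types (p r : {poly F}).
Local Notation q := #|F|.

Lemma card_gt1 : (1 < q)%N. Proof. exact: finNzRing_gt1. Qed.

Lemma expn_card_gt1 m : (0 < m)%N -> (1 < q ^ m)%N.
Proof. by move=> m0; rewrite -[X in (X < _)%N](expn0 q) ltn_exp2l// card_gt1. Qed.

Lemma card_prime_power : exists l k, [/\ prime l, l \in [pchar F] & q = (l ^ k)%N].
Proof.
have [l lp lF] := finPcharP F.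
by exists l, (logn l q); split=> //; exact: (card_pprimeChar lF).
Qed.

(** The quotient by [p], as an abstract finite field with a surjective morphism whose kernel
    consists of the multiples of [p]; nothing else about its representation is used below. *)
Lemma residue_field p : monic_irreducibles p ->
  exists (K : finFieldType) (ev : {rmorphism {poly F} -> K}),
    [/\ #|K| = (q ^ pdeg p)%N, (forall r, (ev r == 0) = (p %| r))
      & forall y, exists r, ev r = y].
Proof.
move=> [pm pI]; have hI : monic_irreducible_poly p by [].
exists ({poly %/ p with hI} : finFieldType).
exists (in_qpoly p : {rmorphism {poly F} -> {poly %/ p with hI}}).
have mE := mk_monicE hI.
split; first exact: card_qfpoly.
- move=> r; apply/eqP/idP => [/val_eqP /=|pr].
    by rewrite -Pdiv.IdomainMonic.modpE ?mE.
  by apply/val_eqP; rewrite /= -Pdiv.IdomainMonic.modpE ?mE.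
- move=> y; exists (val y); apply: val_inj; rewrite /= Pdiv.CommonRing.rmodp_small//.
  exact: size_mk_monic.
Qed.

Lemma expf_cardX (K : finFieldType) k m (y : K) : #|K| = (q ^ k)%N -> y ^+ (q ^ (k * m)) = y.
Proof.
move=> cK; elim: m => [|m IH]; first by rewrite muln0 expn0 expr1.
by rewrite mulnS expnD exprM -cK expf_card IH.
Qed.

Definition frobenius_poly m : {poly F} := 'X^(q ^ m) - 'X.

Lemma size_frobenius_poly m : (0 < m)%N -> size (frobenius_poly m) = (q ^ m).+1.
Proof.
move=> m0; rewrite /frobenius_poly size_polyDl ?size_polyXn// size_polyN size_polyX ltnS.
exact: expn_card_gt1.
Qed.

Lemma dvdp_frobenius_poly p m : monic_irreducibles p -> (pdeg p %| m)%N ->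
  p %| frobenius_poly m.
Proof.
move=> pI /dvdnP[k ->]; have [K [ev [cK ev0 _]]] := residue_field pI.
by rewrite -ev0 rmorphB rmorphXn/= mulnC (expf_cardX _ _ cK) subrr.
Qed.

(** The power map is additive because [q ^ m] is a power of the characteristic, and it fixes the
    constants; so fixing the image of ['X] is enough. *)
Lemma frobenius_fix (K : finFieldType) (ev : {rmorphism {poly F} -> K}) m r :
  ev 'X ^+ (q ^ m) = ev 'X -> ev r ^+ (q ^ m) = ev r.
Proof.
move=> evX; have [l [k [lp lF cq]]] := card_prime_power.
have nK : [pchar K].-nat (q ^ m)%N.
  rewrite cq -expnM; apply/pnatP; first by rewrite expn_gt0 prime_gt0.
  move=> l' l'p; rewrite Euclid_dvdX// => /andP[+ _].
  rewrite dvdn_prime2// => /eqP->.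
  by apply: (rmorph_pchar (ev \o polyC)).
elim/poly_ind: r => [|r c IH]; first by rewrite rmorph0 expr0n expn_eq0 gtn_eqF// ltnW// card_gt1.
rewrite rmorphD rmorphM/= exprDn_pchar// exprMn IH evX; congr (_ + _).
rewrite -rmorphXn -rmorphXn /=; congr (ev _%:P).
elim: (m) => [|n IHn]; first by rewrite expn0 expr1.
by rewrite expnS exprM expf_card.
Qed.

(** All elements of the residue field, of size q^d, are fixed by the power q^m, hence by q^s with s
    the remainder of m modulo d. If s > 0, then X^(q^s) - X has q^d roots, more than its degree. *)
Lemma pdeg_dvdn_frobenius p m : monic_irreducibles p ->
  p %| frobenius_poly m -> (pdeg p %| m)%N.
Proof.
move=> pI pG; have [K [ev [cK ev0 evs]]] := residue_field pI.
have d0 : (0 < pdeg p)%N by rewrite /pdeg -subn1 subn_gt0 pI.2.1.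
have fixm y : y ^+ (q ^ m) = y :> K.
  have [r <-] := evs y; apply: frobenius_fix; apply/eqP.
  by rewrite -subr_eq0 -rmorphXn -rmorphB ev0.
have fixr y : y ^+ (q ^ (m %% pdeg p)) = y :> K.
  rewrite -[RHS]fixm {2}(divn_eq m (pdeg p)) expnD exprM mulnC.
  by rewrite (expf_cardX _ _ cK).
rewrite /dvdn; apply: contraT; rewrite -lt0n => r0.
have rd : (m %% pdeg p < pdeg p)%N by rewrite ltn_mod.
move: (m %% _)%N r0 rd fixr => s s0 sd fixs.
pose G : {poly K} := 'X^(q ^ s) - 'X.
have s1 : (1 < q ^ s)%N by exact: expn_card_gt1.
have sG : size G = (q ^ s).+1.
  by rewrite /G size_polyDl ?size_polyXn// size_polyN size_polyX ltnS.
have G0 : G != 0 by rewrite -size_poly_gt0 sG.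
have rG : all (root G) (enum K).
  by apply/allP => y _; rewrite rootE !hornerE fixs subrr.
have := max_poly_roots G0 rG (enum_uniq K).
by rewrite -cardE cK sG ltnS leq_exp2l ?card_gt1// leqNgt sd.
Qed.

Definition irr d : seq {poly F} :=
  [seq val a | a <- enum {poly_(d.+1) F} &
     [&& val a \is monic, size (val a) == d.+1 & irreducibleb (val a)]].

Lemma mem_irr d p : (p \in irr d) <-> (monic_irreducibles p /\ pdeg p = d).
Proof.
split.
  move=> /mapP[a + ->]; rewrite mem_filter => /andP[/and3P[am /eqP sa /irreducibleP ia] _].
  by split=> //; rewrite /pdeg sa.
move=> [[pm pI] pd]; have sp : size p = d.+1.
  by rewrite -pd /pdeg prednK// ltnW// pI.1.
apply/mapP; exists (npolyp d.+1 p); last by rewrite /= npolypK// sp.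
rewrite mem_filter mem_enum /= npolypK ?sp// pm eqxx /=; rewrite andbT.
exact/irreducibleP.
Qed.

Lemma irr_uniq d : uniq (irr d).
Proof. by rewrite map_inj_uniq; [apply: filter_uniq; exact: enum_uniq|exact: val_inj]. Qed.

Definition npi d := size (irr d).

Lemma coprimep_monic_irr p r : monic_irreducibles p -> monic_irreducibles r ->
  p != r -> coprimep p r.
Proof.
move=> pI rI pr; have [p0 r0] := (monic_neq0 pI.1, monic_neq0 rI.1).
rewrite coprimep_def; apply: contraT => g1.
have gp := pI.2.2 _ g1 (dvdp_gcdl p r); have gr := rI.2.2 _ g1 (dvdp_gcdr p r).
by move: pr; rewrite -(eqp_monic pI.1 rI.1) (eqp_trans _ gr)// eqp_sym.
Qed.

Lemma prod_irr_dvdp (s : seq {poly F}) (a : {poly F}) : uniq s ->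
  {in s, forall p, monic_irreducibles p} -> {in s, forall p, p %| a} ->
  \prod_(p <- s) p %| a.
Proof.
elim: s => [|p s IH] /=; first by rewrite big_nil dvd1p.
move=> /andP[ps us] sI sa; rewrite big_cons Gauss_dvdp.
  rewrite sa ?inE ?eqxx//= IH// => r rs; [apply: sI|apply: sa]; by rewrite inE rs orbT.
rewrite big_seq; elim/big_ind: _ => [|? ? ? ?|r rs]; first exact: coprimep1.
  by rewrite coprimepMr; apply/andP.
apply: coprimep_monic_irr; [by apply: sI; rewrite inE eqxx|by apply: sI; rewrite inE rs orbT|].
by apply: contraNneq ps => ->.
Qed.

Lemma monic_prod_irr (s : seq {poly F}) : {in s, forall p, monic_irreducibles p} ->
  \prod_(p <- s) p \is monic.
Proof. by move=> sI; rewrite big_seq; apply: monic_prod => p /sI[]. Qed.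

Lemma size_prod_irr (s : seq {poly F}) : {in s, forall p, monic_irreducibles p} ->
  size (\prod_(p <- s) p) = (\sum_(p <- s) pdeg p)%N.+1.
Proof.
elim: s => [|p s IH] sI; first by rewrite !big_nil size_poly1.
have sI' : {in s, forall p, monic_irreducibles p}.
  by move=> r rs; apply: sI; rewrite inE rs orbT.
have pI : monic_irreducibles p by apply: sI; rewrite inE eqxx.
rewrite !big_cons size_Mmonic ?monic_neq0 ?monic_prod_irr// ?pI.1//.
rewrite IH// addnS /= /pdeg; have := pI.2.1; by case: (size p).
Qed.

Definition irr_dvd m : seq {poly F} := flatten [seq irr d | d <- divisors m].

Lemma mem_irr_dvd m p : (0 < m)%N ->
  (p \in irr_dvd m) <-> (monic_irreducibles p /\ (pdeg p %| m)%N).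
Proof.
move=> m0; split.
  move=> /flattenP[_ /mapP[d + ->]]; rewrite -dvdn_divisors// => dm /mem_irr[pI pd].
  by rewrite pd.
move=> [pI pm]; apply/flattenP; exists (irr (pdeg p)); last by apply/mem_irr.
by apply/mapP; exists (pdeg p) => //; rewrite -dvdn_divisors.
Qed.

Lemma uniq_flatten_irr (s : seq nat) : uniq s -> uniq (flatten [seq irr d | d <- s]).
Proof.
elim: s => //= d s IH /andP[ds us]; rewrite cat_uniq irr_uniq IH// andbT /=.
apply/hasPn => p /flattenP[_ /mapP[d' d's ->] /mem_irr[_ pd']].
apply: contra ds => /mem_irr[_ <-]; by rewrite pd'.
Qed.

(** The product [P] of the irreducibles of degree dividing [m] divides [G]. An irreducible factor of
    the cofactor would divide [P] too, so its square would divide [G] and it would divide the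
    derivative -1. Hence the cofactor is constant and degrees can be compared. *)
Lemma sum_npi m : (0 < m)%N -> (\sum_(d <- divisors m) d * npi d)%N = (q ^ m)%N.
Proof.
move=> m0; set G := frobenius_poly m; set P := \prod_(p <- irr_dvd m) p.
have sI : {in irr_dvd m, forall p, monic_irreducibles p}.
  by move=> p /(mem_irr_dvd _ m0)[].
have us : uniq (irr_dvd m) by rewrite uniq_flatten_irr// divisors_uniq.
have PG : P %| G.
  apply: prod_irr_dvdp => // p /(mem_irr_dvd _ m0)[pI pm].
  exact: dvdp_frobenius_poly.
have dG : deriv G = -1.
  have [l [k [lp lF cq]]] := card_prime_power.
  rewrite /G /frobenius_poly derivB derivXn derivX -mulr_natr.
  suff -> : (q ^ m)%:R = 0 :> {poly F} by rewrite mulr0 sub0r.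
  rewrite -polyC_natr natrX; suff -> : q%:R = 0 :> F by rewrite expr0n gtn_eqF// polyC0.
  have k0 : (0 < k)%N by case: (k) cq => // cq; have := card_gt1; rewrite cq.
  by rewrite cq natrX (pcharf0 lF) expr0n gtn_eqF.
have G0 : G != 0 by rewrite -size_poly_gt0 size_frobenius_poly.
have [H GE] := dvdpP _ _ PG.
have P0 : P != 0 by rewrite monic_neq0// monic_prod_irr.
have H0 : H != 0 by apply: contraNneq G0 => H0; rewrite GE H0 mul0r.
have sH : size H = 1%N.
  apply/eqP; rewrite eqn_leq size_poly_gt0 H0 andbT leqNgt; apply/negP => /monic_irreducible_dvdp[p [pI pH]].
  have pP : p %| P.
    have : p \in irr_dvd m.
      apply/mem_irr_dvd => //; split=> //; apply: pdeg_dvdn_frobenius => //.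
      by rewrite -/G GE dvdp_mulr.
    by move=> ps; rewrite /P (big_rem p)//= dvdp_mulr.
  have : p %| deriv G.
    have [H' HE] := dvdpP _ _ pH; have [P' PE] := dvdpP _ _ pP.
    rewrite GE HE PE (_ : H' * p * (P' * p) = p * (p * (H' * P'))); last by ring.
    rewrite derivM; apply: dvdp_add; first by rewrite dvdp_mull// dvdp_mulr.
    by rewrite dvdp_mulr.
  rewrite dG dvdpNr dvdp1 => /eqP p1.
  by have := pI.2.1; rewrite p1.
have : size G = (\sum_(p <- irr_dvd m) pdeg p)%N.+1.
  by rewrite GE size_Mmonic ?monic_prod_irr// sH add1n /= size_prod_irr.
rewrite size_frobenius_poly// => -[->].
rewrite /irr_dvd big_flatten big_map /=; apply: eq_bigr => d _.
rewrite big_seq (eq_bigr (fun=> d)); last by move=> p /mem_irr[].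
by rewrite -big_seq big_const_seq iter_addn_0 count_predT mulnC.
Qed.
End Counting.

(** * Mertens estimates *)

Lemma sum_divisors_swap (V : zmodType) (f : nat -> nat -> V) n :
  \sum_(1 <= m < n.+1) \sum_(d <- divisors m) f d m =
  \sum_(1 <= d < n.+1) \sum_(k < n %/ d) f d (d * k.+1)%N.
Proof.
elim: n => [|n IH]; first by rewrite !big_geq.
rewrite big_nat_recr//= IH [RHS]big_nat_recr//= divnn /= big_ord1 muln1.
have -> : \sum_(1 <= d < n.+1) \sum_(k < n.+1 %/ d) f d (d * k.+1)%N =
    \sum_(1 <= d < n.+1) \sum_(k < n %/ d) f d (d * k.+1)%N +
    \sum_(1 <= d < n.+1 | (d %| n.+1)%N) f d n.+1.
  rewrite [X in _ = _ + X]big_mkcond -big_split /= big_nat [RHS]big_nat.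
  apply: eq_bigr => d /andP[d0 _]; rewrite divnS//.
  case: ifP => dn; last by rewrite add0n addr0.
  rewrite add1n big_ord_recr /=; congr (_ + f _ _).
  have := divnK dn; rewrite divnS// dn add1n mulnC => -> //.
rewrite -addrA; congr (_ + _).
have -> : \sum_(d <- divisors n.+1) f d n.+1 = \sum_(1 <= d < n.+2 | (d %| n.+1)%N) f d n.+1.
  rewrite -[RHS]big_filter; apply: perm_big; apply: uniq_perm.
  - exact: divisors_uniq.
  - by rewrite filter_uniq// iota_uniq.
  - move=> d; rewrite mem_filter mem_index_iota -dvdn_divisors//.
    have [dn|//] := boolP (d %| n.+1)%N; rewrite /= (dvdn_gt0 _ dn)//=.
    by rewrite ltnS dvdn_leq.
by rewrite big_mkcond big_nat_recr//= dvdnn -big_mkcond.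
Qed.

Lemma geom_sum_le (R : realType) (y : R) (a b : nat) : 0 <= y < 1 ->
  \sum_(a <= e < b) y ^+ e <= y ^+ a / (1 - y).
Proof.
move=> /andP[y0 y1]; have y1' : 0 < 1 - y by rewrite subr_gt0.
have [ab|ba] := leqP a b; last first.
  by rewrite big_geq ?(ltnW ba)// divr_ge0 ?exprn_ge0// ltW.
have -> : \sum_(a <= e < b) y ^+ e = (y ^+ a - y ^+ b) / (1 - y).
  elim: b ab => [|b IH]; first by rewrite leqn0 => /eqP->; rewrite big_geq// subrr mul0r.
  rewrite leq_eqVlt => /predU1P[<-|ab]; first by rewrite big_geq// subrr mul0r.
  by rewrite big_nat_recr//= IH// exprS; field; rewrite gt_eqF.
by rewrite ler_pM2r ?invr_gt0// lerBlDr lerDl exprn_ge0.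
Qed.

Section MertensBound.
Variables (R : realType) (F : finFieldType).
Local Notation q := #|F|.
Local Notation y := (q%:R^-1 : R).
Local Notation npi := (npi F).

Lemma q_gt1 : 1 < q%:R :> R. Proof. by rewrite ltr1n card_gt1. Qed.

Lemma invq_itv : 0 < y < 1.
Proof. by have := q_gt1 => q1; rewrite invr_gt0 invf_lt1; lra. Qed.

Lemma npi_le d : (0 < d)%N -> (d * npi d <= q ^ d)%N.
Proof.
move=> d0; rewrite -(sum_npi F d0) (big_rem d) /=; first exact: leq_addr.
by rewrite -dvdn_divisors// dvdnn.
Qed.

Lemma npi1 : npi 1 = q.
Proof.
by have := sum_npi F (ltn0Sn 0); rewrite (_ : divisors 1 = [:: 1%N])// big_seq1 mul1n expn1.
Qed.

Lemma npi_prime d : prime d -> (d * npi d + q = q ^ d)%N.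
Proof.
move=> dp; rewrite -(sum_npi F (prime_gt0 dp)).
rewrite (perm_big [:: d; 1%N]) /=; last first.
  apply: uniq_perm; rewrite ?divisors_uniq//=.
    by rewrite inE andbT neq_ltn prime_gt1// orbT.
  move=> e; rewrite -dvdn_divisors ?prime_gt0// !inE.
  apply/idP/idP => [|/orP[]/eqP->]; rewrite ?dvdnn ?dvd1n//.
  by move/primeP: dp => [_ h] /h /orP[]->; rewrite ?orbT.
by rewrite big_cons big_seq1 mul1n npi1.
Qed.

(** The product of 1 - 1/|p| over all irreducibles of degree at most [n], grouped by degree; see
    [coprod_irr_upto]. *)
Definition mertens_prod n : R := \prod_(1 <= d < n.+1) (1 - y ^+ d) ^+ npi d.

Definition mertens_err n : R :=
  (y ^+ (n./2).+1 + y ^+ (n - n./2).+1) / (n.+1%:R * (1 - y) ^+ 2).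

Lemma expy_itv d : (0 < d)%N -> 0 < y ^+ d <= y.
Proof.
have /andP[y0 y1] := invq_itv; case: d => // d _.
rewrite exprn_gt0//= exprS ler_piMr ?(ltW y0)// exprn_ile1 ?(ltW y0)//; exact: ltW.
Qed.

(** For d > n/2 the quotient is 1 and the terms form a geometric series. For d <= n/2 the exponent
    is at least n - d + 1, which gives another one. *)
Lemma sum_floor_le n :
  \sum_(1 <= d < n.+1) y ^+ (d * (n %/ d)) <=
  (y ^+ (n./2).+1 + y ^+ (n - n./2).+1) / (1 - y).
Proof.
have /andP[y0 y1] := invq_itv.
have hn : (n./2 <= n)%N by rewrite -[leqRHS]odd_double_half -addnn addnA leq_addl.
rewrite (@big_cat_nat _ _ _ (n./2).+1)//= addrC mulrDl; apply: lerD.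
  rewrite (_ : \sum_(_ <= _ < _) _ = \sum_((n./2).+1 <= d < n.+1) y ^+ d); first by apply: geom_sum_le; rewrite (ltW y0) y1.
  rewrite big_nat [RHS]big_nat; apply: eq_bigr => d /andP[hd dn].
  suff -> : (n %/ d = 1)%N by rewrite muln1.
  have d0 : (0 < d)%N by exact: leq_ltn_trans hd.
  have nd : (n - d < d)%N.
    by have := leq_b1 (odd n); have := odd_double_half n; lia.
  by rewrite -{1}(subnKC (ltnSE dn)) divnDl ?dvdnn// divnn d0 divn_small.
apply: (@le_trans _ _ (\sum_(1 <= d < (n./2).+1) y ^+ (n - d).+1)).
  rewrite big_nat [leRHS]big_nat; apply: ler_sum => d /andP[d0 dh].
  rewrite ler_wiXn2l ?(ltW y0) ?(ltW y1)//.
  have := divn_eq n d; have := ltn_pmod n d0; lia.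
rewrite big_nat_rev/= big_nat.
rewrite (eq_bigr (fun d => y ^+ (n - n./2) * y ^+ d)); last first.
  by move=> d /andP[d0 dh]; rewrite -exprD; congr (_ ^+ _); lia.
rewrite -big_nat -mulr_sumr exprSr -mulrA ler_wpM2l ?exprn_ge0 ?(ltW y0)//.
have := @geom_sum_le R y 1 (n./2).+1; rewrite expr1; apply.
by rewrite (ltW y0) y1.
Qed.

(** The logarithm of the factor of degree d is cut after [n %/ d] terms, which keeps the powers y^m
    with m <= n. Regrouped by m = d k, the coefficient of y^m / m is the sum of d pi(d) over the
    divisors d of m, that is q^m, and the kept part is exactly the harmonic sum. *)
Lemma mertens_lower n : (0 < n)%N ->
  expR (- (harmonic_sum R n + mertens_err n)) <= mertens_prod n.
Proof.
move=> n0; have /andP[y0 y1] := invq_itv; have y1' : 0 < 1 - y by rewrite subr_gt0.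
have q0 : 0 < q%:R :> R by rewrite (lt_trans _ q_gt1).
pose L d := \sum_(i < n %/ d) (y ^+ d) ^+ i.+1 / i.+1%:R +
  (y ^+ d) ^+ (n %/ d).+1 / ((n %/ d).+1%:R * (1 - y ^+ d)).
have step : expR (- \sum_(1 <= d < n.+1) L d *+ npi d) <= mertens_prod n.
  rewrite -sumrN expR_sum /mertens_prod big_nat [leRHS]big_nat.
  apply: ler_prod => d /andP[d0 _]; rewrite expR_ge0/=.
  rewrite -mulNrn -[_ *+ npi d]mulr_natl expRM_natl; apply: ler_exp_nneg; first exact: expR_ge0.
  apply: onemx_ge_exp; have /andP[h1 h2] := expy_itv d0.
  by rewrite ltW//= (le_lt_trans h2).
apply: le_trans step; rewrite ler_expR lerN2.
have main : \sum_(1 <= d < n.+1) (\sum_(i < n %/ d) (y ^+ d) ^+ i.+1 / i.+1%:R) *+ npi d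
    = harmonic_sum R n.
  pose g d m : R := y ^+ m / m%:R * (d * npi d)%:R.
  rewrite (_ : \sum_(_ <= _ < _) _ =
      \sum_(1 <= d < n.+1) \sum_(i < n %/ d) g d (d * i.+1)%N); last first.
    rewrite big_nat [RHS]big_nat; apply: eq_bigr => d /andP[d0 _].
    rewrite -sumrMnl; apply: eq_bigr => k _.
    rewrite -[LHS]mulr_natr /g !natrM -exprM.
    have k0 : k.+1%:R != 0 :> R by rewrite pnatr_eq0.
    have dn0 : d%:R != 0 :> R by rewrite pnatr_eq0 -lt0n.
    move: (y ^+ _) (k.+1%:R) (d%:R) ((npi d)%:R) k0 dn0 => Y a b c a0 b0.
    by field; rewrite a0 b0.
  rewrite -sum_divisors_swap /harmonic_sum /series /= big_add1 /=.
  apply: eq_bigr => m _; rewrite /g.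
  rewrite -mulr_sumr -natr_sum sum_npi// natrX exprVn mulrAC mulVf ?mul1r//.
  by rewrite expf_neq0// gt_eqF.
rewrite (eq_bigr (fun d => (\sum_(i < n %/ d) (y ^+ d) ^+ i.+1 / i.+1%:R) *+ npi d +
   ((y ^+ d) ^+ (n %/ d).+1 / ((n %/ d).+1%:R * (1 - y ^+ d))) *+ npi d)); last first.
  by move=> d _; rewrite mulrnDl.
rewrite big_split /= main lerD2l.
apply: (@le_trans _ _ ((n.+1%:R * (1 - y))^-1 * \sum_(1 <= d < n.+1) y ^+ (d * (n %/ d)))).
  rewrite mulr_sumr big_nat [leRHS]big_nat; apply: ler_sum => d /andP[d0 dn].
  have /andP[yd0 yd1] := expy_itv d0.
  have yd1' : 0 < 1 - y ^+ d by rewrite subr_gt0 (le_lt_trans yd1).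
  have h1 : (npi d)%:R * y ^+ d <= d%:R^-1.
    rewrite -[leRHS]mul1r ler_pdivlMr ?ltr0n// mulrAC -natrM mulnC exprVn.
    by rewrite ler_pdivrMr ?exprn_gt0// mul1r -natrX ler_nat npi_le.
  have h2 : (d%:R * (n %/ d).+1%:R * (1 - y ^+ d))^-1 <= (n.+1%:R * (1 - y))^-1.
    rewrite lef_pV2 ?posrE ?mulr_gt0 ?ltr0n//.
    apply: ler_pM; rewrite ?ler0n ?(ltW y1')//; last by rewrite lerD2l lerN2.
    by rewrite -natrM ler_nat mulnC ltn_ceil.
  have -> : ((y ^+ d) ^+ (n %/ d).+1 / ((n %/ d).+1%:R * (1 - y ^+ d))) *+ npi d
     = ((npi d)%:R * y ^+ d) * (y ^+ (d * (n %/ d)) / ((n %/ d).+1%:R * (1 - y ^+ d))).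
    by rewrite -mulr_natl exprS exprM; ring.
  apply: le_trans (ler_wpM2r _ h1) _.
    by rewrite divr_ge0 ?exprn_ge0 ?(ltW y0)// mulr_ge0// ltW.
  rewrite mulrCA [leRHS]mulrC; apply: ler_wpM2l; first by rewrite exprn_ge0// ltW.
  by rewrite -invfM mulrA.
rewrite /mertens_err; apply: le_trans (ler_wpM2l _ (sum_floor_le n)) _.
  by rewrite invr_ge0 mulr_ge0// ltW.
rewrite le_eqVlt; apply/orP; left; apply/eqP.
rewrite mulrC -mulrA -!invfM; congr (_ / _); ring.
Qed.
End MertensBound.

Section RealLemmas.
Variable R : realType.
Implicit Types x z : R.

Lemma expRN_ge_cubic z : 0 <= z -> 1 - z + z ^+ 2 / 2 - z ^+ 3 / 6 <= expR (- z).
Proof.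
move=> z0; pose p : {poly R} := 1 - 'X + 2^-1 *: 'X^2 - 6^-1 *: 'X^3.
have pE s : p.[s] = 1 - s + s ^+ 2 / 2 - s ^+ 3 / 6.
  by rewrite /p !(hornerD, hornerN, hornerZ, hornerX, hornerXn, hornerC); ring.
have dpE s : (deriv p).[s] = -1 + s - s ^+ 2 / 2.
  by rewrite /p !(derivD, derivN, derivZ, derivX, derivXn, derivC)
    !(hornerD, hornerN, hornerZ, hornerX, hornerXn, hornerMn, hornerC) /=; field.
(* The factor exp s makes the derivative collapse: [p] plus its derivative is -s^3/6. *)
pose f s : R := - (expR s * p.[s]).
suff : f 0 <= f z.
  rewrite /f lerN2 expR0 mul1r [p.[0]]pE !expr0n /= !mul0r !subr0 addr0 pE expRN => h.
  by rewrite -[leRHS]mul1r ler_pdivlMr ?expR_gt0// mulrC.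
apply: (@le_of_derive_ge0 _ f (fun s => - (expR s *: (deriv p).[s] + p.[s] *: expR s))) => // s /andP[s0 _].
have -> : - (expR s *: (deriv p).[s] + p.[s] *: expR s) = expR s * (s ^+ 3 / 6).
  by rewrite dpE pE /GRing.scale /=; ring.
by rewrite mulr_ge0 ?expR_ge0// divr_ge0// exprn_ge0.
Qed.

Lemma expRN_le_quadratic z : 0 <= z -> expR (- z) <= 1 - z + z ^+ 2 / 2.
Proof.
move=> z0; have e3 := expR_ge_series 3 z0.
have {}e3 : 1 + z + z ^+ 2 / 2 <= expR z.
  apply: le_trans e3; rewrite /series /= !big_nat_recr//= big_geq//.
  by rewrite /exp_coeff /= !factS fact0 /= expr0 expr1; lra.
rewrite expRN -[leLHS]mul1r ler_pdivrMr ?expR_gt0//.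
have z2 : 0 <= z ^+ 2 by exact: sqr_ge0.
have h : 0 <= 1 - z + z ^+ 2 / 2 by nra.
apply: le_trans (ler_wpM2l h e3).
have -> : (1 - z + z ^+ 2 / 2) * (1 + z + z ^+ 2 / 2) = 1 + z ^+ 4 / 4 by field.
by rewrite lerDl divr_ge0// exprn_ge0.
Qed.

Lemma sinh_lower z : 0 <= z -> 2 * z + z ^+ 3 / 6 <= expR z - expR (- z).
Proof.
move=> z0; have := expRN_le_quadratic z0.
have e4 := expR_ge_series 4 z0.
have {}e4 : 1 + z + z ^+ 2 / 2 + z ^+ 3 / 6 <= expR z.
  apply: le_trans e4; rewrite /series /= !big_nat_recr//= big_geq//.
  by rewrite /exp_coeff /= !factS fact0 /= expr0 expr1; lra.
lra.
Qed.

Lemma mul_expn_noninc (y : R) k0 k : 0 <= y <= 2^-1 -> (0 < k0 <= k)%N ->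
  k%:R * y ^+ k <= k0%:R * y ^+ k0.
Proof.
move=> /andP[y0 y1] /andP[k00]; elim: k => [|k IH]; first by rewrite leqNgt k00.
rewrite leq_eqVlt => /predU1P[->//|]; rewrite ltnS => kk.
apply: le_trans (IH kk); rewrite exprS mulrA ler_wpM2r ?exprn_ge0//.
have : 1 <= k%:R :> R by rewrite ler1n (leq_trans k00).
rewrite -natr1; nra.
Qed.

End RealLemmas.

(** * Mertens estimates sharpened by Euler's constant *)

Section Tight.
Variables (R : realType) (F : finFieldType).
Local Notation q := #|F|.
Local Notation y := (q%:R^-1 : R).
Local Notation M := (mertens_prod R F).
Local Notation G := (expR (euler_gamma : R)).
Local Notation eps := (mertens_err R F).

Lemma invq_le k : (0 < k)%N -> (k <= q)%N -> y <= k%:R^-1.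
Proof. by move=> k0 kq; rewrite lef_pV2 ?posrE ?ltr0n ?(leq_trans k0)// ler_nat. Qed.

(** Makes the error numerical on a range of q: [Y] is the largest value of 1/q there, and in the
    applications [c] is the exact value of 1/(1 - Y)^2. *)
Lemma mertens_err_le n (Y c : R) : y <= Y -> Y < 1 -> 1 <= c * (1 - Y) ^+ 2 ->
  eps n <= c * (Y ^+ (n./2).+1 + Y ^+ (n - n./2).+1) / n.+1%:R.
Proof.
move=> yY Y1 cY; have /andP[y0 y1] := invq_itv R F.
have YY : 0 < (1 - Y) ^+ 2 by rewrite exprn_gt0// subr_gt0.
rewrite /mertens_err [n.+1%:R * _]mulrC invfM mulrA; apply: ler_wpM2r.
  by rewrite invr_ge0.
rewrite mulrC; apply: ler_pM.
- by rewrite invr_ge0 exprn_ge0// subr_ge0 ltW.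
- by rewrite addr_ge0// exprn_ge0// ltW.
- rewrite -[leLHS]mul1r ler_pdivrMr ?exprn_gt0 ?subr_gt0//; apply: (le_trans cY).
  have c0 : 0 <= c by rewrite -(pmulr_lge0 _ YY); exact: le_trans ler01 cY.
  apply: (ler_wpM2l c0); apply: ler_exp_nneg; lra.
- by apply: lerD; apply: ler_exp_nneg => //; exact: ltW.
Qed.

Lemma mertens_gamma n : (0 < n)%N ->
  expR (- (1 / (2 * n%:R) - 1 / (12 * n%:R ^+ 2) + 1 / (120 * n%:R ^+ 4) + eps n))
  <= G * n%:R * M n.
Proof.
move=> n0; have nn : 0 < n%:R :> R by rewrite ltr0n.
have /andP[lo _] := euler_gamma_bounds R n0.
have H := mertens_lower R F n0.
apply: (@le_trans _ _ (G * n%:R * expR (- (harmonic_sum R n + eps n)))); last first.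
  by rewrite ler_wpM2l// mulr_ge0 ?expR_ge0// ltW.
have nE : n%:R = expR (ln n%:R) :> R by rewrite lnK ?posrE.
rewrite [X in _ <= _ * X * _]nE -!expRD ler_expR.
move: lo; rewrite /gamma_lower /gamma_upper; move: (ln _) => L.
move: (harmonic_sum R n) (euler_gamma : R) (eps n) (1 / _) (1 / _) (1 / _) => h g e a b c; lra.
Qed.

Lemma mertens_gamma_cubic n z : (0 < n)%N ->
  1 / (2 * n%:R) - 1 / (12 * n%:R ^+ 2) + 1 / (120 * n%:R ^+ 4) + eps n <= z ->
  0 <= z ->
  1 - z + z ^+ 2 / 2 - z ^+ 3 / 6 <= G * n%:R * M n.
Proof.
move=> n0 hz z0; apply: le_trans (mertens_gamma n0).
by apply: le_trans (expRN_ge_cubic z0) _; rewrite ler_expR lerN2.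
Qed.

(** Let u = 1/d. As H_(d-1) = H_d - u, the correction -u/2 in the expansion of gamma becomes +u/2,
    and exp(u/2) (1 - exp(-u)) is 2 sinh(u/2). Its cubic term gives a relative surplus of order u^2,
    which absorbs the error. *)
Lemma mertens_prev d : (1 < d)%N -> 10 * d%:R ^+ 2 * eps d.-1 <= 1 ->
  (4 <= d)%N -> 1 / d%:R ^+ 2 <= G * M d.-1 * (1 - expR (- d%:R^-1)).
Proof.
move=> d1 he d4.
have d0 : (0 < d)%N by exact: ltnW.
have dd : 4 <= d%:R :> R by rewrite ler_nat.
have H := mertens_lower R F (_ : 0 < d.-1)%N.
have {H}H : expR (- (harmonic_sum R d - d%:R^-1 + eps d.-1)) <= M d.-1.
  suff -> : harmonic_sum R d - d%:R^-1 = harmonic_sum R d.-1 by apply: H; case: (d) d1 => [|[]].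
  by rewrite -{1 2}(prednK d0) harmonic_sumS addrK.
have /andP[lo _] := euler_gamma_bounds R d0.
pose u : R := d%:R^-1.
have u0 : 0 < u by rewrite invr_gt0; lra.
have u4 : u <= 4^-1 by rewrite lef_pV2 ?posrE//; lra.
have ud : u * d%:R = 1 by rewrite mulVf// gt_eqF//; lra.
have he' : eps d.-1 <= u ^+ 2 / 10.
  have -> : eps d.-1 = u ^+ 2 / 10 * (10 * d%:R ^+ 2 * eps d.-1).
    transitivity ((u * d%:R) ^+ 2 * eps d.-1); first by rewrite ud expr1n mul1r.
    by field.
  by rewrite -[leRHS]mulr1 ler_wpM2l// divr_ge0// exprn_ge0// ltW.
pose del := u ^+ 2 / 12 - u ^+ 4 / 120 - eps d.-1.
have h1 : expR (u / 2 + del) * u <= G * M d.-1.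
  apply: (@le_trans _ _ (G * expR (- (harmonic_sum R d - d%:R^-1 + eps d.-1)))); last first.
    by rewrite ler_wpM2l// expR_ge0.
  have -> : u = expR (- ln (d%:R)) by rewrite expRN lnK// posrE; lra.
  rewrite -!expRD ler_expR expRN lnK ?posrE; last by lra.
  have lo' : harmonic_sum R d - ln d%:R - u / 2 + u ^+ 2 / 12 - u ^+ 4 / 120 <= euler_gamma.
    apply: le_trans lo; rewrite /gamma_lower /gamma_upper le_eqVlt; apply/orP; left; apply/eqP.
    by rewrite /u; field; rewrite gt_eqF//; lra.
  rewrite /del -/u; move: lo'; move: (harmonic_sum R d) (ln _) (euler_gamma : R) (eps _) => h l g e.
  lra.
have e0 : 0 <= 1 - expR (- u) by rewrite subr_ge0 expR_le1 oppr_le0 ltW.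
apply: (@le_trans _ _ (expR (u / 2 + del) * u * (1 - expR (- u)))); last first.
  by rewrite ler_wpM2r.
have -> : expR (u / 2 + del) * u * (1 - expR (- u)) =
    expR del * u * (expR (u / 2) - expR (- (u / 2))).
  have -> : - u = - (u / 2) - u / 2 by lra.
  rewrite expRD [expR (_ - _)]expRD; have := expRxMexpNx_1 (u / 2).
  move: (expR (u / 2)) (expR (- (u / 2))) => a b ab.
  have -> : a * expR del * u * (1 - b * b) = expR del * u * (a - a * b * b) by ring.
  by rewrite ab mul1r.
have u2 : 0 <= u / 2 by lra.
have sh := sinh_lower u2.
have ed := expR_ge1Dx del.
have -> : 1 / d%:R ^+ 2 = u * u by rewrite div1r -exprVn expr2.
have uu0 : 0 <= u ^+ 2 by exact: sqr_ge0.
have uu1 : u ^+ 2 <= 16^-1 by nra.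
have uu2 : u ^+ 4 <= u ^+ 2 / 16.
  by rewrite (_ : u ^+ 4 = u ^+ 2 * u ^+ 2); [apply: ler_wpM2l|ring].
(* 1/49 is just below the 1/48 of the sinh bound, so that (1 + del)(1 + u^2/48) >= 1 for u <= 1. *)
have dlo : - (u ^+ 2 / 49) <= del.
  move: he' uu0 uu2; rewrite /del; move: (u ^+ 2) (u ^+ 4) (eps _) => a b e.
  lra.
apply: (@le_trans _ _ ((1 + del) * u * (u + u ^+ 3 / 48))).
  have : 1 <= (1 + del) * (1 + u ^+ 2 / 48) by nra.
  have uu : 0 <= u * u by nra.
  move=> /(ler_wpM2l uu); rewrite mulr1 => /le_trans; apply.
  by rewrite le_eqVlt; apply/orP; left; apply/eqP; field.
have d1' : 0 <= 1 + del by nra.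
apply: ler_pM; [by rewrite mulr_ge0// ltW|by nra|by rewrite ler_wpM2r// ltW|].
apply: le_trans sh; rewrite le_eqVlt; apply/orP; left; apply/eqP; by field.
Qed.
End Tight.

Lemma half_le_sub n : (n./2 <= n - n./2)%N.
Proof. by have := odd_double_half n; lia. Qed.

Lemma leq_double_uphalf d : (d <= 2 * uphalf d)%N.
Proof.
by rewrite uphalf_half mulnDr -{1}(odd_double_half d) mul2n -muln2 -mul2n mulnC leq_add2r leq_pmull.
Qed.

(** * Verification of the condition on irreducibles outside A *)

Section Table.
Variables (R : realType) (F : finFieldType).
Local Notation q := #|F|.
Local Notation y := (q%:R^-1 : R).
Local Notation M := (mertens_prod R F).
Local Notation G := (expR (euler_gamma : R)).
Local Notation eps := (mertens_err R F).
Local Notation npi := (npi F).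

Definition inv_sqr_sum (n D : nat) : R := \sum_(n.+1 <= d < D.+1) (d%:R ^+ 2)^-1.
Local Notation tau := inv_sqr_sum.

Lemma inv_sqr_sumS n D : (n < D)%N -> tau n D = (n.+1%:R ^+ 2)^-1 + tau n.+1 D.
Proof. by move=> nD; rewrite /tau big_ltn. Qed.

Lemma inv_sqr_sum_geq n D : (D <= n)%N -> tau n D = 0.
Proof. by move=> Dn; rewrite /tau big_geq. Qed.

Lemma inv_sqr_sum_ge0 n D : 0 <= tau n D.
Proof. by rewrite sumr_ge0// => d _; rewrite invr_ge0 exprn_ge0. Qed.

Lemma inv_sqr_sum_10 :
  [/\ tau 1 10 <= 550 / 10 ^+ 3, tau 2 10 <= 300 / 10 ^+ 3 & tau 3 10 <= 189 / 10 ^+ 3] /\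
  [/\ tau 4 10 <= 127 / 10 ^+ 3, tau 5 10 <= 87 / 10 ^+ 3 & tau 6 10 <= 59 / 10 ^+ 3] /\
  [/\ tau 7 10 <= 38 / 10 ^+ 3, tau 8 10 <= 23 / 10 ^+ 3 & tau 9 10 <= 11 / 10 ^+ 3].
Proof.
have h9 : tau 9 10 = (10%:R ^+ 2)^-1 by rewrite inv_sqr_sumS// inv_sqr_sum_geq// addr0.
have h8 := @inv_sqr_sumS 8 10 isT; rewrite h9 in h8.
have h7 := @inv_sqr_sumS 7 10 isT; rewrite h8 in h7.
have h6 := @inv_sqr_sumS 6 10 isT; rewrite h7 in h6.
have h5 := @inv_sqr_sumS 5 10 isT; rewrite h6 in h5.
have h4 := @inv_sqr_sumS 4 10 isT; rewrite h5 in h4.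
have h3 := @inv_sqr_sumS 3 10 isT; rewrite h4 in h3.
have h2 := @inv_sqr_sumS 2 10 isT; rewrite h3 in h2.
have h1 := @inv_sqr_sumS 1 10 isT; rewrite h2 in h1.
rewrite h1 h2 h3 h4 h5 h6 h7 h8 h9.
by split; [|split]; split; lra.
Qed.

Lemma inv_sqr_sum_6 :
  [/\ tau 1 6 <= 492 / 10 ^+ 3, tau 2 6 <= 241 / 10 ^+ 3 + 4 / 10 ^+ 4 & tau 3 6 <= 131 / 10 ^+ 3] /\
  (tau 4 6 <= 68 / 10 ^+ 3 /\ tau 5 6 <= 28 / 10 ^+ 3).
Proof.
have h5 : tau 5 6 = (6%:R ^+ 2)^-1 by rewrite inv_sqr_sumS// inv_sqr_sum_geq// addr0.
have h4 := @inv_sqr_sumS 4 6 isT; rewrite h5 in h4.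
have h3 := @inv_sqr_sumS 3 6 isT; rewrite h4 in h3.
have h2 := @inv_sqr_sumS 2 6 isT; rewrite h3 in h2.
have h1 := @inv_sqr_sumS 1 6 isT; rewrite h2 in h1.
rewrite h1 h2 h3 h4 h5.
by split; split; lra.
Qed.

Lemma inv_sqr_sum_3 : tau 1 3 <= 362 / 10 ^+ 3 /\ tau 2 3 <= 112 / 10 ^+ 3.
Proof.
have h2 : tau 2 3 = (3%:R ^+ 2)^-1 by rewrite inv_sqr_sumS// inv_sqr_sum_geq// addr0.
have h1 := @inv_sqr_sumS 1 3 isT; rewrite h2 in h1.
by rewrite h1 h2; split; lra.
Qed.

Lemma mertens_ge0 n : 0 <= M n.
Proof.
have /andP[y0 y1] := invq_itv R F.
rewrite /mertens_prod big_nat prodr_ge0// => d /andP[d0 _].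
have /andP[_ h] := expy_itv R F d0.
by rewrite exprn_ge0// subr_ge0 (le_trans h)// ltW.
Qed.

(** [G] occurs in [G - t] and in the bound on [G * n%:R * M n]. Multiplied by [G * n%:R], the claim
    becomes linear in [G] with slope [A - K * n%:R >= 0], so it suffices to check it at the decimal
    lower bound for [G]. *)
Lemma table_step n z t K : (0 < n)%N ->
  1 / (2 * n%:R) - 1 / (12 * n%:R ^+ 2) + 1 / (120 * n%:R ^+ 4) + eps n <= z ->
  0 <= z <= 1 -> 0 <= t <= 1 ->
  K * (1 + 781 / 10 ^+ 3 + 72 / 10 ^+ 6) * n%:R <=
    (1 + 781 / 10 ^+ 3 + 72 / 10 ^+ 6 - t) * n.+1%:R * (1 - z + z ^+ 2 / 2 - z ^+ 3 / 6) ->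
  K <= (G - t) * n.+1%:R * M n.
Proof.
move=> n0 hz /andP[z0 z1] /andP[t0 t1] hK.
have := mertens_gamma_cubic n0 hz z0.
have T0 : 0 <= 1 - z + z ^+ 2 / 2 - z ^+ 3 / 6.
  have : z ^+ 3 <= 1 by rewrite exprn_ile1.
  have := sqr_ge0 (1 - z); have -> : (1 - z) ^+ 2 = 1 - 2 * z + z ^+ 2 by ring.
  by move: (z ^+ 3) (z ^+ 2) => a b; lra.
move: T0 hK; set T := 1 - z + _ - _ => T0 hK hT.
have /andP[G0 _] := expR_gamma_bounds R.
move: hK G0; set g0 := 1 + _ + _ => hK G0.
have g01 : 1 < g0 by rewrite /g0; lra.
have nn : 0 < n%:R :> R by rewrite ltr0n.
have nG : 0 < G * n%:R by rewrite mulr_gt0// expR_gt0.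
rewrite -(ler_pM2l nG).
apply: (@le_trans _ _ ((G - t) * n.+1%:R * T)); last first.
  rewrite [leRHS](_ : _ = (G - t) * n.+1%:R * (G * n%:R * M n)); last by ring.
  by rewrite ler_wpM2l// mulr_ge0//; lra.
move: hK; set A := n.+1%:R * T => hK.
have A0 : 0 <= A by rewrite mulr_ge0.
have {}hK : K * g0 * n%:R <= (g0 - t) * A by rewrite mulrA.
rewrite -[leRHS]mulrA -/A.
have h : K * n%:R <= A.
  rewrite -(ler_pM2l (lt_trans ltr01 g01)).
  have := mulr_ge0 t0 A0; lra.
have : 0 <= (G - g0) * (A - K * n%:R) by rewrite mulr_ge0 ?subr_ge0.
move: (n%:R : R) (G : R) A hK {h A0 nG nn hT} => N g A hK; lra.
Qed.

(** The factor (n + 1)/n gains 1/n against a loss of about 1/(2n), and from n = 4 and q = 3 on the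
    error is at most 1/(6 (n + 1)). *)
Lemma mertens_large n : (3 <= q)%N -> (4 <= n)%N -> 1 <= G * n.+1%:R * M n.
Proof.
move=> q3 n4; have n0 : (0 < n)%N by exact: leq_trans n4.
have yY : y <= 3%:R^-1 by exact: invq_le.
have he := @mertens_err_le R F n 3^-1 (9 / 4) yY ltac:(lra) ltac:(lra).
have hn : (2 <= n./2)%N by exact: (half_leq n4).
have hn' := half_le_sub n.
have p3 k : (2 <= k)%N -> (3^-1 : R) ^+ k.+1 <= 3^-1 ^+ 3.
  by move=> k2; rewrite ler_wiXn2l//; lra.
have h1 := p3 _ hn; have h2 := p3 _ (leq_trans hn hn').
have nn : 4 <= n%:R :> R by rewrite ler_nat.
pose u : R := n%:R^-1.
have un : u * n%:R = 1 by rewrite mulVf// gt_eqF//; lra.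
have u0 : 0 < u by rewrite invr_gt0; lra.
have u1 : u <= 4^-1 by rewrite lef_pV2 ?posrE//; lra.
have n1E : n.+1%:R = n%:R + 1 :> R by rewrite natr1.
have n1 : 0 < n.+1%:R :> R by rewrite ltr0n.
have he' : n.+1%:R * eps n <= 6^-1.
  rewrite mulrC -ler_pdivlMr//; apply: le_trans he _.
  by rewrite ler_wpM2r ?invr_ge0//; lra.
have hM := mertens_gamma R F n0.
have {}hM : 1 - (u / 2 + eps n) <= G * n%:R * M n.
  apply: le_trans hM; apply: le_trans (expR_ge1Dx _); rewrite lerD2l lerN2.
  have -> : 1 / (2 * n%:R) - 1 / (12 * n%:R ^+ 2) + 1 / (120 * n%:R ^+ 4) =
     u / 2 - u ^+ 2 / 12 + u ^+ 4 / 120.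
    by rewrite /u; field; rewrite gt_eqF//; lra.
  rewrite lerD2r.
  have : u ^+ 4 <= u ^+ 2 by rewrite ler_wiXn2l ?(ltW u0)//; lra.
  by have := sqr_ge0 u; move: (u ^+ 2) (u ^+ 4) => a b; lra.
rewrite -(ler_pM2l u0) mulr1.
have -> : u * (G * n.+1%:R * M n) = u ^+ 2 * n.+1%:R * (G * n%:R * M n).
  transitivity (u * (u * n%:R) * n.+1%:R * G * M n); last by ring.
  by rewrite un; ring.
apply: (@le_trans _ _ (u ^+ 2 * n.+1%:R * (1 - (u / 2 + eps n)))); last first.
  by rewrite ler_wpM2l// mulr_ge0// exprn_ge0// ltW.
have -> : u ^+ 2 * n.+1%:R * (1 - (u / 2 + eps n)) =
    u ^+ 2 * (n.+1%:R * (1 - u / 2)) - u ^+ 2 * (n.+1%:R * eps n) by ring.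
have -> : u ^+ 2 * (n.+1%:R * (1 - u / 2)) = (u * n%:R * u + u ^+ 2) * (1 - u / 2).
  by rewrite n1E; ring.
rewrite un mul1r.
have uu : 0 <= u ^+ 2 by exact: sqr_ge0.
have := ler_wpM2l uu he'; move: (n.+1%:R * eps n) => e.
nra.
Qed.

(** Here and in the later tables the number given to [table_step] is [z]: the exponent in the
    Mertens bound, rounded up. *)
Lemma table_q3 n : (3 <= q <= 4)%N -> (5 <= n <= 9)%N ->
  1 <= (G - tau n 10) * n.+1%:R * M n.
Proof.
move=> /andP[q3 q4] /andP[n5 n9]; have yY : y <= 3%:R^-1 by exact: invq_le.
have [_ [[_ t5 t6] [t7 t8 t9]]] := inv_sqr_sum_10.
have t0 k : 0 <= tau k 10 by exact: inv_sqr_sum_ge0.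
have err k := @mertens_err_le R F k 3^-1 (9 / 4) yY ltac:(lra) ltac:(lra).
have [|{}n5] := leqP n 5.
  move=> n5'; have -> : n = 5%N by apply/eqP; rewrite eqn_leq n5' n5.
  have e : eps 5 <= 9 / 4 * (3^-1 ^+ 3 + 3^-1 ^+ 4) / 6 := err 5%N; apply: (@table_step _ (1152 / 10 ^+ 4)) => //; have h := t0 5%N; try (apply/andP; split); lra.
have [|{}n6] := leqP n 6.
  move=> n6'; have -> : n = 6%N by apply/eqP; rewrite eqn_leq n6' n5.
  have e : eps 6 <= 9 / 4 * (3^-1 ^+ 4 + 3^-1 ^+ 4) / 7 := err 6%N; apply: (@table_step _ (89 / 10 ^+ 3)) => //; have h := t0 6%N; try (apply/andP; split); lra.
have [|{}n7] := leqP n 7.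
  move=> n7'; have -> : n = 7%N by apply/eqP; rewrite eqn_leq n7' n6.
  have e : eps 7 <= 9 / 4 * (3^-1 ^+ 4 + 3^-1 ^+ 5) / 8 := err 7%N; apply: (@table_step _ (745 / 10 ^+ 4)) => //; have h := t0 7%N; try (apply/andP; split); lra.
have [|{}n8] := leqP n 8.
  move=> n8'; have -> : n = 8%N by apply/eqP; rewrite eqn_leq n8' n7.
  have e : eps 8 <= 9 / 4 * (3^-1 ^+ 5 + 3^-1 ^+ 5) / 9 := err 8%N; apply: (@table_step _ (64 / 10 ^+ 3)) => //; have h := t0 8%N; try (apply/andP; split); lra.
have -> : n = 9%N by apply/eqP; rewrite eqn_leq n9 n8.
have e : eps 9 <= 9 / 4 * (3^-1 ^+ 5 + 3^-1 ^+ 6) / 10 := err 9%N; apply: (@table_step _ (56 / 10 ^+ 3)) => //; have h := t0 9%N; try (apply/andP; split); lra.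
Qed.

Lemma table_q3_4 : q = 3 -> 1 - y ^+ 4 <= (G - tau 4 10) * 5%:R * M 4.
Proof.
move=> qE; have yY : y <= 3%:R^-1 by rewrite qE.
have [_ [[t4 _ _] _]] := inv_sqr_sum_10; have t0 := inv_sqr_sum_ge0 4 10.
have e : eps 4 <= 9 / 4 * (3^-1 ^+ 3 + 3^-1 ^+ 3) / 5 :=
  @mertens_err_le R F 4 3^-1 (9 / 4) yY ltac:(lra) ltac:(lra).
rewrite qE; apply: (@table_step _ (154 / 10 ^+ 3)) => //; try (apply/andP; split); lra.
Qed.

Lemma table_q4_4 : q = 4 -> 1 - y ^+ 4 <= (G - tau 4 10) * 5%:R * M 4.
Proof.
move=> qE; have yY : y <= 4%:R^-1 by rewrite qE.
have [_ [[t4 _ _] _]] := inv_sqr_sum_10; have t0 := inv_sqr_sum_ge0 4 10.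
have e : eps 4 <= 16 / 9 * (4^-1 ^+ 3 + 4^-1 ^+ 3) / 5 :=
  @mertens_err_le R F 4 4^-1 (16 / 9) yY ltac:(lra) ltac:(lra).
rewrite qE; apply: (@table_step _ (132 / 10 ^+ 3)) => //; try (apply/andP; split); lra.
Qed.

Lemma mertens_prod1 : M 1 = (1 - y) ^+ q.
Proof. by rewrite /mertens_prod big_nat1 expr1 npi1. Qed.

Lemma mertens_prodS n : M n.+1 = M n * (1 - y ^+ n.+1) ^+ npi n.+1.
Proof. by rewrite /mertens_prod big_nat_recr. Qed.

(** For the smallest [n] the Mertens bound loses too much; there [M n] is evaluated exactly, from
    pi(1) = q and the values of pi at the primes 2 and 3. *)
Lemma table_exact n D m (K t : R) : m <= M n -> 0 <= m -> tau n D <= t -> t <= 1 ->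
  K <= (1 + 781 / 10 ^+ 3 + 72 / 10 ^+ 6 - t) * n.+1%:R * m ->
  K <= (G - tau n D) * n.+1%:R * M n.
Proof.
move=> hm m0 ht t1; have /andP[G0 _] := expR_gamma_bounds R.
have g1 : 1 <= 1 + 781 / 10 ^+ 3 + 72 / 10 ^+ 6 :> R by lra.
move: (1 + _ + _) G0 g1 => g0 G0 g1 /le_trans; apply.
have gt0 : 0 <= g0 - t by lra.
have gt1 : g0 - t <= G - tau n D by lra.
by apply: ler_pM => //; [rewrite mulr_ge0|rewrite ler_wpM2r].
Qed.

Lemma table_q3_123 n : q = 3 -> (0 < n < 4)%N ->
  1 - y ^+ n <= (G - tau n 10) * n.+1%:R * M n.
Proof.
move=> qE /andP[n0 n4].
have [[t1 t2 t3] _] := inv_sqr_sum_10.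
have n2 : npi 2 = 3%N by have := @npi_prime F 2 isT; rewrite qE; lia.
have n3 : npi 3 = 8%N by have := @npi_prime F 3 isT; rewrite qE; lia.
have M1 : M 1 = 8 / 27 by rewrite mertens_prod1 qE; lra.
have M2 : M 2 = 8 / 27 * (8 / 9) ^+ 3.
  by rewrite mertens_prodS M1 qE n2; congr (_ * _ ^+ _); lra.
have M3 : M 3 = 8 / 27 * (8 / 9) ^+ 3 * (26 / 27) ^+ 8.
  by rewrite mertens_prodS M2 qE n3; congr (_ * _ ^+ _); lra.
case: n n0 n4 => [|[|[|[|]]]]// _ _; rewrite qE.
- by apply: (table_exact _ _ t1 (_ : _ <= 1)); rewrite ?M1; [exact: lexx|lra|lra|lra].
- by apply: (table_exact _ _ t2 (_ : _ <= 1)); rewrite ?M2; [exact: lexx|lra|lra|lra].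
- by apply: (table_exact _ _ t3 (_ : _ <= 1)); rewrite ?M3; [exact: lexx|lra|lra|lra].
Qed.

Lemma table_q4_123 n : q = 4 -> (0 < n < 4)%N ->
  1 - y ^+ n <= (G - tau n 10) * n.+1%:R * M n.
Proof.
move=> qE /andP[n0 n4].
have [[t1 t2 t3] _] := inv_sqr_sum_10.
have n2 : npi 2 = 6%N by have := @npi_prime F 2 isT; rewrite qE; lia.
have n3 : npi 3 = 20%N by have := @npi_prime F 3 isT; rewrite qE; lia.
have M1 : M 1 = 81 / (16 * 16) by rewrite mertens_prod1 qE; lra.
have M2 : M 2 = 81 / (16 * 16) * (15 / 16) ^+ 6.
  by rewrite mertens_prodS M1 qE n2; congr (_ * _ ^+ _); lra.
have M3 : M 3 = 81 / (16 * 16) * (15 / 16) ^+ 6 * (63 / 64) ^+ 20.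
  by rewrite mertens_prodS M2 qE n3; congr (_ * _ ^+ _); lra.
case: n n0 n4 => [|[|[|[|]]]]// _ _; rewrite qE.
- by apply: (table_exact _ _ t1 (_ : _ <= 1)); rewrite ?M1; [exact: lexx|lra|lra|lra].
- by apply: (table_exact _ _ t2 (_ : _ <= 1)); rewrite ?M2; [exact: lexx|lra|lra|lra].
- by apply: (table_exact _ _ t3 (_ : _ <= 1)); rewrite ?M3; [exact: lexx|lra|lra|lra].
Qed.

Lemma table_q5_1 : (5 <= q <= 9)%N -> 1 - y ^+ 1 <= (G - tau 1 6) * 2%:R * M 1.
Proof.
move=> /andP[q5 q9]; have [[t1 _ _] _] := inv_sqr_sum_6.
have M1 := mertens_prod1.
have [E|[E|[E|[E|E]]]] : (q = 5 \/ q = 6 \/ q = 7 \/ q = 8 \/ q = 9)%N by lia.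
all: rewrite E in M1 *; apply: (table_exact _ _ t1 (_ : _ <= 1)); rewrite ?M1.
all: (exact: lexx || lra).
Qed.

Lemma table_q5 n : (5 <= q <= 9)%N -> (1 < n <= 5)%N ->
  1 - y ^+ n <= (G - tau n 6) * n.+1%:R * M n.
Proof.
move=> /andP[q5 q9] /andP[n1 n5]; have yY : y <= 5%:R^-1 by exact: invq_le.
have y9 : 9%:R^-1 <= y by rewrite lef_pV2 ?posrE ?ltr0n ?(leq_trans _ q5)// ler_nat.
have [[_ t2 t3] [t4 t5]] := inv_sqr_sum_6.
have t0 k := inv_sqr_sum_ge0 k 6.
have err k := @mertens_err_le R F k 5^-1 (25 / 16) yY ltac:(lra) ltac:(lra).
have y2 : 81^-1 <= y ^+ 2 by nra.
have yn k : 1 - y ^+ k <= 1 by rewrite lerBlDr lerDl exprn_ge0// ltW// (lt_le_trans _ y9)// invr_gt0.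
have [->|[->|[->|->]]] : (n = 2 \/ n = 3 \/ n = 4 \/ n = 5)%N by lia.
- have e : eps 2 <= 25 / 16 * (5^-1 ^+ 2 + 5^-1 ^+ 2) / 3 := err 2%N.
  apply: (@le_trans _ _ (1 - 81^-1)); first lra.
  have h := t0 2%N; clear - e h t2.
  by apply: (@table_step _ (271 / 10 ^+ 3 + 4 / 10 ^+ 4)) => //; try (apply/andP; split); lra.
- have e : eps 3 <= 25 / 16 * (5^-1 ^+ 2 + 5^-1 ^+ 3) / 4 := err 3%N.
  apply: le_trans (yn 3%N) _; have h := t0 3%N; clear - e h t3.
  by apply: (@table_step _ (177 / 10 ^+ 3)) => //; try (apply/andP; split); lra.
- have e : eps 4 <= 25 / 16 * (5^-1 ^+ 3 + 5^-1 ^+ 3) / 5 := err 4%N.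
  apply: le_trans (yn 4%N) _; have h := t0 4%N; clear - e h t4.
  by apply: (@table_step _ (125 / 10 ^+ 3)) => //; try (apply/andP; split); lra.
- have e : eps 5 <= 25 / 16 * (5^-1 ^+ 3 + 5^-1 ^+ 4) / 6 := err 5%N.
  apply: le_trans (yn 5%N) _; have h := t0 5%N; clear - e h t5.
  by apply: (@table_step _ (100 / 10 ^+ 3)) => //; try (apply/andP; split); lra.
Qed.

(** 1/(1 - 1/q) = 1 + 1/(q - 1) is at most exp(1/(q - 1)). *)
Lemma onem_invq_expn_ge : expR (-1) <= (1 - y) ^+ q.-1.
Proof.
have q1 := card_gt1 F; have Q1 := @q_gt1 R F.
have qE : q.-1%:R = q%:R - 1 :> R by rewrite -subn1 natrB// ltnW.
have q0 : 0 < q.-1%:R :> R by rewrite qE subr_gt0.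
have -> : -1 = - q.-1%:R^-1 * q.-1%:R :> R by rewrite mulNr mulVf// gt_eqF.
rewrite expRM_natr; apply: ler_exp_nneg; first exact: expR_ge0.
rewrite expRN -[leLHS]mul1r ler_pdivrMr ?expR_gt0//.
have y1 : 0 < 1 - y by have /andP[_] := invq_itv R F; rewrite subr_gt0.
rewrite mulrC -ler_pdivrMr//.
apply: le_trans (expR_ge1Dx _); rewrite le_eqVlt; apply/orP; left; apply/eqP.
rewrite qE; field; rewrite !gt_eqF ?subr_gt0//; exact: lt_trans Q1.
Qed.

(** One factor [1 - y] of [M 1] cancels against the left-hand side. The remaining power is at least
    1/e, which settles all [q] at once. *)
Lemma table_q10_1 : (10 <= q)%N -> 1 - y ^+ 1 <= (G - tau 1 3) * 2%:R * M 1.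
Proof.
move=> q10; have [t1 _] := inv_sqr_sum_3; have h := onem_invq_expn_ge.
have E : (1 - y) ^+ q = (1 - y) * (1 - y) ^+ q.-1 by rewrite -exprS prednK// ltnW// card_gt1.
rewrite mertens_prod1 expr1 E mulrCA.
have /andP[_ y1] := invq_itv R F.
rewrite ler_peMr ?subr_ge0 ?(ltW y1)//.
have e : 367 / 10 ^+ 3 <= expR (-1) :> R.
  have /andP[_ e1] := expR1_bounds R; rewrite expRN -[leRHS]mul1r ler_pdivlMr; last exact: expR_gt0.
  by move: (expR 1) e1 => e e1; lra.
have {}h := le_trans e h; have /andP[g _] := expR_gamma_bounds R.
move: ((1 - y) ^+ _) (G) (tau _ _) h g t1 => a g t ha hg ht.
nra.
Qed.

Lemma table_q10 n : (10 <= q)%N -> (1 < n <= 3)%N ->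
  1 - y ^+ n <= (G - tau n 3) * n.+1%:R * M n.
Proof.
move=> q10 /andP[n1 n3]; have yY : y <= 10%:R^-1 by exact: invq_le.
have [_ t2] := inv_sqr_sum_3.
have t0 k := inv_sqr_sum_ge0 k 3.
have err k := @mertens_err_le R F k 10^-1 (100 / 81) yY ltac:(lra) ltac:(lra).
have yn k : 1 - y ^+ k <= 1.
  by have /andP[y0 _] := invq_itv R F; rewrite lerBlDr lerDl exprn_ge0// ltW.
apply: le_trans (yn n) _.
have [->|->] : (n = 2 \/ n = 3)%N by lia.
- have e : eps 2 <= 100 / 81 * (10^-1 ^+ 2 + 10^-1 ^+ 2) / 3 := err 2%N.
  have h := t0 2%N; clear - e h t2.
  by apply: (@table_step _ (239 / 10 ^+ 3)) => //; try (apply/andP; split); lra.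
- have e : eps 3 <= 100 / 81 * (10^-1 ^+ 2 + 10^-1 ^+ 3) / 4 := err 3%N.
  have h : tau 3 3 = 0 by rewrite inv_sqr_sum_geq.
  rewrite h; clear - e.
  by apply: (@table_step _ (170 / 10 ^+ 3)) => //; try (apply/andP; split); lra.
Qed.

(* The irreducible members of A of degree 2, ..., cutoff are moved to the front of
   the ordering; tau n cutoff bounds the part of the Erdos sum carried by those of
   degree more than n. *)
Definition cutoff : nat := if (q < 5)%N then 10 else if (q < 10)%N then 6 else 3.

(** [1 - y ^+ n] takes the irreducible under consideration out of the full product [M n], and
    [tau n cutoff] reserves room for the front members of degree above [n]. Dropping the latter
    gives the condition for the plain ordering. *)
Lemma mertens_table n : (3 <= q)%N -> (0 < n)%N ->
  1 - y ^+ n <= (G - tau n cutoff) * n.+1%:R * M n.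
Proof.
move=> q3 n0.
have large : (4 <= n)%N -> tau n cutoff = 0 -> 1 - y ^+ n <= (G - tau n cutoff) * n.+1%:R * M n.
  move=> n4 ->; rewrite subr0; apply: le_trans (mertens_large q3 n4).
  by have /andP[y0 _] := invq_itv R F; rewrite lerBlDr lerDl exprn_ge0// ltW.
have yn : 1 - y ^+ n <= 1.
  by have /andP[y0 _] := invq_itv R F; rewrite lerBlDr lerDl exprn_ge0// ltW.
have [cn|nc] := leqP cutoff n.
  have [n4|n4] := leqP 4 n; first by apply: large => //; exact: inv_sqr_sum_geq.
  have q10 : (10 <= q)%N.
    rewrite leqNgt; apply/negP => q10; move: cn; rewrite /cutoff q10.
    by clear - n4; case: ifP => _; lia.
  have cut : cutoff = 3 by rewrite /cutoff ifN ?ifN -?leqNgt// (leq_trans _ q10).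
  rewrite cut in cn *; have -> : n = 3 by clear - cn n4; lia.
  exact: table_q10.
move: nc; rewrite /cutoff; case: (ltnP q 5) => q5 /= nc.
  have [n5|n5] := leqP 5 n.
    by apply: (le_trans yn); apply: table_q3; rewrite ?q3 ?n5.
  have [qE|qE] : (q = 3 \/ q = 4)%N by lia.
    have [n4|n4] := leqP 4 n; last by apply: table_q3_123 => //; rewrite n0.
    by have -> : n = 4; [lia|exact: table_q3_4].
  have [n4|n4] := leqP 4 n; last by apply: table_q4_123 => //; rewrite n0.
  by have -> : n = 4; [lia|exact: table_q4_4].
move: nc; case: (ltnP q 10) => q10 /= nc.
  have [n1|n1] := leqP n 1.
    by have -> : n = 1; [lia|apply: table_q5_1; rewrite q5].
  by apply: table_q5; [rewrite q5|rewrite n1].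
have [n1|n1] := leqP n 1; first by have -> : n = 1; [lia|exact: table_q10_1].
by apply: table_q10 => //; rewrite n1 ltnW.
Qed.

(** With k = [uphalf d], both exponents in [eps d.-1] are at least k and d <= 2 k, so the left-hand
    side is at most 40 c k Y^k. This is nonincreasing in k, hence tested at [j0] only. *)
Lemma mertens_err_pred d j0 (Y c : R) : (4 <= d)%N -> (j0.*2 <= d.+1)%N -> (0 < j0)%N ->
  y <= Y -> Y <= 2^-1 -> 1 <= c * (1 - Y) ^+ 2 -> 0 <= c -> 40 * c * (j0%:R * Y ^+ j0) <= 1 ->
  10 * d%:R ^+ 2 * eps d.-1 <= 1.
Proof.
move=> d4 dj j00 yY Y2 cY c0 hj.
have /andP[y0 _] := invq_itv R F; have Y0 : 0 < Y by exact: lt_le_trans yY.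
have d0 : 0 < d%:R :> R by rewrite ltr0n (leq_trans _ d4).
have := @mertens_err_le R F d.-1 Y c yY ltac:(lra) cY.
rewrite prednK ?(leq_trans _ d4)// => he.
pose j := uphalf d.
have jj : (j0 <= j)%N.
  by have := half_leq dj; rewrite doubleK.
have hY k : (j <= k)%N -> Y ^+ k <= Y ^+ j by move=> jk; rewrite ler_wiXn2l ?(ltW Y0)//; lra.
have dE : (d = d.-1.+1)%N by rewrite prednK// (leq_trans _ d4).
have j1 : (j <= (d.-1./2).+1)%N by rewrite /j {1}dE.
have j2 : (j <= (d.-1 - d.-1./2).+1)%N.
  by apply: (leq_trans j1); rewrite ltnS half_le_sub.
have h1 := hY _ j1; have h2 := hY _ j2.
have dj2 : d%:R <= 2 * j%:R :> R.
  by rewrite -natrM ler_nat leq_double_uphalf.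
apply: (@le_trans _ _ (10 * d%:R ^+ 2 * (c * (2 * Y ^+ j) / d%:R))).
  apply: ler_wpM2l; first by rewrite mulr_ge0// exprn_ge0// ltW.
  apply: le_trans he _; rewrite ler_wpM2r ?invr_ge0 ?(ltW d0)// ler_wpM2l//; lra.
have -> : 10 * d%:R ^+ 2 * (c * (2 * Y ^+ j) / d%:R) = 20 * c * (d%:R * Y ^+ j).
  by field; rewrite gt_eqF.
apply: le_trans hj; apply: (@le_trans _ _ (40 * c * (j%:R * Y ^+ j))).
  have -> : 40 * c * (j%:R * Y ^+ j) = 20 * c * (2 * j%:R * Y ^+ j) by ring.
  by rewrite ler_wpM2l ?mulr_ge0// ler_wpM2r// exprn_ge0// ltW.
rewrite ler_wpM2l ?mulr_ge0//; apply: mul_expn_noninc; first by rewrite (ltW Y0).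
by rewrite j00.
Qed.

Lemma mertens_irr_gain d : (3 <= q)%N -> (cutoff < d)%N ->
  1 / d%:R ^+ 2 <= G * M d.-1 * (1 - expR (- d%:R^-1)).
Proof.
move=> q3 cd.
have d4 : (4 <= d)%N by move: cd; rewrite /cutoff; case: (ltnP q 5) => _; [|case: (ltnP q 10) => _]; clear; lia.
apply: mertens_prev => //; first by exact: leq_trans d4.
(* The origin of the cutoffs: for Y = 1/3, 1/5, 1/10 the test first succeeds at [j0] = 6, 4, 2, that
   is for d >= 11, 7, 3; the last is raised to 4 because [mertens_prev] assumes [4 <= d]. *)
move: cd; rewrite /cutoff; case: (ltnP q 5) => q5 /= cd; last (move: cd; case: (ltnP q 10) => q10 /= cd).
- have yY : y <= 3^-1 := @invq_le R F 3 isT q3.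
  by apply: (@mertens_err_pred d 6 _ (9 / 4) d4 cd isT yY); clear; lra.
- have yY : y <= 5^-1 := @invq_le R F 5 isT q5.
  by apply: (@mertens_err_pred d 4 _ (25 / 16) d4 cd isT yY); clear; lra.
- have yY : y <= 10^-1 := @invq_le R F 10 isT q10.
  by apply: (@mertens_err_pred d 2 _ (100 / 81) d4 (leqW d4) isT yY); clear; lra.
Qed.

Lemma inv_sqr_sum_cutoff : tau 1 cutoff <= 55 / 100.
Proof.
have [[h10 _ _] _] := inv_sqr_sum_10; have [[h6 _ _] _] := inv_sqr_sum_6.
have [h3 _] := inv_sqr_sum_3.
by rewrite /cutoff; case: (ltnP q 5) => _; [lra|case: (ltnP q 10) => _; lra].
Qed.
End Table.

(** * The ordering of the irreducibles *)

Section Ordering.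
Variables (R : realType) (F : finFieldType).
Variable A : seq {poly F}.
Implicit Types (p r : {poly F}) (s t : seq {poly F}).
Local Notation q := #|F|.
Local Notation y := (q%:R^-1 : R).
Local Notation x := (@inv_norm R F).
Local Notation M := (mertens_prod R F).
Local Notation npi := (npi F).

Definition irr_in d := [seq p <- irr F d | p \in A].
Definition irr_out d := [seq p <- irr F d | p \notin A].
Definition front D := flatten [seq irr_in d | d <- index_iota 2 D.+1].
Definition block D d := (if (1 < d <= D)%N then [::] else irr_in d) ++ irr_out d.
Definition blocks D N := flatten [seq block D d | d <- index_iota 1 N.+1].
(** For [D = 1] the front is empty and the order is by degree, as in [regime_linear];
    [regime_few_linear] takes [D = cutoff F]. *)
Definition ordering D N := front D ++ blocks D N.

Lemma mem_irr_in d p : p \in irr_in d -> [/\ p \in A, monic_irreducibles p & pdeg p = d].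
Proof. by rewrite mem_filter => /andP[pA /mem_irr[]]. Qed.

Lemma mem_irr_out d p : p \in irr_out d -> [/\ p \notin A, monic_irreducibles p & pdeg p = d].
Proof. by rewrite mem_filter => /andP[pA /mem_irr[]]. Qed.

Lemma mem_block D d p : p \in block D d ->
  [/\ monic_irreducibles p, pdeg p = d & (p \in A) ==> ~~ (1 < d <= D)%N].
Proof.
rewrite mem_cat => /orP[|/mem_irr_out[pA ? ?]]; last by rewrite (negbTE pA).
by case: ifP => // _ /mem_irr_in[? ? ?]; split=> //; rewrite implybT.
Qed.

Lemma mem_front D p : p \in front D ->
  [/\ p \in A, monic_irreducibles p & (1 < pdeg p <= D)%N].
Proof.
move=> /flattenP[_ /mapP[d + ->]] /mem_irr_in[pA pI pd].
by rewrite mem_index_iota ltnS => dD; rewrite pd.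
Qed.

Lemma mem_blocks D N p : p \in blocks D N ->
  [/\ monic_irreducibles p, (0 < pdeg p <= N)%N & (p \in A) ==> ~~ (1 < pdeg p <= D)%N].
Proof.
move=> /flattenP[_ /mapP[d + ->]] /mem_block[pI pd h].
by rewrite mem_index_iota ltnS => dN; rewrite pd.
Qed.

Lemma uniq_flatten_deg (f : nat -> seq {poly F}) (s : seq nat) : uniq s ->
  (forall d, uniq (f d)) -> (forall d p, p \in f d -> pdeg p = d) ->
  uniq (flatten [seq f d | d <- s]).
Proof.
move=> + uf fd; elim: s => //= d s IH /andP[ds us]; rewrite cat_uniq uf IH// andbT /=.
apply/hasPn => p /flattenP[_ /mapP[e es ->] /fd pe].
by apply: contra ds => /fd <-; rewrite pe.
Qed.

Lemma irr_in_uniq d : uniq (irr_in d). Proof. by rewrite filter_uniq// irr_uniq. Qed.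
Lemma irr_out_uniq d : uniq (irr_out d). Proof. by rewrite filter_uniq// irr_uniq. Qed.

Lemma block_uniq D d : uniq (block D d).
Proof.
rewrite /block cat_uniq irr_out_uniq andbT; apply/andP; split.
  by case: ifP => // _; exact: irr_in_uniq.
apply/hasPn => p /mem_irr_out[pA _ _]; case: ifP => // _.
by apply: contra pA => /mem_irr_in[].
Qed.

Lemma ordering_uniq D N : uniq (ordering D N).
Proof.
rewrite cat_uniq; apply/and3P; split.
- by apply: uniq_flatten_deg; [exact: iota_uniq|exact: irr_in_uniq|move=> d p /mem_irr_in[]].
- apply/hasPn => p /mem_blocks[_ _ pA]; apply/negP => /mem_front[pA' _ pD].
  by rewrite pA' pD in pA.
- by apply: uniq_flatten_deg; [exact: iota_uniq|exact: block_uniq|move=> d p /mem_block[]].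
Qed.

Lemma ordering_irr D N : {in ordering D N, forall p, monic_irreducibles p}.
Proof. by move=> p; rewrite mem_cat => /orP[/mem_front[]|/mem_blocks[]]. Qed.

Lemma pdeg_irr_gt0 p : monic_irreducibles p -> (0 < pdeg p)%N.
Proof. by move=> [_ [p1 _]]; rewrite /pdeg -subn1 subn_gt0. Qed.

Lemma mem_ordering D N p : monic_irreducibles p -> (pdeg p <= N)%N -> p \in ordering D N.
Proof.
move=> pI pN; have p0 := pdeg_irr_gt0 pI; have pirr : p \in irr F (pdeg p) by apply/mem_irr.
rewrite mem_cat; have [pA|pA] := boolP (p \in A); last first.
  apply/orP; right; apply/flattenP; exists (block D (pdeg p)).
    by apply: map_f; rewrite mem_index_iota p0 ltnS.
  by rewrite mem_cat mem_filter pA pirr orbT.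
have [pD|pD] := boolP (1 < pdeg p <= D)%N; apply/orP; [left|right].
  apply/flattenP; exists (irr_in (pdeg p)); last by rewrite mem_filter pA.
  by apply: map_f; rewrite mem_index_iota ltnS.
apply/flattenP; exists (block D (pdeg p)).
  by apply: map_f; rewrite mem_index_iota p0 ltnS.
by rewrite mem_cat (negbTE pD) mem_filter pA pirr.
Qed.

Lemma blocksS D N : blocks D N.+1 = blocks D N ++ block D N.+1.
Proof.
rewrite /blocks; have -> : index_iota 1 N.+2 = index_iota 1 N.+1 ++ [:: N.+1].
  by rewrite /index_iota !subSS !subn0 -[N.+1 in LHS]addn1 iotaD add1n.
by rewrite map_cat flatten_cat /= cats0.
Qed.

Lemma blocks_sorted D N : pairwise (fun r p => pdeg r <= pdeg p)%N (blocks D N).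
Proof.
elim: N => [|N IH]; first by rewrite /blocks /index_iota.
rewrite blocksS pairwise_cat IH /=; apply/andP; split.
  apply/allrelP => r p /mem_blocks[_ /andP[_ rN] _] /mem_block[_ -> _].
  exact: leqW.
have : {in block D N.+1, forall p, pdeg p = N.+1} by move=> p /mem_block[].
elim: (block D N.+1) => //= p s IHs sN; rewrite IHs ?andbT; last first.
  by move=> r rs; apply: sN; rewrite inE rs orbT.
by apply/allP => r rs; rewrite !sN ?inE ?eqxx ?rs ?orbT.
Qed.

Lemma ordering_before D N p r : p \in ordering D N ->
  r \in take (index p (ordering D N)) (ordering D N) ->
  r != p /\ (r \in front D \/ (pdeg r <= pdeg p)%N).
Proof.
set s := ordering D N; set i := index p s => ps rs.
have pd : p \in drop i s by rewrite (drop_nth p) ?index_mem// inE nth_index// eqxx.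
have us : uniq s by exact: ordering_uniq.
have pw : pairwise (fun r p => (r != p) && ((r \in front D) || (pdeg r <= pdeg p)%N)) s.
  rewrite pairwise_relI -uniq_pairwise us /= pairwise_cat; apply/and3P; split.
  - by apply/allrelP => u v ->.
  - apply/(pairwiseP 0) => a b; rewrite !inE => aF bF _.
    by rewrite mem_nth.
  - by apply: sub_pairwise (blocks_sorted D N) => u v ->; rewrite orbT.
move: pw; rewrite -[X in pairwise _ X](cat_take_drop i s) pairwise_cat => /andP[/allrelP h _].
by have /andP[? /orP] := h _ _ rs pd.
Qed.

Lemma inv_normE p : x p = y ^+ pdeg p.
Proof. by rewrite /inv_norm /pnorm natrX exprVn. Qed.

Lemma coprod_deg s d : {in s, forall p, pdeg p = d} -> coprod R s = (1 - y ^+ d) ^+ size s.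
Proof.
move=> sd; rewrite /coprod big_seq (eq_bigr (fun=> 1 - y ^+ d)).
  by rewrite -big_seq big_const_seq count_predT iter_mulr_1.
by move=> p ps; rewrite inv_normE sd.
Qed.

Lemma erdos_sum_deg s d : {in s, forall p, pdeg p = d} ->
  \sum_(p <- s) erdos_term R p = (size s)%:R * y ^+ d / d%:R.
Proof.
move=> sd; rewrite big_seq (eq_bigr (fun=> y ^+ d / d%:R)).
  by rewrite -big_seq big_const_seq count_predT iter_addr_0 -[LHS]mulr_natl mulrA.
by move=> p ps; rewrite erdos_termE inv_normE sd.
Qed.

Definition irr_upto n := flatten [seq irr F d | d <- index_iota 1 n.+1].

Lemma mem_irr_upto n p : p \in irr_upto n <-> monic_irreducibles p /\ (pdeg p <= n)%N.
Proof.
split.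
  move=> /flattenP[_ /mapP[d + ->]] /mem_irr[pI pd].
  by rewrite mem_index_iota ltnS pd => /andP[].
move=> [pI pn]; apply/flattenP; exists (irr F (pdeg p)); last by apply/mem_irr.
by apply: map_f; rewrite mem_index_iota ltnS pn pdeg_irr_gt0.
Qed.

Lemma coprod_flatten (f : nat -> seq {poly F}) (ds : seq nat) :
  coprod R (flatten [seq f d | d <- ds]) = \prod_(d <- ds) coprod R (f d).
Proof. by elim: ds => [|d ds IH]; rewrite /= ?coprod_cat ?IH ?big_cons// /coprod !big_nil. Qed.

Lemma coprod_irr_upto n : coprod R (irr_upto n) = M n.
Proof.
rewrite coprod_flatten; apply: eq_bigr => d _.
by rewrite (@coprod_deg _ d)// => p /mem_irr[].
Qed.

Definition front_le D n := flatten [seq irr_in d | d <- index_iota 2 D.+1 & (d <= n)%N].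
Definition front_gt D n := flatten [seq irr_in d | d <- index_iota 2 D.+1 & ~~ (d <= n)%N].

Lemma coprod_front D n : coprod R (front D) = coprod R (front_le D n) * coprod R (front_gt D n).
Proof. by rewrite !coprod_flatten !big_filter (bigID (fun d => d <= n)%N). Qed.

Lemma onem_inv_norm_gt0 p : monic_irreducibles p -> 0 < 1 - x p.
Proof.
move=> pI; rewrite inv_normE subr_gt0.
have /andP[_ y1] := invq_itv R F; have /andP[_ h] := expy_itv R F (pdeg_irr_gt0 pI).
exact: le_lt_trans h y1.
Qed.

(** What precedes [p] is either another irreducible of degree at most [pdeg p] or a front member of
    larger degree. Replacing it by all of these only lowers the product. *)
Lemma coprod_before_out D N p : p \in ordering D N -> p \notin A ->
  M (pdeg p) * coprod R (front_gt D (pdeg p)) <=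
  (1 - y ^+ pdeg p) * coprod R (take (index p (ordering D N)) (ordering D N)).
Proof.
move=> ps pA; have pI := ordering_irr ps.
have pu : p \in irr_upto (pdeg p) by apply/mem_irr_upto.
have -> : M (pdeg p) * coprod R (front_gt D (pdeg p)) =
    (1 - y ^+ pdeg p) * coprod R (rem p (irr_upto (pdeg p)) ++ front_gt D (pdeg p)).
  rewrite coprod_cat mulrA -coprod_irr_upto; congr (_ * _).
  by rewrite /coprod (perm_big _ (perm_to_rem pu)) /= big_cons inv_normE.
apply: ler_wpM2l; first by rewrite -inv_normE ltW// onem_inv_norm_gt0.
apply: coprod_sub; first by rewrite take_uniq// ordering_uniq.
move=> r rs; have [rp h] := ordering_before ps rs.
have rI : monic_irreducibles r by apply: ordering_irr; exact: mem_take rs.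
rewrite mem_cat; have [rn|nr] := leqP (pdeg r) (pdeg p).
  by rewrite rem_mem//; apply/mem_irr_upto.
case: h => [/mem_front[rA _ rD]|]; last by rewrite leqNgt nr.
apply/orP; right; apply/flattenP; exists (irr_in (pdeg r)).
  by apply: map_f; rewrite mem_filter -ltnNge nr mem_index_iota ltnS.
by rewrite mem_filter rA; apply/mem_irr.
Qed.

(** When every entry is in [A], the subtracted terms telescope. *)
Lemma excess_all (P : R) s : {subset s <= A} ->
  excess A P s = \sum_(p <- s) erdos_term R p - P * (1 - coprod R s).
Proof.
elim: s P => [|p s IH] P sA.
  by rewrite /= /coprod !big_nil subrr mulr0 subr0.
rewrite /= sA ?inE ?eqxx// IH; last by move=> r rs; apply: sA; rewrite inE rs orbT.
by rewrite /coprod !big_cons; ring.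
Qed.

Lemma excess_none (P : R) s : {in s, forall p, p \notin A} -> excess A P s = 0.
Proof.
elim: s P => [|p s IH] P sA //=.
rewrite (negbTE (sA p _)) ?inE ?eqxx// add0r IH// => r rs.
by apply: sA; rewrite inE rs orbT.
Qed.

Lemma excess_blocks (P : R) D N : excess A P (blocks D N) =
  \sum_(1 <= d < N.+1) excess A (P * coprod R (blocks D d.-1)) (block D d).
Proof.
elim: N => [|N IH]; first by rewrite big_geq.
rewrite big_nat_recr//= -IH.
by rewrite blocksS excess_cat.
Qed.

Lemma excess_block (P : R) D d :
  excess A P (block D d) = if (1 < d <= D)%N then 0 else
    (size (irr_in d))%:R * y ^+ d / d%:R - P * (1 - (1 - y ^+ d) ^+ size (irr_in d)).
Proof.
rewrite /block; case: ifP => _; last first.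
  rewrite excess_cat [X in _ + X]excess_none ?addr0; last by move=> p /mem_irr_out[].
  rewrite excess_all; last by move=> p /mem_irr_in[].
  by rewrite (@erdos_sum_deg _ d) ?(@coprod_deg _ d)// => p /mem_irr_in[].
by rewrite excess_none// => p /mem_irr_out[].
Qed.

Lemma coprod_front_blocks D d : (D < d)%N ->
  M d.-1 <= coprod R (front D) * coprod R (blocks D d.-1).
Proof.
move=> Dd; rewrite -coprod_cat -coprod_irr_upto.
apply: coprod_sub; first exact: ordering_uniq.
move=> p; rewrite mem_cat => /orP[/mem_front[_ pI /andP[_ pD]]|/mem_blocks[pI /andP[_ pd] _]];
  apply/mem_irr_upto; split=> //.
by rewrite -ltnS prednK ?(leq_ltn_trans _ Dd)// (leq_ltn_trans pD).
Qed.
End Ordering.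

(** * Bounds for finite primitive sets *)

Lemma tail_sum_le_decimal (R : realType) N : tail_sum R N <= 145 / 10 ^+ 3.
Proof.
apply: le_trans (tail_sum_le R N) _.
have /andP[p0 p1] := pi_bounds R; move: (pi : R) p0 p1 => p p0 p1.
have d0 : 0 <= p - 3 by lra.
have d1 : p - 3 <= 1416 / 10 ^+ 4 by lra.
have := ler_wpM2r d0 d1; lra.
Qed.

Lemma euler_gamma_le_decimal (R : realType) : euler_gamma <= 58 / 100 :> R.
Proof.
have /andP[_ G1] := expR_gamma_bounds R; rewrite -ler_expR; apply: (le_trans G1).
have h58 : 0 <= 58 / 100 :> R /\ 58 / 100 <= 3 / 4 :> R by split; lra.
move/andP in h58.
have /andP[lo _] := expR_taylor10 h58.
by apply: le_trans lo; rewrite /exp_taylor10; lra.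
Qed.

(** The margin g (t - t^2/2) - t is concave in t, so the ends 1/3 and 58/100 decide; at both it
    exceeds 145/1000 by less than 2/100. *)
Lemma few_linear_margin (R : realType) (t a e : R) :
  1 / 3 <= t -> t <= 58 / 100 -> e <= 145 / 10 ^+ 3 -> a <= 1 - t + t ^+ 2 / 2 ->
  t + expR euler_gamma * a + e <= expR euler_gamma.
Proof.
have /andP[g0 _] := expR_gamma_bounds R; move: (expR _) g0 => g g0 t3 t58 e1 a1.
have g0' : 0 <= g by lra.
have {}g0 : 1 + 781 / 10 ^+ 3 <= g by lra.
have := ler_wpM2l g0' a1.
have b0 : 0 <= t - t ^+ 2 / 2 by nra.
have := ler_wpM2r b0 g0.
have : 145 / 10 ^+ 3 + t <= (1 + 781 / 10 ^+ 3) * (t - t ^+ 2 / 2) by nra.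
lra.
Qed.

Section Regimes.
Variables (R : realType) (F : finFieldType).
Variable A : seq {poly F}.
Hypotheses (uA : uniq A) (primA : {in A &, forall a b, a %| b -> a = b}).
Hypothesis monA : {in A, forall a, a \is monic /\ (1 < size a)%N}.
Local Notation q := #|F|.
Local Notation y := (q%:R^-1 : R).
Local Notation M := (mertens_prod R F).
Local Notation G := (expR (euler_gamma : R)).
Local Notation npi := (npi F).
Local Notation j d := (size (irr_in A d)).
Local Notation tau := (@inv_sqr_sum R).
Local Notation N := (\max_(a <- A) pdeg a)%N.

Lemma size_irr_in_le d : (j d <= npi d)%N.
Proof. by rewrite /irr_in size_filter count_size. Qed.

Lemma irr_in_mass_le d : (0 < d)%N -> (j d)%:R * y ^+ d <= d%:R^-1.
Proof.
move=> d0; rewrite -[leRHS]mul1r ler_pdivlMr ?ltr0n// mulrAC -natrM exprVn.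
rewrite ler_pdivrMr ?exprn_gt0 ?ltr0n ?(ltnW (card_gt1 F))// mul1r -natrX ler_nat mulnC.
by apply: leq_trans (npi_le F d0); rewrite leq_mul2l size_irr_in_le orbT.
Qed.

Lemma invq_expn_ge0 d : 0 <= y ^+ d. Proof. by rewrite exprn_ge0// invr_ge0. Qed.

Lemma onem_invq_expn_gt0 d : (0 < d)%N -> 0 < 1 - y ^+ d.
Proof.
move=> d0; have /andP[_ y1] := invq_itv R F; have /andP[_ h] := expy_itv R F d0.
by rewrite subr_gt0 (le_lt_trans h).
Qed.

Lemma erdos_ordering D (C : R) : 0 <= C ->
  (forall n, (0 < n)%N -> 1 - y ^+ n <= C * n.+1%:R * (M n * coprod R (front_gt A D n))) ->
  \sum_(a <- A) erdos_term R a <= C + excess A C (ordering A D N).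
Proof.
move=> C0 hC; apply: erdos_sum_le_excess => //.
- exact: ordering_uniq.
- exact: ordering_irr.
- move=> a aA p pI pa; apply: mem_ordering => //.
  have a0 : a != 0 by rewrite monic_neq0// (monA aA).1.
  apply: (@leq_trans (pdeg a)); last exact: (@leq_bigmax_seq _ A xpredT).
  by rewrite /pdeg; have := dvdp_leq a0 pa; case: (size p) (size a) => [|m] [|n].
- move=> p ps pA; have pI := ordering_irr ps; have p0 := pdeg_irr_gt0 pI.
  have yp := onem_invq_expn_gt0 p0.
  rewrite -(ler_pM2l yp) mulr1; apply: le_trans (hC _ p0) _.
  rewrite [leRHS]mulrCA; apply: ler_wpM2l; first by rewrite mulr_ge0.
  exact: coprod_before_out.
Qed.

Lemma onem_expn_le_expR (z : R) k : 0 <= z <= 1 -> (1 - z) ^+ k <= expR (- (k%:R * z)).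
Proof.
move=> /andP[z0 z1]; rewrite mulrC -mulNr expRM_natr.
by apply: ler_exp_nneg; [rewrite subr_ge0|exact: expR_ge1Dx].
Qed.

(** Convexity of exp, from its tangent at [s * v] evaluated at [v] and at 0 with weights [s] and
    [1 - s]. *)
Lemma expR_chord (s v : R) : 0 <= s <= 1 -> expR (s * v) <= 1 + s * (expR v - 1).
Proof.
move=> /andP[s0 s1]; have h1 := expR_ge1Dx ((1 - s) * v); have h2 := expR_ge1Dx (- (s * v)).
have E0 := expR_ge0 (s * v).
have {}h1 : expR (s * v) * (1 + (1 - s) * v) <= expR v.
  have -> : expR v = expR (s * v) * expR ((1 - s) * v) by rewrite -expRD; congr expR; ring.
  exact: ler_wpM2l.
have {}h2 : expR (s * v) * (1 - s * v) <= 1.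
  by apply: le_trans (ler_wpM2l E0 h2) _; rewrite expRxMexpNx_1.
have := ler_wpM2l s0 h1; have s1' : 0 <= 1 - s by rewrite subr_ge0.
have := ler_wpM2l s1' h2; move: (expR (s * v)) (expR v) => a b; lra.
Qed.

(** By convexity the worst case is the full mass t = 1/d, which is [mertens_irr_gain]. Hence beyond
    the cutoff the members of degree [d] have excess at most 0 once the constant reaching them is at
    least [G * M d.-1]. *)
Lemma irr_gain d : (3 <= q)%N -> (cutoff F < d)%N ->
  (j d)%:R * y ^+ d / d%:R <= G * M d.-1 * (1 - (1 - y ^+ d) ^+ j d).
Proof.
move=> q3 cd; have d0 : (0 < d)%N by exact: leq_ltn_trans cd.
have X := mertens_irr_gain R q3 cd.
have dR : 0 < d%:R :> R by rewrite ltr0n.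
set t := (j d)%:R * y ^+ d; have t0 : 0 <= t by rewrite mulr_ge0 ?invq_expn_ge0.
have td : t * d%:R <= 1 by rewrite -ler_pdivlMr// div1r irr_in_mass_le.
have h1 : (1 - y ^+ d) ^+ j d <= expR (- t).
  by apply: onem_expn_le_expR; rewrite invq_expn_ge0 -subr_ge0 ltW// onem_invq_expn_gt0.
have h2 : expR (- t) <= 1 + t * d%:R * (expR (- d%:R^-1) - 1).
  have -> : - t = (t * d%:R) * - d%:R^-1 by rewrite mulrN mulfK// gt_eqF.
  by apply: expR_chord; rewrite td mulr_ge0// ltW.
have h3 : t * d%:R * (1 - expR (- d%:R^-1)) <= 1 - (1 - y ^+ d) ^+ j d.
  move: h1 h2; move: (_ ^+ j d) (expR (- t)) (t * _) (expR _) => a b c e; lra.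
have GM : 0 <= G * M d.-1 by rewrite mulr_ge0 ?expR_ge0 ?mertens_ge0.
apply: le_trans (ler_wpM2l GM h3).
rewrite mulrCA; apply: le_trans (ler_wpM2l _ X); last by rewrite mulr_ge0// ltW.
by rewrite le_eqVlt; apply/orP; left; apply/eqP; field; rewrite gt_eqF.
Qed.

Lemma harmonic_tail_le n : (n <= 10)%N -> \sum_(2 <= d < n.+1) (d%:R^-1 : R) <= 193 / 100.
Proof.
move=> n10; apply: (@le_trans _ _ (\sum_(2 <= d < 11) (d%:R^-1 : R))).
  have [n1|n1] := leqP 2 n.+1; last first.
    by rewrite big_geq ?(ltnW n1)// sumr_ge0// => i _; rewrite invr_ge0.
  by rewrite [leRHS](@big_cat_nat _ _ _ n.+1)//= lerDl sumr_ge0// => i _; rewrite invr_ge0.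
rewrite /index_iota /= !big_cons big_nil; lra.
Qed.

Lemma inv_sqr_sum_cutoff2 n : (2 <= n)%N -> tau n (cutoff F) <= 300 / 10 ^+ 3.
Proof.
move=> n2; apply: (@le_trans _ _ (tau 2 (cutoff F))).
  have [cn|nc] := leqP (cutoff F) n.
    by rewrite inv_sqr_sum_geq// inv_sqr_sum_ge0.
  rewrite /inv_sqr_sum [leRHS](@big_cat_nat _ _ _ n.+1) ?ltnS// 1?ltnW//= lerDr.
  by rewrite sumr_ge0// => d _; rewrite invr_ge0 exprn_ge0.
have [[_ h10 _] _] := inv_sqr_sum_10 R; have [[_ h6 _] _] := inv_sqr_sum_6 R.
have [_ h3] := inv_sqr_sum_3 R.
by rewrite /cutoff; case: (ltnP q 5) => _; [lra|case: (ltnP q 10) => _; lra].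
Qed.

Lemma cutoff_le : (cutoff F <= 10)%N.
Proof. by rewrite /cutoff; case: ifP => // _; case: ifP. Qed.

(** With S the total mass, the left-hand side is at most S/2 because d >= 2, and the product is at
    most exp(-S) <= 1/(1 + S). Then S/2 <= K S/(1 + S) is the hypothesis. *)
Lemma front_mass (P : pred nat) (K : R) D : (D <= 10)%N ->
  1 + \sum_(2 <= d < D.+1 | P d) (j d)%:R * y ^+ d <= 2 * K ->
  \sum_(2 <= d < D.+1 | P d) (j d)%:R * y ^+ d / d%:R <=
  K * (1 - \prod_(2 <= d < D.+1 | P d) (1 - y ^+ d) ^+ j d).
Proof.
move=> D10 hK; set S := \sum_(_ <= d < _ | _) _ in hK.
have S0 : 0 <= S by rewrite sumr_ge0// => d _; rewrite mulr_ge0 ?invq_expn_ge0.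
apply: (@le_trans _ _ (S / 2)).
  rewrite mulr_suml big_nat_cond [leRHS]big_nat_cond; apply: ler_sum => d /andP[/andP[d2 _] _].
  rewrite ler_wpM2l ?mulr_ge0 ?invq_expn_ge0// lef_pV2 ?posrE ?ltr0n ?(leq_trans _ d2)//.
  by rewrite ler_nat.
have T1 : \prod_(2 <= d < D.+1 | P d) (1 - y ^+ d) ^+ j d <= expR (- S).
  rewrite /S -sumrN expR_sum big_nat_cond [leRHS]big_nat_cond.
  apply: ler_prod => d /andP[/andP[d2 _] _]; have yd := onem_invq_expn_gt0 (ltnW d2).
  rewrite exprn_ge0 ?(ltW yd)//=; apply: onem_expn_le_expR.
  by rewrite invq_expn_ge0 -subr_ge0 ltW.
have T2 : expR (- S) <= (1 + S)^-1.
  by rewrite expRN lef_pV2 ?posrE ?expR_gt0 ?expR_ge1Dx//; lra.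
have S1 : 0 < 1 + S by lra.
have K0 : 0 <= K by lra.
apply: (@le_trans _ _ (K * (1 - (1 + S)^-1))); last first.
  by rewrite ler_wpM2l// lerD2l lerN2 (le_trans T1).
rewrite -subr_ge0 (_ : _ - _ = S * (2 * K - (1 + S)) / (2 * (1 + S))); last first.
  by field; rewrite gt_eqF.
by rewrite divr_ge0 ?mulr_ge0 ?subr_ge0// ltW.
Qed.

Lemma sum_front D :
  \sum_(p <- front A D) erdos_term R p = \sum_(2 <= d < D.+1) (j d)%:R * y ^+ d / d%:R.
Proof.
rewrite /front big_flatten big_map; apply: eq_bigr => d _.
by rewrite (@erdos_sum_deg _ _ _ d)// => p /mem_irr_in[].
Qed.

Lemma coprod_front_le D n :
  coprod R (front_le A D n) = \prod_(2 <= d < D.+1 | (d <= n)%N) (1 - y ^+ d) ^+ j d.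
Proof.
rewrite coprod_flatten big_filter; apply: eq_bigr => d _.
by rewrite (@coprod_deg _ _ _ d)// => p /mem_irr_in[].
Qed.

Lemma front_gt_mass D n : (0 < n)%N ->
  \sum_(2 <= d < D.+1 | ~~ (d <= n)%N) (j d)%:R * y ^+ d / d%:R <= tau n D.
Proof.
move=> n0; rewrite /inv_sqr_sum.
have -> : \sum_(n.+1 <= d < D.+1) (d%:R ^+ 2)^-1 = 
    \sum_(2 <= d < D.+1 | ~~ (d <= n)%N) (d%:R ^+ 2)^-1 :> R.
  rewrite [LHS](big_nat_widenl _ 2)//; apply: eq_big => // d; by rewrite /= ltnNge.
rewrite big_nat_cond [leRHS]big_nat_cond; apply: ler_sum => d /andP[/andP[d2 _] _].
rewrite expr2 invfM ler_wpM2r ?invr_ge0//.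
by apply: irr_in_mass_le; exact: ltnW.
Qed.

Lemma regime_few_linear : (3 <= q)%N -> (3 * j 1 <= q)%N ->
  \sum_(a <- A) erdos_term R a <= G.
Proof.
move=> q3 j3; set D := cutoff F; have /andP[G0 G1] := expR_gamma_bounds R.
set sg := \sum_(2 <= d < D.+1) (j d)%:R * y ^+ d / d%:R.
pose V := G - sg; pose T := coprod R (front A D).
have massS (P : pred nat) : \sum_(2 <= d < D.+1 | P d) (j d)%:R * y ^+ d <= 193 / 100 :> R.
  apply: le_trans (harmonic_tail_le cutoff_le).
  rewrite [leRHS](bigID P) /= -[leLHS]addr0; apply: lerD; last first.
    by rewrite sumr_ge0// => d _; rewrite invr_ge0.
  rewrite big_nat_cond [leRHS]big_nat_cond; apply: ler_sum => d /andP[/andP[d2 _] _].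
  by apply: irr_in_mass_le; exact: ltnW.
have t1 := inv_sqr_sum_cutoff R F.
(* In the condition on irreducibles of degree [n] outside [A], the front members of degree above [n]
   cancel against [T]; this inequality then reduces it to [mertens_table]. *)
have Vn n : (0 < n)%N -> (G - tau n D) * coprod R (front_le A D n) <= V.
  move=> n0; rewrite coprod_front_le.
  (* Tight for n >= 2: 1 + 1.93 against 2 (1.781 - 0.3). For [n = 1] the sum is empty. *)
  have K1 : 1 + \sum_(2 <= d < D.+1 | (d <= n)%N) (j d)%:R * y ^+ d <= 2 * (G - tau n D).
    have [n2|n1] := leqP 2 n.
      have := massS (fun d => d <= n)%N; have := inv_sqr_sum_cutoff2 n2; rewrite -/D.
      move: (tau _ _) (\sum_(_ <= _ < _ | _) _) => t S; lra.
    have n1' : n = 1%N by apply/eqP; rewrite eqn_leq -ltnS n1.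
    rewrite big_nat_cond big1 ?n1'; first by move: t1; rewrite -/D; move: (tau _ _) => t; lra.
    by move=> d /andP[/andP[d2 _] dn]; move: dn; rewrite leqNgt d2.
  have h1 := front_mass cutoff_le K1; have h2 := front_gt_mass D n0.
  have -> : V = G - (\sum_(2 <= d < D.+1 | (d <= n)%N) (j d)%:R * y ^+ d / d%:R +
      \sum_(2 <= d < D.+1 | ~~ (d <= n)%N) (j d)%:R * y ^+ d / d%:R).
    by rewrite /V /sg (bigID (fun d => d <= n)%N).
  move: h1 h2; move: (\prod_(_ <= _ < _ | _) _) (\sum_(_ <= _ < _ | _) _) (\sum_(_ <= _ < _ | _) _) (tau _ _) => P S1 S2 t.
  lra.
have T0 : 0 < T.
  by rewrite /T /coprod big_seq prodr_gt0// => p /mem_front[_ pI _]; exact: onem_inv_norm_gt0.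
have VT : G * T <= V.
  have := Vn D.+1 isT; rewrite inv_sqr_sum_geq// subr0 /T (coprod_front R A D D.+1).
  suff -> : front_gt A D D.+1 = [::] by rewrite (_ : @coprod R F [::] = 1) ?mulr1// /coprod big_nil.
  rewrite /front_gt (_ : [seq d <- _ | _] = [::])//; apply/eqP; rewrite -size_eq0 size_filter.
  rewrite -leqn0 leqNgt -has_count; apply/hasPn => d; rewrite mem_index_iota negbK => /andP[_ dD].
  exact: ltnW.
have V12 : 12 / 10 <= V.
  have := Vn 1%N isT; rewrite coprod_front_le big_nat_cond big1 ?mulr1.
    by move: t1; rewrite -/D; move: (tau _ _) => t t1 h; apply: le_trans h; lra.
  by move=> d /andP[/andP[d2 _] dn]; move: dn; rewrite leqNgt d2.
(* With this C, the constant reaching the blocks after the front is V. *)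
pose C := V / T.
have C0 : 0 <= C by rewrite divr_ge0// ?ltW//; lra.
have CT : C * T = V by rewrite /C divfK// gt_eqF.
have CG : G <= C by rewrite ler_pdivlMr.
apply: le_trans (@erdos_ordering D C C0 _) _.
  move=> n n0; have Tle0 : 0 < coprod R (front_le A D n).
    rewrite /coprod big_seq prodr_gt0// => p /flattenP[_ /mapP[d _ ->] /mem_irr_in[_ pI _]].
    exact: onem_inv_norm_gt0.
  rewrite -(ler_pM2l Tle0).
  have -> : coprod R (front_le A D n) * (C * n.+1%:R * (M n * coprod R (front_gt A D n))) =
      V * n.+1%:R * M n by rewrite -CT /T (coprod_front R A D n); ring.
  have h := ler_wpM2l (ltW Tle0) (mertens_table R q3 n0).
  apply: le_trans h _.
  rewrite !mulrA; apply: ler_wpM2r; first exact: mertens_ge0.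
  by apply: ler_wpM2r => //; rewrite mulrC; exact: Vn.
rewrite /ordering excess_cat excess_all; last by move=> p /mem_front[].
rewrite sum_front -/sg -/T CT excess_blocks.
suff ex0 : \sum_(1 <= d < N.+1) excess A (V * coprod R (blocks A D d.-1)) (block A D d) <= 0.
  move: ex0; move: (\sum_(_ <= _ < _) _) => e e0.
  have -> : C + (sg - C * (1 - T) + e) = sg + C * T + e by ring.
  by rewrite CT /V; lra.
rewrite big_nat; apply: sumr_le0 => d /andP[d0 _]; rewrite excess_block.
case: ifPn => // dD; have [Dd|] := ltnP D d.
  have hP : G * M d.-1 <= V * coprod R (blocks A D d.-1).
    have h := coprod_front_blocks R A Dd; rewrite -CT -mulrA.
    by apply: ler_pM; rewrite ?expR_ge0 ?mertens_ge0.
  have := irr_gain q3 Dd.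
  have e0 : 0 <= 1 - (1 - y ^+ d) ^+ j d.
    by rewrite subr_ge0 exprn_ile1 ?(ltW (onem_invq_expn_gt0 d0))// lerBlDr lerDl invq_expn_ge0.
  by move/le_trans/(_ (ler_wpM2r e0 hP)); rewrite subr_le0.
move=> dD'; have -> : d = 1%N by apply/eqP; rewrite eqn_leq d0 andbT leqNgt; move: dD; rewrite dD' andbT.
rewrite /blocks /index_iota /= (_ : @coprod R F [::] = 1); last by rewrite /coprod big_nil.
rewrite mulr1 expr1 divr1 subr_le0.
set t := (j 1)%:R * y.
have q0 : 0 < q%:R :> R by rewrite ltr0n (ltnW (card_gt1 F)).
have t3 : t <= 1 / 3.
  by rewrite /t ler_pdivrMr// mulrAC ler_pdivlMr// mul1r -natrM ler_nat mulnC.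
have t0 : 0 <= t by rewrite mulr_ge0// ?invr_ge0// ltW.
have h1 : (1 - y) ^+ j 1 <= 1 - t + t ^+ 2 / 2.
  apply: le_trans (expRN_le_quadratic t0); apply: onem_expn_le_expR.
  by have /andP[y0 y1] := invq_itv R F; rewrite !ltW.
(* 1 - t/2 >= 5/6 is where t <= 1/3 is used. Since [V] is at least 12/10 and 12/10 times 5/6 is 1,
   the linear block has excess at most 0. *)
have h2 : 5 / 6 * t <= 1 - (1 - y) ^+ j 1.
  clear - h1 t3 t0; clearbody t; move: (_ ^+ j 1) h1 => a h1; nra.
have V0 : 0 <= V by apply: le_trans V12; rewrite divr_ge0.
apply: le_trans (ler_wpM2l V0 h2).
clear - V12 t0; clearbody t; move: (V) V12 => v V12.
have := ler_wpM2r t0 V12; lra.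
Qed.

(** The right-hand side is z times a geometric sum of m terms, each at least (1 - z)^(k-1). *)
Lemma onem_expn_ge (z : R) m k : 0 <= z <= 1 -> (m <= k)%N ->
  m%:R * z * (1 - z) ^+ k.-1 <= 1 - (1 - z) ^+ m.
Proof.
move=> /andP[z0 z1]; have z1' : 0 <= 1 - z by rewrite subr_ge0.
have z1'' : 1 - z <= 1 by rewrite lerBlDr lerDl.
move=> mk; elim: m mk => [|m IH] mk; first by rewrite mulr0n !mul0r expr0 subrr.
have := IH (ltnW mk); rewrite -natr1 !mulrDl mul1r => h.
have : z * (1 - z) ^+ k.-1 <= z * (1 - z) ^+ m.
  by rewrite ler_wpM2l// ler_wiXn2l// -ltnS (leq_trans mk)// leqSpred.
rewrite exprS; move: h; move: (_ ^+ k.-1) (_ ^+ m) => a b; lra.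
Qed.

(** What is left of 1/(|p| d) when a weight of at least 1/(|p| (d + 1)) has been subtracted for each
    member of degree d. *)
Definition irr_excess : R :=
  \sum_(2 <= d < N.+1) (j d)%:R * y ^+ d / (d%:R * (d%:R + 1)).

Lemma regime_linear : (3 <= q)%N ->
  \sum_(a <- A) erdos_term R a <= (j 1)%:R * y + G * (1 - y) ^+ j 1 + irr_excess.
Proof.
move=> q3; have M0 n : (0 < n)%N -> 1 - y ^+ n <= G * n.+1%:R * M n.
  move=> n0; apply: le_trans (mertens_table R q3 n0) _.
  rewrite ler_wpM2r ?mertens_ge0// ler_wpM2r// lerBlDr lerDl.
  exact: inv_sqr_sum_ge0.
have front1 : front A 1 = [::] by rewrite /front /index_iota.
apply: le_trans (@erdos_ordering 1 G (expR_ge0 _) _) _.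
  move=> n n0; have -> : front_gt A 1 n = [::] by rewrite /front_gt /index_iota.
  by rewrite (_ : @coprod R F [::] = 1) ?mulr1; [exact: M0|rewrite /coprod big_nil].
rewrite /ordering front1 /= excess_blocks.
have [N0|N0] := leqP N 0.
  rewrite /irr_excess; have -> : N = 0%N by apply/eqP; rewrite -leqn0.
  have -> : j 1 = 0%N.
    apply/eqP; rewrite -leqn0 leqNgt; apply/negP; case E : (irr_in A 1) => [//|p s] _.
    have /mem_irr_in[pA _ p1] : p \in irr_in A 1 by rewrite E inE eqxx.
    have := @leq_bigmax_seq _ A xpredT (@pdeg F) p pA isT.
    by rewrite p1 leqNgt ltnS N0.
  by rewrite !big_geq// mul0r expr0 add0r mulr1 lexx.
rewrite big_ltn// /irr_excess.
rewrite excess_block /= expr1 divr1.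
have -> : G * coprod R (blocks A 1 0) = G.
  by rewrite (_ : @coprod R F _ = 1) ?mulr1// /coprod /blocks /index_iota /= big_nil.
rewrite addrA lerD//.
  by rewrite mulrBr mulr1; move: (_ ^+ j 1) => a; lra.
rewrite big_nat [leRHS]big_nat; apply: ler_sum => d /andP[d2 _].
have d0 : (0 < d)%N by exact: ltnW.
rewrite excess_block ifN; last by apply/negP => /andP[_]; rewrite leqNgt d2.
have yd := onem_invq_expn_gt0 d0.
have hM : M d.-1 <= coprod R (blocks A 1 d.-1).
  have := @coprod_front_blocks R F A 1 d d2; rewrite front1.
  by rewrite (_ : @coprod R F [::] = 1) ?mul1r// /coprod big_nil.
have MdE : M d = M d.-1 * (1 - y ^+ d) ^+ npi d by rewrite -{1}(prednK d0) mertens_prodS prednK.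
have dR : 0 < d%:R :> R by rewrite ltr0n.
have yd1 : 0 <= y ^+ d <= 1 by rewrite invq_expn_ge0 -subr_ge0 ltW.
have h := onem_expn_ge yd1 (size_irr_in_le d).
have [j0|j0] := posnP (j d).
  by rewrite j0 mulr0n !mul0r expr0 subrr mulr0 subr0.
have n0 : (0 < npi d)%N by exact: leq_trans j0 (size_irr_in_le d).
(* One factor is removed from [M d] for the last irreducible of degree [d], which all the others
   precede; the earlier ones see a larger product. *)
have key : 1 <= G * (d%:R + 1) * (M d.-1 * (1 - y ^+ d) ^+ (npi d).-1).
  have := M0 _ d0; rewrite MdE -{1}(prednK n0) exprSr natr1 mulrA [leRHS]mulrA.
  by rewrite -{1}[1 - y ^+ d]mul1r ler_pM2r// !mulrA.
have GP : 0 <= G * coprod R (blocks A 1 d.-1).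
  by rewrite mulr_ge0 ?expR_ge0//; have /andP[] := coprod_itv R (blocks A 1 d.-1).
have jy : 0 <= (j d)%:R * y ^+ d by rewrite mulr_ge0 ?invq_expn_ge0.
have step : (j d)%:R * y ^+ d / (d%:R + 1) <=
    G * coprod R (blocks A 1 d.-1) * (1 - (1 - y ^+ d) ^+ j d).
  apply: le_trans (ler_wpM2l GP h); rewrite mulrCA; apply: ler_wpM2l => //.
  rewrite -[leLHS]mul1r ler_pdivrMr ?addr_gt0//; apply: le_trans key _.
  rewrite [leRHS](_ : _ = G * (d%:R + 1) *
      (coprod R (blocks A 1 d.-1) * (1 - y ^+ d) ^+ (npi d).-1)); last first.
    move: (coprod _ _) (expR _) ((1 - y ^+ d) ^+ _) (d%:R : R) => a b c e; ring.
  apply: ler_wpM2l; first by rewrite mulr_ge0 ?expR_ge0// addr_ge0// ltW.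
  by apply: ler_wpM2r => //; rewrite exprn_ge0// ltW.
apply: (@le_trans _ _ ((j d)%:R * y ^+ d / d%:R - (j d)%:R * y ^+ d / (d%:R + 1))).
  by rewrite lerD2l lerN2.
rewrite le_eqVlt; apply/orP; left; apply/eqP.
field; rewrite !gt_eqF ?addr_gt0//.
Qed.

Lemma irr_excess_le : irr_excess <= tail_sum R N.
Proof.
rewrite /irr_excess /tail_sum big_nat [leRHS]big_nat; apply: ler_sum => d /andP[d2 _].
rewrite natr1 expr2 -[in leRHS]mulrA [leRHS]invfM ler_wpM2r//.
by apply: irr_in_mass_le; exact: ltnW.
Qed.

(** If G (1 - y)^j >= 1, then t = j/q is at most gamma, while t > 1/3 outside the regime of few
    linear members; in this window [few_linear_margin] gives [G]. Otherwise j can be raised to q. *)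
Lemma erdos_finite : (3 <= q)%N ->
  \sum_(a <- A) erdos_term R a <= G \/
  \sum_(a <- A) erdos_term R a <= 1 + G * (1 - y) ^+ q + irr_excess.
Proof.
move=> q3; have [j3|j3] := leqP (3 * j 1) q; first by left; exact: regime_few_linear.
have := regime_linear q3; set S := \sum_(a <- A) _ => hS.
have E1 := le_trans irr_excess_le (tail_sum_le_decimal R N).
have /andP[y0 y1] := invq_itv R F; have /andP[G0 G1] := expR_gamma_bounds R.
have jq : (j 1 <= q)%N by have := size_irr_in_le 1; rewrite npi1.
have qy : q%:R * y = 1 by rewrite divff// gt_eqF// ltr0n (ltnW (card_gt1 F)).
have yy : 0 <= y <= 1 by rewrite !ltW.
have [g1|g1] := leP 1 (G * (1 - y) ^+ j 1).
  left; apply: le_trans hS _.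
  set t := (j 1)%:R * y.
  have t3 : 1 / 3 <= t.
    rewrite ler_pdivrMr// /t mulrAC -[leLHS]qy ler_wpM2r ?(ltW y0)//.
    by rewrite -natrM ler_nat mulnC ltnW.
  have h1 := onem_expn_le_expR (j 1) yy; rewrite -/t in h1.
  have tg : t <= euler_gamma.
    rewrite -subr_ge0 -ler_expR expR0 expRD; apply: le_trans g1 _.
    by rewrite ler_wpM2l// expR_ge0.
  have g58 := euler_gamma_le_decimal R.
  have t0 : 0 <= t by apply: le_trans t3; rewrite divr_ge0.
  have h2 := expRN_le_quadratic t0.
  by apply: few_linear_margin E1 (le_trans h1 h2) => //; exact: le_trans g58.
right; apply: le_trans hS _; rewrite lerD2r.
have mono k : (j 1 <= k)%N -> (j 1)%:R * y + G * (1 - y) ^+ j 1 <= k%:R * y + G * (1 - y) ^+ k.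
  elim: k => [|k IH]; first by rewrite leqn0 => /eqP->.
  rewrite leq_eqVlt => /predU1P[->//|]; rewrite ltnS => jk; apply: le_trans (IH jk) _.
  have gk : G * (1 - y) ^+ k <= 1.
    apply: le_trans (ltW g1); rewrite ler_wpM2l ?expR_ge0//.
    by rewrite ler_wiXn2l// ?subr_ge0 ?(ltW y1)// lerBlDr lerDl ltW.
  rewrite -natr1 exprS; move: gk; move: (expR _) (_ ^+ k) => g a gk.
  have := ler_wpM2l (ltW y0) gk; clear; move: y => z; lra.
by have := mono _ jq; rewrite qy.
Qed.
End Regimes.

(** * Comparison of the two bounds *)

Lemma esum_le_seq (R : realType) (T : choiceType) (S : set T) (f : T -> R) (c : R) :
  (forall s : seq T, uniq s -> {in s, forall x, S x} -> \sum_(x <- s) f x <= c) ->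
  (\esum_(x in S) (f x)%:E <= c%:E)%E.
Proof.
move=> fc; apply: ge_ereal_sup => _ [X [finX XS] <-].
rewrite fsbig_finite//= sumEFin lee_fin; apply: fc => // x.
by rewrite in_fset_set// inE => /XS.
Qed.

Lemma esum_ge_seq (R : realType) (T : choiceType) (S : set T) (f : T -> R) (s : seq T) :
  uniq s -> {in s, forall x, S x} -> ((\sum_(x <- s) f x)%:E <= \esum_(x in S) (f x)%:E)%E.
Proof.
move=> us sS; apply: esum_ge; exists [set` s]; last by rewrite -fsbig_seq// sumEFin.
by split=> [|x /= /sS//]; apply/finite_seqP; exists s.
Qed.

Lemma ler_sum_subseq (R : numDomainType) (T : eqType) (f : T -> R) (s t : seq T) :
  uniq s -> uniq t -> {subset s <= t} -> (forall x, 0 <= f x) ->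
  \sum_(x <- s) f x <= \sum_(x <- t) f x.
Proof.
move=> us ut st f0; rewrite [leRHS](bigID (mem s)) /= -[leLHS]addr0.
apply: lerD; last exact: sumr_ge0.
rewrite -[leRHS]big_filter le_eqVlt; apply/orP; left; apply/eqP/perm_big.
apply: uniq_perm => // [|x]; first exact: filter_uniq.
by rewrite mem_filter /=; case: (boolP (x \in s)) => [/st ->|].
Qed.

Lemma onem_expn_bernoulli (R : realDomainType) (u : R) m : 0 <= u <= 1 ->
  (1 - u) ^+ m * (1 + m%:R * u) <= 1.
Proof.
move=> /andP[u0 u1]; have u1' : 0 <= 1 - u by rewrite subr_ge0.
elim: m => [|m IH]; first by rewrite mul0r addr0 expr0 mulr1.
apply: le_trans IH; rewrite exprSr -mulrA ler_wpM2l ?exprn_ge0// -natr1.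
have m0 : 0 <= m%:R :> R by [].
by move: (m%:R) m0 => k k0; nra.
Qed.

(** With r = n/(n + 1) one has 1 - 1/n = r (1 - 1/n^2), and Bernoulli's inequality gives (1 -
    1/n^2)^n <= 1/(1 + 1/n) = r. *)
Lemma onem_invn_expn_mono (R : realFieldType) (m n : nat) : (0 < m <= n)%N ->
  (1 - m%:R^-1 : R) ^+ m <= (1 - n%:R^-1) ^+ n.
Proof.
move=> /andP[m0]; elim: n => [|n IH]; first by case: m m0.
rewrite leq_eqVlt => /predU1P[->//|]; rewrite ltnS => mn; apply: le_trans (IH mn) _.
have n0 : 0 < n%:R :> R by rewrite ltr0n (leq_trans m0).
have n1 : 1 <= n%:R :> R by rewrite ler1n (leq_trans m0).
have E1 : 1 - n.+1%:R^-1 = n%:R / n.+1%:R :> R.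
  by rewrite -natr1; field; rewrite gt_eqF// addr_gt0.
have E2 : 1 - n%:R^-1 = n%:R / n.+1%:R * (1 - (n%:R ^+ 2)^-1) :> R.
  by rewrite -natr1; field; rewrite !gt_eqF// addr_gt0.
have u01 : 0 <= ((n%:R ^+ 2)^-1 : R) <= 1.
  by rewrite invr_ge0 exprn_ge0 ?(ltW n0)//= invf_le1 ?exprn_gt0// exprn_ege1.
have h := @onem_expn_bernoulli R (n%:R ^+ 2)^-1 n u01.
have E3 : 1 + n%:R * (n%:R ^+ 2)^-1 = (n%:R / n.+1%:R)^-1 :> R.
  by rewrite -natr1; field; rewrite !gt_eqF// addr_gt0.
have r0 : 0 < n%:R / n.+1%:R :> R by rewrite divr_gt0.
rewrite E2 exprMn E1 [leRHS]exprSr ler_wpM2l ?exprn_ge0 ?(ltW r0)//.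
by move: h; rewrite E3 ler_pdivrMr// mul1r.
Qed.

Lemma card_gt19 (F : finFieldType) : (19 < #|F|)%N -> (23 <= #|F|)%N.
Proof.
have [l [k [lp _ qE]]] := card_prime_power F.
have [k0|k0] := posnP k; first by rewrite qE k0.
have : primes #|F| = [:: l] by rewrite qE primesX// primes_prime.
(* For 20, 21 and 22 [primes] computes to a list with two entries. *)
move: #|F| => n; do 23 (case: n => [//|n]); by [].
Qed.

Section IrrTail.
Variables (R : realType) (F : finFieldType).
Local Notation q := #|F|.
Local Notation y := (q%:R^-1 : R).

Definition irr_term (p : {poly F}) : R :=
  ((pnorm p)%:R * ((pdeg p)%:R + 1) * (pdeg p)%:R)^-1.

Definition irr_tail : \bar R :=
  \esum_(p in [set p : {poly F} | monic_irreducibles p /\ (1 < pdeg p)%N]) (irr_term p)%:E.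

Lemma irr_term_ge0 p : 0 <= irr_term p.
Proof. by rewrite invr_ge0 !mulr_ge0// addr_ge0. Qed.

Lemma sum_irr_term_flatten (r : nat -> seq {poly F}) n :
  (forall d, {in r d, forall p, pdeg p = d}) ->
  \sum_(p <- flatten [seq r d | d <- index_iota 2 n]) irr_term p =
  \sum_(2 <= d < n) (size (r d))%:R * y ^+ d / (d%:R * (d%:R + 1)).
Proof.
move=> rd; rewrite big_flatten big_map; apply: eq_bigr => d _.
rewrite big_seq (eq_bigr (fun=> y ^+ d / (d%:R * (d%:R + 1)))); last first.
  move=> p /rd pd; rewrite /irr_term /pnorm pd natrX exprVn -invfM.
  by congr (_^-1); rewrite -mulrA; congr (_ * _); rewrite mulrC.
by rewrite -big_seq big_const_seq count_predT iter_addr_0 -[LHS]mulr_natl mulrA.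
Qed.

Lemma irr_excess_le_tail (A : seq {poly F}) : ((irr_excess R A)%:E <= irr_tail)%E.
Proof.
rewrite /irr_excess -sum_irr_term_flatten; last by move=> d p /mem_irr_in[].
apply: esum_ge_seq.
  apply: uniq_flatten_deg; [exact: iota_uniq|exact: irr_in_uniq|by move=> d p /mem_irr_in[]].
by move=> p /mem_front[_ pI /andP[]].
Qed.

Lemma irr_tail_ge n :
  ((\sum_(2 <= d < n) (npi F d)%:R * y ^+ d / (d%:R * (d%:R + 1)))%:E <= irr_tail)%E.
Proof.
rewrite -sum_irr_term_flatten; last by move=> d p /mem_irr[].
apply: esum_ge_seq; first by apply: uniq_flatten_irr; exact: iota_uniq.
move=> p /flattenP[_ /mapP[d + ->]] /mem_irr[pI pd].
by rewrite mem_index_iota -pd => /andP[].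
Qed.

Lemma irr_tail_le : (irr_tail <= ((pi ^+ 2 - 9) / 6)%:E)%E.
Proof.
apply: esum_le_seq => s us sI; set N := (\max_(p <- s) pdeg p)%N.
apply: le_trans (tail_sum_le R N).
apply: (@le_trans _ _ (\sum_(p <- flatten [seq irr F d | d <- index_iota 2 N.+1]) irr_term p)).
  apply: ler_sum_subseq => // [|p ps|]; last exact: irr_term_ge0.
    by apply: uniq_flatten_irr; exact: iota_uniq.
  have [pI p1] := sI _ ps; apply/flattenP; exists (irr F (pdeg p)); last exact/mem_irr.
  by apply: map_f; rewrite mem_index_iota p1 ltnS; exact: (@leq_bigmax_seq _ s xpredT).
rewrite sum_irr_term_flatten; last by move=> d p /mem_irr[].
rewrite /tail_sum big_nat [leRHS]big_nat; apply: ler_sum => d /andP[d2 _].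
have d0 : (0 < d)%N by exact: ltnW.
rewrite natr1 expr2 -[in leRHS]mulrA [leRHS]invfM ler_wpM2r//.
rewrite exprVn ler_pdivrMr ?exprn_gt0 ?ltr0n ?(ltnW (card_gt1 F))// mulrC.
by rewrite ler_pdivlMr ?ltr0n// -natrX -natrM ler_nat mulnC npi_le.
Qed.
End IrrTail.

(** The proper divisors of d are at most d/2, so q^d - d pi(d) is at most a geometric sum below
    q^(d-1)/22 <= q^d/(22 * 23), and 22 * 23 = 506. *)
Lemma npi_lower (F : finFieldType) d : (23 <= #|F|)%N -> (3 <= d)%N ->
  (505 * #|F| ^ d <= 506 * (d * npi F d))%N.
Proof.
set q := #|F| => q23 d3; have d0 : (0 < d)%N by exact: leq_trans d3.
have geo h : (22 * \sum_(1 <= e < h.+1) q ^ e <= q ^ h.+1)%N.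
  elim: h => [|h IH]; first by rewrite big_geq.
  rewrite big_nat_recr//= mulnDr [leqRHS]expnS.
  by apply: (@leq_trans (23 * q ^ h.+1)); [rewrite mulSn leq_add2r|rewrite leq_mul2r q23 orbT].
have dd : d \in divisors d by rewrite -dvdn_divisors// dvdnn.
have qd := sum_npi F d0; rewrite (big_rem d) //= -/q in qd.
have rest : (\sum_(e <- rem d (divisors d)) e * npi F e <= \sum_(1 <= e < (d./2).+1) q ^ e)%N.
  apply: (@leq_trans (\sum_(e <- rem d (divisors d)) q ^ e)%N).
    rewrite big_seq [leqRHS]big_seq; apply: leq_sum => e.
    move/mem_rem; rewrite -dvdn_divisors// => ed; apply: npi_le; exact: dvdn_gt0 ed.
  rewrite [leqRHS](bigID (mem (rem d (divisors d)))) /=; apply: leq_trans (leq_addr _ _).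
  rewrite -[leqRHS]big_filter; apply: eq_leq; apply: perm_big; apply: uniq_perm.
  - by rewrite rem_uniq// divisors_uniq.
  - by rewrite filter_uniq// iota_uniq.
  move=> e; rewrite mem_filter; case: (boolP (e \in rem _ _)) => //= + .
  rewrite mem_rem_uniq ?divisors_uniq// inE -dvdn_divisors// mem_index_iota => /andP[ed /dvdnP[k dE]].
  apply/esym; rewrite ltnS; move: ed d0; rewrite dE; case: k dE => [|[|k]] _; rewrite ?mul1n ?eqxx//.
  move=> _; case: e => [|e]; first by rewrite muln0.
  by move=> _; apply: (introT andP); split=> //; rewrite geq_half_double -muln2 mulnC leq_mul2r orbT.
have hd : (q ^ (d./2).+1 <= q ^ d.-1)%N.
  rewrite leq_exp2l ?card_gt1//; have := odd_double_half d; clear -d3; lia.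
have e1 := geo d./2; have e2 : (23 * q ^ d.-1 <= q ^ d)%N.
  by rewrite -{2}(prednK d0) expnS leq_mul2r q23 orbT.
move: rest hd e1 e2 qd; clear.
move: (\sum_(e <- _) _)%N (\sum_(1 <= e < _) _)%N (q ^ _.-1)%N (q ^ _.+1)%N (q ^ d)%N (d * npi F d)%N => a b c e g h.
lia.
Qed.

(** Each term dominates the corresponding difference of 1/(2 d^2), and these telescope. *)
Lemma sum_invn_ge (R : realFieldType) (a b : nat) : (0 < a <= b)%N ->
  (2 * a%:R ^+ 2)^-1 - (2 * b%:R ^+ 2)^-1 <= \sum_(a <= d < b) (d%:R ^+ 2 * d.+1%:R)^-1 :> R.
Proof.
move=> /andP[a0]; elim: b => [|b IH]; first by case: a a0.
rewrite leq_eqVlt => /predU1P[->|]; first by rewrite big_geq// subrr.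
rewrite ltnS => ab; rewrite big_nat_recr//=; have := IH ab.
have b0 : 0 < b%:R :> R by rewrite ltr0n (leq_trans a0).
suff : (2 * b%:R ^+ 2)^-1 - (2 * b.+1%:R ^+ 2)^-1 <= (b%:R ^+ 2 * b.+1%:R)^-1 :> R.
  by move: (_^-1) (_^-1) (_^-1) (_^-1) (\sum_(_ <= _ < _) _) => x z t u s; lra.
rewrite -[b.+1%:R]natr1; move: (b%:R : R) b0 => x x0; rewrite -subr_ge0.
have -> : (x ^+ 2 * (x + 1))^-1 - ((2 * x ^+ 2)^-1 - (2 * (x + 1) ^+ 2)^-1) =
    (2 * x ^+ 2 * (x + 1) ^+ 2)^-1.
  by field; rewrite !gt_eqF//; lra.
by rewrite invr_ge0 !mulr_ge0 ?exprn_ge0//; lra.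
Qed.

Lemma sum_3_41_ge (R : realFieldType) :
  611 / 10 ^+ 4 <= \sum_(3 <= d < 41) (d%:R ^+ 2 * d.+1%:R)^-1 :> R.
Proof.
rewrite (@big_cat_nat _ _ _ 11)//=.
have := @sum_invn_ge R 11 41 isT; move: (\sum_(11 <= _ < _) _) => s.
rewrite /index_iota /= !big_cons big_nil; lra.
Qed.

Lemma onem_inv23_expn (R : realFieldType) : 3597 / 10 ^+ 4 <= (1 - 23%:R^-1 : R) ^+ 23.
Proof. lra. Qed.

Lemma onem_inv19_expn (R : realFieldType) : (1 - 19%:R^-1 : R) ^+ 19 <= 358 / 10 ^+ 3.
Proof. lra. Qed.

Section Comparison.
Variables (R : realType) (F : finFieldType).
Local Notation q := #|F|.
Local Notation y := (q%:R^-1 : R).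
Local Notation G := (expR (euler_gamma : R)).

Lemma card_gt0R : 0 < q%:R :> R.
Proof. by rewrite ltr0n (ltnW (card_gt1 F)). Qed.

Lemma npi2_mass : (npi F 2)%:R * y ^+ 2 = (1 - y) / 2.
Proof.
have q0 := card_gt0R; have /(congr1 (fun n => n%:R : R)) := npi_prime F (isT : prime 2).
rewrite natrD natrM natrX => e.
have -> : (npi F 2)%:R = (q%:R ^+ 2 - q%:R) / 2 :> R by rewrite -e; field.
by move: (q%:R : R) q0 => z z0; field; rewrite gt_eqF.
Qed.

(** At q = 23 the comparison with e^gamma has a margin of about 2/10000; so degree 2 is counted
    exactly, and degrees 3 to 40 lose only the factor 505/506. *)
Lemma irr_tail_lower : (23 <= q)%N -> (((1 - y) / 12 + 609 / 10 ^+ 4)%:E <= irr_tail R F)%E.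
Proof.
move=> q23; apply: le_trans (irr_tail_ge R F 41); rewrite lee_fin big_ltn// npi2_mass.
apply: lerD; first by rewrite le_eqVlt; apply/orP; left; apply/eqP; field; rewrite gt_eqF// card_gt0R.
apply: (@le_trans _ _ (505 / 506 * \sum_(3 <= d < 41) (d%:R ^+ 2 * d.+1%:R)^-1)).
  have := sum_3_41_ge R; move: (\sum_(_ <= _ < _) _) => s; lra.
rewrite mulr_sumr [leLHS]big_nat [leRHS]big_nat; apply: ler_sum => d /andP[d3 _].
have d0 : 0 < d%:R :> R by rewrite ltr0n (leq_trans _ d3).
have qd : 0 < q%:R ^+ d :> R by rewrite exprn_gt0// card_gt0R.
have : (505%:R : R) * q%:R ^+ d <= 506%:R * (d%:R * (npi F d)%:R).
  by rewrite -natrX -!natrM ler_nat npi_lower.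
move=> h; rewrite exprVn -[d.+1%:R]natr1 -subr_ge0.
have -> : (npi F d)%:R / q%:R ^+ d / (d%:R * (d%:R + 1)) - 505 / 506 / (d%:R ^+ 2 * (d%:R + 1)) =
    (506 * (d%:R * (npi F d)%:R) - 505 * q%:R ^+ d) / (506 * q%:R ^+ d * d%:R ^+ 2 * (d%:R + 1)) :> R.
  move: (npi F d)%:R (q%:R ^+ d) (d%:R : R) d0 qd => a b c c0 b0.
  by field; rewrite !gt_eqF//; lra.
apply: divr_ge0; first by rewrite subr_ge0.
rewrite -mulrA -mulrA; apply: mulr_ge0; first exact: ler0n.
by rewrite mulr_ge0 ?(ltW qd)// mulr_ge0 ?exprn_ge0 ?(ltW d0)// addr_ge0 ?(ltW d0).
Qed.

(** The degree 2 term is at most (1 - 1/q)/12 instead of 1/12, a saving of at least 1/228 without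
    which q = 19 would fail. *)
Lemma irr_excess_small (A : seq {poly F}) : (q <= 19)%N -> irr_excess R A <= 141 / 10 ^+ 3.
Proof.
move=> q19; rewrite /irr_excess; set N := (\max_(a <- A) pdeg a)%N.
have [N1|N2] := leqP N.+1 2.
  by rewrite big_geq// divr_ge0 ?exprn_ge0.
have t145 := tail_sum_le_decimal R N; move: t145; rewrite /tail_sum.
rewrite [X in X <= _ -> _]big_ltn// [X in _ -> X <= _]big_ltn//.
have y19 : 19%:R^-1 <= y by rewrite lef_pV2 ?posrE ?ltr0n ?ler_nat// (ltnW (card_gt1 F)).
have t2 : (size (irr_in A 2))%:R * y ^+ 2 / (2 * (2 + 1)) <= (1 - y) / 2 / (2 * (2 + 1)).
  rewrite ler_wpM2r ?invr_ge0 ?mulr_ge0 ?addr_ge0// -npi2_mass.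
  by rewrite ler_wpM2r ?exprn_ge0 ?invr_ge0// ler_nat size_irr_in_le.
have : \sum_(3 <= d < N.+1) (size (irr_in A d))%:R * y ^+ d / (d%:R * (d%:R + 1)) <=
    \sum_(3 <= d < N.+1) (d%:R ^+ 2 * d.+1%:R)^-1 :> R.
  rewrite big_nat [leRHS]big_nat; apply: ler_sum => d /andP[d3 _].
  rewrite natr1 expr2 -[in leRHS]mulrA [leRHS]invfM ler_wpM2r//.
  by apply: irr_in_mass_le; exact: leq_trans d3.
move: (\sum_(_ <= _ < _) _) (\sum_(_ <= _ < _) _) t2 y19 => a b.
move: ((size _)%:R * y ^+ 2 / _) => u; move: y => z; clear.
have -> : (2 ^+ 2 * 3)^-1 = 1 / 12 :> R by field.
have -> : (1 - z) / 2 / (2 * (2 + 1)) = (1 - z) / 12 by field.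
lra.
Qed.

Lemma erdos_bound_small (A : seq {poly F}) : (3 <= q <= 19)%N ->
  1 + G * (1 - y) ^+ q + irr_excess R A <= G.
Proof.
move=> /andP[q3 q19]; have := irr_excess_small A q19.
have h1 : (1 - y) ^+ q <= 358 / 10 ^+ 3.
  apply: le_trans (onem_inv19_expn R); apply: onem_invn_expn_mono.
  by rewrite q19 (leq_trans _ q3).
have /andP[g0 g1] := expR_gamma_bounds R.
have := ler_wpM2l (expR_ge0 euler_gamma) h1.
by move: (expR _) (_ ^+ q) g0 g1 (irr_excess _ _) => g a g0 g1 e; lra.
Qed.

Lemma erdos_bound_large : (19 < q)%N ->
  (G%:E <= (1 + G * (1 - y) ^+ q)%:E + irr_tail R F)%E.
Proof.
move=> /card_gt19 q23; apply: le_trans (leeD2l _ (irr_tail_lower q23)).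
rewrite -EFinD lee_fin.
have h1 : 3597 / 10 ^+ 4 <= (1 - y) ^+ q.
  by apply: le_trans (onem_inv23_expn R) _; apply: onem_invn_expn_mono.
have y23 : y <= 23%:R^-1 by rewrite lef_pV2 ?posrE ?ltr0n ?ler_nat// (ltnW (card_gt1 F)).
have /andP[g0 g1] := expR_gamma_bounds R.
have := ler_wpM2l (expR_ge0 euler_gamma) h1.
move: ((1 - y) ^+ q) => a; move: (expR _) g0 g1 => g g0 g1.
move: y y23 g0 g1 => z; clear; lra.
Qed.

(** Strictness comes from 1 - 1/q < exp(-1/q), raised to the power q. *)
Lemma erdos_bound_limit : exists2 e : R, irr_tail R F = e%:E &
  1 + G * (1 - y) ^+ q + e < 1 + expR (euler_gamma - 1) + (pi ^+ 2 - 9) / 6.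
Proof.
have le := irr_tail_le R F.
have ge : (0 <= irr_tail R F)%E by apply: esum_ge0 => p _; rewrite lee_fin irr_term_ge0.
have fin : irr_tail R F \is a fin_num by rewrite ge0_fin_numE// (le_lt_trans le)// ltry.
exists (fine (irr_tail R F)); first by rewrite fineK.
have le' : fine (irr_tail R F) <= (pi ^+ 2 - 9) / 6 by rewrite -lee_fin fineK.
apply: ltr_leD => //; rewrite ltrD2l expRD ltr_pM2l ?expR_gt0//.
have /andP[y0 y1] := invq_itv R F.
have -> : -1 = - y * q%:R by rewrite mulNr mulVf// gt_eqF// card_gt0R.
rewrite expRM_natr ltrXn2r ?subr_ge0 ?(ltW y1)//; last by rewrite expR_gt1Dx// oppr_eq0 gt_eqF.
by rewrite -lt0n (ltnW (card_gt1 F)).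
Qed.

(** A primitive set containing 1 is {1}, because 1 divides every polynomial; so all members here
    have positive degree. *)
Lemma primitive_erdos_finite (A : set {poly F}) (s : seq {poly F}) :
  monic_set A -> primitive_set A -> A <> [set 1] -> (3 <= q)%N ->
  uniq s -> {in s, forall a, A a} ->
  \sum_(a <- s) erdos_term R a <= G \/
  \sum_(a <- s) erdos_term R a <= 1 + G * (1 - y) ^+ q + irr_excess R s.
Proof.
move=> monA primA A1 q3 us sA; apply: erdos_finite => //.
  by move=> a b /sA ? /sA ?; exact: primA.
move=> a /sA aA; split; first exact: monA.
have nA1 : ~ A 1.
  move=> A1'; apply: A1; apply/seteqP; split=> [b bA|_ ->//].
  by apply/esym/primA => //; exact: dvd1p.
rewrite ltnNge; apply/negP => sa; apply: nA1.
suff <- : a = 1 by [].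
have am := monA _ aA; move: am; rewrite (size1_polyC sa) monicE lead_coefC => /eqP->.
by rewrite polyC1.
Qed.
End Comparison.

Theorem theorem4p5 (R : realType) (F : finFieldType) (q : nat)
    (q_card : #|F| = q) (A : set {poly F}) (A_monic : monic_set A)
    (A_primitive : primitive_set A) (A_neq1 : A <> [set 1]) :
  [/\ (* decimal expansions, truncated after five places *)
      1 + 78 / 10 ^+ 2 + 107 / 10 ^+ 5 <= expR (euler_gamma : R)
        < 1 + 78 / 10 ^+ 2 + 108 / 10 ^+ 5,
      1 + 80 / 10 ^+ 2 + 15 / 10 ^+ 5
        <= 1 + expR (euler_gamma - 1) + ((pi : R) ^+ 2 - 9) / 6
        < 1 + 80 / 10 ^+ 2 + 16 / 10 ^+ 5,
      (3 <= q <= 19)%N ->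
        (erdos_sum R A <= (expR euler_gamma)%:E)%E
    & (19 < q)%N ->
        let B : \bar R :=
          ((1 + expR euler_gamma * (1 - q%:R^-1) ^+ q)%:E
           + \esum_(p in [set p : {poly F} | monic_irreducibles p /\ (1 < pdeg p)%N])
               (((pnorm p)%:R * ((pdeg p)%:R + 1) * (pdeg p)%:R)^-1)%:E)%E in
        (erdos_sum R A <= B)%E /\
        (B < (1 + expR (euler_gamma - 1) + (pi ^+ 2 - 9) / 6)%:E)%E].

Proof.
subst q; have fin := fun s => @primitive_erdos_finite R F A s A_monic A_primitive A_neq1.
split.
- exact: expR_gamma_decimals.
- exact: limit_bound_decimals.
- move=> q319; have /andP[q3 _] := q319; apply: esum_le_seq => s us sA.
  have [//|h] := fin s q3 us sA; exact: le_trans h (erdos_bound_small R s q319).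
move=> q19 B; have q3 : (3 <= #|F|)%N by exact: leq_trans q19.
have [e eE eB] := erdos_bound_limit R F.
have BE : B = (1 + expR euler_gamma * (1 - #|F|%:R^-1) ^+ #|F| + e)%:E by rewrite EFinD -eE.
split; last by rewrite BE lte_fin.
(* A finite part may fall under either alternative; e^gamma is at most [B] because q > 19. *)
rewrite BE; apply: esum_le_seq => s us sA; have [h|h] := fin s q3 us sA.
  by apply: (le_trans h); rewrite -lee_fin EFinD -eE; exact: erdos_bound_large.
apply: (le_trans h); rewrite lerD2l -lee_fin -eE; exact: irr_excess_le_tail.
Qed.
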